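(* There are $4$ types of symmetric regular twisted superpotentials $\omega\in V^{\otimes3}$ up to linear change of variables, where $V$ has basis $x,y,z$: every symmetric regular twisted superpotential is, after a linear change of variables, of exactly one of the following types: Type S: $xyz+yzx+zxy+xzy+zyx+yxz$; Type S$'$: $xyz+yzx+zxy+xzy+zyx+yxz+x^3$; Type NC: $xyz+yzx+zxy+xzy+zyx+yxz+x^3+y^3$; Type EC: $xyz+yzx+zxy+xzy+zyx+yxz+\xi(x^3+y^3+z^3)$, where $\xi\in k$, $\xi\neq0$, $\xi\neq-2$, $\xi\neq1\pm\sqrt{-3}$ and $\xi^3\neq1$. Moreover, the potentials of Type S, Type S$'$, Type NC and Type EC (the latter for every $\xi\in k$ with $\xi\neq0$, $\xi\neq-2$, $\xi\neq1\pm\sqrt{-3}$ and $\xi^3\neq1$) are all symmetric regular superpotentials.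
   Context: Let $k$ be an algebraically closed field of characteristic zero and $V$ a $3$-dimensional $k$-vector space with basis $x,y,z$; tensor symbols are omitted in monomials such as $xyz=x\otimes y\otimes z$. For $\omega=x\otimes\omega_x+y\otimes\omega_y+z\otimes\omega_z\in V^{\otimes3}$ (a potential) put $\mathcal{D}(\omega)=T(V)/(\omega_x,\omega_y,\omega_z)$. Let $\varphi(u_1\otimes u_2\otimes u_3)=u_2\otimes u_3\otimes u_1$. The potential $\omega$ is a superpotential if $\varphi(\omega)=\omega$, and a twisted superpotential if $(\sigma\otimes\mathrm{id}\otimes\mathrm{id})\varphi(\omega)=\omega$ for some $\sigma\in\mathrm{GL}(V)$. It is symmetric if it is invariant under all permutations of the three tensor factors. It is regular if $\mathcal{D}(\omega)$ is a $3$-dimensional quantum polynomial algebra, i.e. a noetherian connected graded algebra $S$ of global dimension $3$ with $\operatorname{Ext}^i_S(k,S)\cong k$ for $i=3$ and $0$ otherwise, and Hilbert series $(1-t)^{-3}$. A linear change of variables is the action of an element of $\mathrm{GL}(V)$ on $V^{\otimes3}$ (diagonally). *)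

(* Defs.v *)
From HB Require Import structures.
From mathcomp Require Import all_boot all_order all_algebra all_fingroup.
From mathcomp Require Import generic_quotient ring_quotient boolp.
From mathcomp Require Import finmap monalg.

Set Implicit Arguments.
Unset Strict Implicit.
Unset Printing Implicit Defensive.

Import GRing.Theory.
Local Open Scope ring_scope.
Local Open Scope quotient_scope.

(* Modules are left modules (lmodType R); right R-modules are left modules over
   the converse ring R^c. *)

Definition left_noetherian (R : nzRingType) : Prop :=
  forall I : R -> Prop,
    I 0 ->
    (forall a b, I a -> I b -> I (a + b)) ->
    (forall r a, I a -> I (r * a)) ->
    exists gens : seq R,
      forall a, I a <->
        exists c : 'I_(size gens) -> R, a = \sum_i c i * gens`_i.

Definition noetherian (R : nzRingType) : Prop :=
  left_noetherian R /\ left_noetherian R^c.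

Definition projective (R : nzRingType) (P : lmodType R) : Prop :=
  forall (A B : lmodType R) (g : {linear A -> B}) (f : {linear P -> B}),
    (forall b, exists a, g a = b) ->
    exists h : {linear P -> A}, forall p, g (h p) = f p.

(* ... -> res_obj 2 -> res_obj 1 -> res_obj 0 -> M -> 0 *)
Record proj_resolution (R : nzRingType) (M : lmodType R) := ProjResolution {
  res_obj :> nat -> lmodType R;
  res_diff : forall n, {linear res_obj n.+1 -> res_obj n};
  res_aug : {linear res_obj 0%N -> M};
  res_projective : forall n, projective (res_obj n);
  res_aug_surj : forall m, exists p, res_aug p = m;
  res_exact0 : forall p, res_aug p = 0 <-> exists q, res_diff 0 q = p;
  res_exactS : forall n p,
    res_diff n p = 0 <-> exists q, res_diff n.+1 q = p
}.

Definition pd_le (R : nzRingType) (M : lmodType R) (n : nat) : Prop :=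
  exists P : proj_resolution M, forall m, (n < m)%N -> forall p : P m, p = 0.

Definition left_gldim_le (R : nzRingType) (n : nat) : Prop :=
  forall M : lmodType R, pd_le M n.

Definition left_gldim (R : nzRingType) (n : nat) : Prop :=
  left_gldim_le R n /\ forall m, (m < n)%N -> ~ left_gldim_le R m.

(* For noetherian rings the two conditions are equivalent. *)
Definition gldim (R : nzRingType) (n : nat) : Prop :=
  left_gldim R n /\ left_gldim R^c n.

Section Ext.
Variables (R : nzRingType) (M : lmodType R).

(* The complex Hom_R(P, R); R^o is R as a left module over itself. *)
Definition cocycle (P : proj_resolution M) (i : nat) (g : P i -> R^o) : Prop :=
  linear g /\ forall p, g (res_diff P i p) = 0.

Definition coboundary (P : proj_resolution M) (i : nat) : (P i -> R^o) -> Prop :=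
  match i with
  | 0%N => fun g => forall p, g p = 0
  | j.+1 => fun g => exists h : P j -> R^o,
      linear h /\ forall p, g p = h (res_diff P j p)
  end.

(* Ext^i_R(M, R) = 0. As for [Ext_iso], the choice of the resolution does not
   matter. *)
Definition Ext_vanishes (i : nat) : Prop :=
  exists P : proj_resolution M,
    forall g : P i -> R^o, cocycle g -> coboundary g.

(* Ext^i_R(M, R) is isomorphic to E as a right R-module, the right action being
   (g . r)(p) = g(p) * r. The isomorphism is presented as a surjection theta
   from cocycles to E whose kernel consists of the coboundaries. *)
Definition Ext_iso (i : nat) (E : lmodType R^c) : Prop :=
  exists (P : proj_resolution M) (theta : (P i -> R^o) -> E),
    [/\ forall g h, cocycle g -> cocycle h ->
          theta (fun p => g p + h p) = theta g + theta h,
        forall (r : R) g, cocycle g ->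
          theta (fun p => (g p : R) * r) = (r : R^c) *: theta g,
        forall e, exists2 g, cocycle g & theta g = e
      & forall g, cocycle g -> (theta g = 0 <-> coboundary g)].

End Ext.

(* The field k as an R-module through a ring morphism R -> k. *)
Definition trivial_module (k : fieldType) (R : nzRingType)
  (eps : {rmorphism R -> k}) : Type := k.

Section TrivialModule.
Variables (k : fieldType) (R : nzRingType) (eps : {rmorphism R -> k}).
Local Notation E := (trivial_module eps).

HB.instance Definition _ := GRing.Zmodule.copy E k.

Let scale (r : R) (c : E) : E := eps r * (c : k).

Fact trivial_scalerA a b c : scale a (scale b c) = scale (a * b) c.
Proof. by rewrite /scale rmorphM mulrA. Qed.

Fact trivial_scale1r : left_id 1 scale.
Proof. by move=> c; rewrite /scale rmorph1 mul1r. Qed.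

Fact trivial_scalerDr : right_distributive scale +%R.
Proof. by move=> a b c; rewrite /scale mulrDr. Qed.

Fact trivial_scalerDl c : {morph scale^~ c : a b / a + b}.
Proof. by move=> a b; rewrite /scale rmorphD mulrDl. Qed.

HB.instance Definition _ := GRing.Zmodule_isLmodule.Build R E
  trivial_scalerA trivial_scale1r trivial_scalerDr trivial_scalerDl.

Definition aug_conv (r : R^c) : k := eps r.

Fact aug_conv_is_zmod_morphism : zmod_morphism aug_conv.
Proof. exact: (rmorphB eps). Qed.

Fact aug_conv_is_monoid_morphism : monoid_morphism aug_conv.
Proof.
split; first exact: (rmorph1 eps).
by move=> a b; rewrite /aug_conv [LHS](rmorphM eps) mulrC.
Qed.

HB.instance Definition _ :=
  GRing.isZmodMorphism.Build R^c k aug_conv aug_conv_is_zmod_morphism.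
HB.instance Definition _ :=
  GRing.isMonoidMorphism.Build R^c k aug_conv aug_conv_is_monoid_morphism.

End TrivialModule.

(* The ring R^c is given explicitly, as unification sees through converse and
   would pick the left module structure. *)
Definition right_trivial_module (k : fieldType) (R : nzRingType)
    (eps : {rmorphism R -> k}) : lmodType R^c :=
  @trivial_module k R^c (aug_conv eps).

Section Graded.
Variables (k : fieldType) (S : algType k) (gr : nat -> S -> Prop).

(* gr n is the degree n part of S. *)
Definition graded_algebra : Prop :=
  [/\ forall n, gr n 0 /\
        forall (c : k) a b, gr n a -> gr n b -> gr n (c *: a + b),
      gr 0%N 1,
      forall m n a b, gr m a -> gr n b -> gr (m + n)%N (a * b),
      forall a, exists (N : nat) (f : nat -> S),
        (forall n, gr n (f n)) /\ a = \sum_(n < N) f n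
    & forall (N : nat) (f : nat -> S),
        (forall n, gr n (f n)) -> \sum_(n < N) f n = 0 ->
        forall n, (n < N)%N -> f n = 0].

Definition connected_graded : Prop :=
  graded_algebra /\ forall a, gr 0%N a <-> exists c : k, a = c%:A.

Definition has_dim (U : S -> Prop) (n : nat) : Prop :=
  exists e : 'I_n -> S,
    (forall c : 'I_n -> k, \sum_i c i *: e i = 0 -> forall i, c i = 0) /\
    forall a, U a <-> exists c : 'I_n -> k, a = \sum_i c i *: e i.

(* H_S(t) = (1 - t)^(-d), i.e. the product of the power series H_S(t) with the
   polynomial (1 - t)^d is 1. *)
Definition hilbert_series_inv_pow (d : nat) : Prop :=
  exists h : nat -> nat,
    (forall n, has_dim (gr n) (h n)) /\
    forall n, \sum_(i < n.+1) ((1 - 'X : {poly int}) ^+ d)`_i * (h (n - i)%N)%:R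
              = (n == 0%N)%:R.

(* The augmentation S -> S / S_{>0} = k; it is unique. *)
Definition is_augmentation (eps : S -> k) : Prop :=
  (forall c : k, eps c%:A = c) /\ forall n a, gr n.+1 a -> eps a = 0.

Definition quantum_polynomial_algebra (d : nat) : Prop :=
  [/\ noetherian S,
      connected_graded,
      gldim S d,
      exists2 eps : {rmorphism S -> k}, is_augmentation eps &
        Ext_iso (trivial_module eps) d (right_trivial_module eps) /\
        forall i, i != d -> Ext_vanishes (trivial_module eps) i
    & hilbert_series_inv_pow d].

End Graded.

(* V = k^3 with its standard basis x, y, z indexed by 'I_3. A tensor in
   V (x) V (x) V is given by its coefficients on the monomials e_a e_b e_c; the
   codomain k^o (k as a module over itself) provides the vector space
   structure. *)
Definition tensor3 (k : fieldType) := {ffun 3.-tuple 'I_3 -> k^o}.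

Definition vx : 'I_3 := @Ordinal 3 0 isT.
Definition vy : 'I_3 := @Ordinal 3 1 isT.
Definition vz : 'I_3 := @Ordinal 3 2 isT.

Section Potentials.
Variable k : fieldType.
Implicit Types (w : tensor3 k) (g sigma : 'M[k]_3).

Definition mon (a b c : 'I_3) : tensor3 k :=
  [ffun t => (t == [tuple a; b; c])%:R].

(* A matrix g acts on V by g(e_i) = sum_a g_{a i} e_a. *)
Definition gl_act g w : tensor3 k :=
  [ffun t => \sum_(u : 3.-tuple 'I_3)
               (\prod_(i < 3) g (tnth t i) (tnth u i)) * w u].

Definition gl_act_first g w : tensor3 k :=
  [ffun t : 3.-tuple 'I_3 =>
     \sum_(i < 3) g (thead t) i * w [tuple i; tnth t 1; tnth t 2]].

(* u1 u2 u3 |-> u2 u3 u1: the coefficient of abc in the image is the coefficient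
   of cab in w. *)
Definition cyc w : tensor3 k :=
  [ffun t : 3.-tuple 'I_3 => w [tuple tnth t 2; tnth t 0; tnth t 1]].

Definition superpotential w : Prop := cyc w = w.

Definition twisted_superpotential w : Prop :=
  exists2 sigma, sigma \in unitmx & gl_act_first sigma (cyc w) = w.

Definition perm_act (s : 'S_3) w : tensor3 k :=
  [ffun t : 3.-tuple 'I_3 => w [tuple tnth t (s i) | i < 3]].

Definition symmetric_potential w : Prop := forall s : 'S_3, perm_act s w = w.

Definition linear_change w w' : Prop :=
  exists2 g, g \in unitmx & gl_act g w = w'.

End Potentials.

Section TensorAlgebra.
Variable k : fieldType.

Definition tensor_alg : Type := {malg k[{fmonom 'I_3}]}.
HB.instance Definition _ := GRing.Lalgebra.on tensor_alg.

Fact tensor_alg_scalerAr (c : k) (a b : tensor_alg) :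
  c *: (a * b) = a * (c *: b).
Proof.
apply/malgP => m; rewrite mcoeffZ.
rewrite (mcoeffMlw _ (fsubset_refl _) (fsubset_refl _)).
rewrite (mcoeffMlw _ (fsubset_refl _) (msuppZ_le c b)) mulr_sumr.
apply: eq_bigr => m1 _; rewrite mulr_sumr; apply: eq_bigr => m2 _.
by rewrite mcoeffZ mulrnAr mulrCA.
Qed.

HB.instance Definition _ :=
  GRing.Lalgebra_isAlgebra.Build k tensor_alg tensor_alg_scalerAr.

Definition gen (i : 'I_3) : tensor_alg := << fmu i >>.

Definition tensor_homog (n : nat) (a : tensor_alg) : Prop :=
  forall m : {fmonom 'I_3}, m \in msupp a -> size m = n.

End TensorAlgebra.

(* D(w) is the quotient of T(V) by the two-sided ideal (w_x, w_y, w_z). *)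
Section Derivation.
Variables (k : fieldType) (w : tensor3 k).
Local Notation T := (tensor_alg k).

(* w = sum_i e_i (x) w_i *)
Definition rel_of (i : 'I_3) : T :=
  \sum_(j < 3) \sum_(l < 3) w [tuple i; j; l] *: (gen k j * gen k l).

Definition rel_ideal : {pred T} := [pred a : T |
  `[< exists s : seq (T * 'I_3 * T),
        a = \sum_(p <- s) p.1.1 * rel_of p.1.2 * p.2 >]].

Fact rel_ideal_zmod_closed : zmod_closed rel_ideal.
Proof.
split=> [|a b]; rewrite !inE; first by apply/asboolP; exists [::]; rewrite big_nil.
move=> /asboolP[s ->] /asboolP[s' ->]; apply/asboolP.
exists (s ++ [seq (- p.1.1, p.1.2, p.2) | p <- s']).
rewrite big_cat big_map -sumrN; congr (_ + _).
by apply: eq_bigr => p _; rewrite !mulNr.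
Qed.
HB.instance Definition _ :=
  GRing.isZmodClosed.Build T rel_ideal rel_ideal_zmod_closed.

Fact rel_idealMl a b : b \in rel_ideal -> a * b \in rel_ideal.
Proof.
rewrite !inE => /asboolP[s ->]; apply/asboolP.
exists [seq (a * p.1.1, p.1.2, p.2) | p <- s].
by rewrite big_map mulr_sumr; apply: eq_bigr => p _; rewrite !mulrA.
Qed.

Fact rel_idealMr a b : a \in rel_ideal -> a * b \in rel_ideal.
Proof.
rewrite !inE => /asboolP[s ->]; apply/asboolP.
exists [seq (p.1.1, p.1.2, p.2 * b) | p <- s].
by rewrite big_map mulr_suml; apply: eq_bigr => p _; rewrite !mulrA.
Qed.

Fact rel_ideal1 : 1 \notin rel_ideal.
Proof.
pose cst : {rmorphism {malg k[{fmonom 'I_3}]} -> k} :=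
  @mcoeff {fmonom 'I_3} k mone.
have cst_gen i : cst (gen k i) = 0 by rewrite /cst /= mcoeffU1 fm1_eq1.
rewrite !inE; apply/asboolP => -[s /(congr1 cst)].
rewrite rmorph1 rmorph_sum big1 => [/eqP|p _]; first by rewrite oner_eq0.
rewrite !rmorphM /= [X in _ * X * _](_ : _ = 0) ?mulr0 ?mul0r //.
rewrite rmorph_sum big1 // => j _; rewrite rmorph_sum big1 // => l _.
rewrite /= mcoeffZ [X in _ * X](_ : _ = 0) ?mulr0 //.
by rewrite -[LHS]/(cst _) rmorphM /= -[X in X * _]/(cst _) cst_gen mul0r.
Qed.

Definition deriv_quot : Type := Quotient.quot rel_ideal.
HB.instance Definition _ := GRing.Zmodule.on deriv_quot.

Definition D_pi (a : T) : deriv_quot := \pi_(Quotient.quot rel_ideal) a.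

Let rep (a : deriv_quot) : T := repr (a : Quotient.quot rel_ideal).

Let repK a : D_pi (rep a) = a.
Proof. exact: reprK. Qed.

Let eqD a b : (D_pi a == D_pi b) = (a - b \in rel_ideal).
Proof. by rewrite Quotient.idealrBE. Qed.

Let rep_pi a : rep (D_pi a) - a \in rel_ideal.
Proof. by rewrite -eqD repK. Qed.

Fact D_pi_is_zmod_morphism : zmod_morphism D_pi.
Proof. by move=> a b; rewrite /D_pi raddfB. Qed.
HB.instance Definition _ :=
  GRing.isZmodMorphism.Build T deriv_quot D_pi D_pi_is_zmod_morphism.

Let one : deriv_quot := D_pi 1.
Let mul (a b : deriv_quot) : deriv_quot := D_pi (rep a * rep b).
Let scale (c : k) (a : deriv_quot) : deriv_quot := D_pi (c *: rep a).

Let mulE a b : mul (D_pi a) (D_pi b) = D_pi (a * b).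
Proof.
apply/eqP; rewrite eqD.
rewrite (_ : _ - _ = (rep (D_pi a) - a) * rep (D_pi b)
                     + a * (rep (D_pi b) - b)).
  by apply: rpredD; [apply: rel_idealMr | apply: rel_idealMl]; apply: rep_pi.
by rewrite mulrBl mulrBr addrA subrK.
Qed.

Let scaleE c a : scale c (D_pi a) = D_pi (c *: a).
Proof.
apply/eqP; rewrite eqD -scalerBr.
by rewrite -[_ - _]mul1r scalerAl rel_idealMl ?rep_pi.
Qed.

Fact D_mulA : associative mul.
Proof.
by move=> a b c; rewrite -[a]repK -[b]repK -[c]repK !mulE mulrA.
Qed.

Fact D_mul1r : left_id one mul.
Proof. by move=> a; rewrite -[a]repK mulE mul1r. Qed.

Fact D_mulr1 : right_id one mul.
Proof. by move=> a; rewrite -[a]repK mulE mulr1. Qed.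

Fact D_mulrDl : left_distributive mul +%R.
Proof.
move=> a b c; rewrite -[a]repK -[b]repK -[c]repK.
by rewrite -raddfD !mulE -raddfD mulrDl.
Qed.

Fact D_mulrDr : right_distributive mul +%R.
Proof.
move=> a b c; rewrite -[a]repK -[b]repK -[c]repK.
by rewrite -raddfD !mulE -raddfD mulrDr.
Qed.

Fact D_one_neq0 : one != 0.
Proof. by rewrite -(raddf0 D_pi) eqD subr0 rel_ideal1. Qed.

HB.instance Definition _ := GRing.Zmodule_isNzRing.Build deriv_quot
  D_mulA D_mul1r D_mulr1 D_mulrDl D_mulrDr D_one_neq0.

Fact D_scalerA a b v : scale a (scale b v) = scale (a * b) v.
Proof. by rewrite -[v]repK !scaleE scalerA. Qed.

Fact D_scale1r : left_id 1 scale.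
Proof. by move=> v; rewrite -[v]repK scaleE scale1r. Qed.

Fact D_scalerDr : right_distributive scale +%R.
Proof.
move=> a u v; rewrite -[u]repK -[v]repK.
by rewrite -raddfD !scaleE -raddfD scalerDr.
Qed.

Fact D_scalerDl v : {morph scale^~ v : a b / a + b}.
Proof. by move=> a b; rewrite -[v]repK !scaleE -raddfD scalerDl. Qed.

HB.instance Definition _ := GRing.Zmodule_isLmodule.Build k deriv_quot
  D_scalerA D_scale1r D_scalerDr D_scalerDl.

Fact D_scalerAl (c : k) (u v : deriv_quot) : c *: (u * v) = (c *: u) * v.
Proof.
rewrite -[u]repK -[v]repK.
by rewrite [RHS](congr1 (mul^~ _) (scaleE _ _)) [RHS]mulE
           [LHS](congr1 (scale c) (mulE _ _)) [LHS]scaleE scalerAl.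
Qed.

HB.instance Definition _ :=
  GRing.Lmodule_isLalgebra.Build k deriv_quot D_scalerAl.

Fact D_scalerAr (c : k) (u v : deriv_quot) : c *: (u * v) = u * (c *: v).
Proof.
rewrite -[u]repK -[v]repK.
by rewrite [RHS](congr1 (mul _) (scaleE _ _)) [RHS]mulE
           [LHS](congr1 (scale c) (mulE _ _)) [LHS]scaleE scalerAr.
Qed.

HB.instance Definition _ :=
  GRing.Lalgebra_isAlgebra.Build k deriv_quot D_scalerAr.

Fact D_pi_is_monoid_morphism : monoid_morphism D_pi.
Proof. by split=> // a b; rewrite [RHS]mulE. Qed.
HB.instance Definition _ :=
  GRing.isMonoidMorphism.Build T deriv_quot D_pi D_pi_is_monoid_morphism.

Fact D_pi_is_scalable : scalable D_pi.
Proof. by move=> c a; rewrite [RHS]scaleE. Qed.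
HB.instance Definition _ :=
  GRing.isScalable.Build k T deriv_quot *:%R D_pi D_pi_is_scalable.

Definition D_alg : algType k := deriv_quot.

(* The grading induced by the word length, i.e. deg x = deg y = deg z = 1. *)
Definition D_gr (n : nat) (a : D_alg) : Prop :=
  exists2 b : T, tensor_homog n b & a = D_pi b.

Definition regular_potential : Prop := quantum_polynomial_algebra D_gr 3.

End Derivation.

Inductive potential_type := TypeS | TypeS' | TypeNC | TypeEC.

Section Types.
Variable k : fieldType.

Definition pot_S : tensor3 k :=
  mon k vx vy vz + mon k vy vz vx + mon k vz vx vy
  + mon k vx vz vy + mon k vz vy vx + mon k vy vx vz.

Definition pot_S' : tensor3 k := pot_S + mon k vx vx vx.

Definition pot_NC : tensor3 k := pot_S + mon k vx vx vx + mon k vy vy vy.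

Definition pot_EC (xi : k) : tensor3 k :=
  pot_S + xi *: (mon k vx vx vx + mon k vy vy vy + mon k vz vz vz).

(* s ranges over the square roots of -3 *)
Definition EC_parameter (xi : k) : Prop :=
  [/\ xi <> 0,
      xi <> - 2%:R,
      forall s : k, s ^+ 2 = - 3%:R -> xi <> 1 + s /\ xi <> 1 - s
    & xi ^+ 3 <> 1].

Definition has_type (ty : potential_type) (w : tensor3 k) : Prop :=
  match ty with
  | TypeS => w = pot_S
  | TypeS' => w = pot_S'
  | TypeNC => w = pot_NC
  | TypeEC => exists2 xi, EC_parameter xi & w = pot_EC xi
  end.

End Types.

(* Main.v *)
(* All four types are of the form 6xyz + al x^3 + be y^3 + ga z^3 (6xyz standing
   for the full symmetrization of xyz) with al be ga <> 1.

   Regularity. In D(w) the squares of the generators are then central, and the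
   monomials x^p y^q z^r form a basis: they span by rewriting, and they are
   independent because D(w) acts on a Clifford algebra over k[a, b, c]. Hence
   the Hilbert series is (1 - t)^-3, D(w) is finite over a central polynomial
   ring, and a dimension count turns the Koszul complex of w into an exact
   complex. Exactness passes to the complex of free modules with differential
   d(e_j (x) b) = sum X_t (x) b - 1 (x) X_t b over a k-basis b of an arbitrary
   module, through the filtration by degree; this resolution has length 3.

   Classification. View w as a ternary cubic form. If D(w) has dimension 10 in
   degree 3, no partial derivative w(c, ., .) with c <> 0 is the square of a
   linear form. It follows that w can be brought to the form above: a singular
   point s and two isotropic vectors of w(s, ., .) give a suitable basis; a
   smooth cubic has a flex, hence a Weierstrass form, and the 3-torsion then
   gives a Hesse form. Rescaling leads to the four types, which are separated by
   the dimension of the span of the singular points (3, 2, 1 and 0). *)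
Require Import Defs.
From HB Require Import structures.
From mathcomp Require Import all_boot all_order all_algebra all_fingroup.
From mathcomp Require Import generic_quotient ring_quotient.
From mathcomp Require Import boolp classical_sets.
From mathcomp Require Import finmap monalg.
From mathcomp Require Import ring zify.

Set Implicit Arguments.
Unset Strict Implicit.
Unset Printing Implicit Defensive.

Import GRing.Theory.
Local Open Scope ring_scope.

(** Global dimension is tested on every left module, graded or not, so a resolution of k alone does
    not settle it: the complex carries an arbitrary module as a tensor factor, and a k-basis of that
    module makes its terms free. That length 3 cannot be improved is seen on k, where the matrix
    entries of the differential lie in the kernel of the augmentation. Right-handed statements
    follow from left-handed ones by reversing words, an anti-automorphism of D(w) because w is
    symmetric. The product al be ga appears because passing once around the three relations
    multiplies a commutator such as [x^2, y] by it; if it differs from 1, the commutator vanishes.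
    The value 1 belongs to Fermat cubics, some of whose polar forms are squares. The value -8 is no
    obstacle to regularity, but the cubic is then a triangle of lines, already counted in Type S.
    Hence the exclusions in Type EC: xi^3 = 1 for regularity, xi = 0 and xi^3 = -8 for uniqueness of
    the type. *)

(** * Free modules and linear extension *)

Section FreeModule.
Variables (R : nzRingType) (K : choiceType).

Definition free_lift (A : lmodType R) (f : K -> A) (u : {malg R[K]}) : A :=
  \sum_(x <- msupp u) u@_x *: f x.

Section Lift.
Variables (A : lmodType R) (f : K -> A).

Lemma free_liftEw (d : {fset K}) (u : {malg R[K]}) : (msupp u `<=` d)%fset ->
  free_lift f u = \sum_(x <- d) u@_x *: f x.
Proof.
move=> sud; rewrite /free_lift (big_fset_incl _ sud) // => x _.
by move=> /mcoeff_outdom ->; rewrite scale0r.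
Qed.

Fact free_lift_is_linear : linear (free_lift f).
Proof.
move=> c u v; pose d := (msupp u `|` msupp v)%fset.
have su : (msupp u `<=` d)%fset by apply: fsubsetUl.
have sv : (msupp v `<=` d)%fset by apply: fsubsetUr.
have sw : (msupp (c *: u + v) `<=` d)%fset.
  apply: (fsubset_trans (msuppD_le _ _)).
  by apply: fsetUSS => //; apply: msuppZ_le.
rewrite (free_liftEw su) (free_liftEw sv) (free_liftEw sw) scaler_sumr.
rewrite -big_split /=; apply: eq_bigr => x _.
by rewrite mcoeffD mcoeffZ scalerDl scalerA.
Qed.
HB.instance Definition _ := GRing.isLinear.Build R {malg R[K]} A *:%R
  (free_lift f) free_lift_is_linear.

Lemma free_liftU c x : free_lift f << c *g x >> = c *: f x.
Proof.
by rewrite (free_liftEw msuppU_le) big_seq_fset1 mcoeffUU.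
Qed.

End Lift.

Lemma free_liftD (A : lmodType R) (f g h : K -> A) u :
  (forall x, f x = g x + h x) -> free_lift f u = free_lift g u + free_lift h u.
Proof.
by move=> fgh; rewrite -big_split; apply: eq_bigr => x _; rewrite fgh scalerDr.
Qed.

Lemma malgU_scale c x : << c *g x >> = c *: << x >> :> {malg R[K]}.
Proof. by apply/malgP => y; rewrite mcoeffZ !mcoeffU mulrnAr mulr1. Qed.

Lemma free_ext (A : lmodType R) (f g : {linear {malg R[K]} -> A}) :
  (forall x, f << x >> = g << x >>) -> f =1 g.
Proof.
move=> fg u; rewrite [u]monalgE !linear_sum; apply: eq_bigr => x _.
by rewrite malgU_scale !linearZ fg.
Qed.

Lemma free_projective : projective ({malg R[K]} : lmodType R).
Proof.
move=> A B g f gsurj; pose h x := projT1 (cid (gsurj (f << x >>))).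
exists (free_lift h : {linear _ -> _}) => p.
have -> : g (free_lift h p) = (g \o free_lift h) p by [].
apply: free_ext => x /=; rewrite free_liftU scale1r.
exact: (projT2 (cid (gsurj (f << x >>)))).
Qed.

End FreeModule.

(** * Bases over a field by Zorn's lemma *)

Section Hamel.
Variables (k : fieldType) (V : lmodType k).

(** [u] is a formal combination of vectors, and [free_lift id] evaluates it in [V]. *)
Definition lin_indep (P : set V) : Prop := forall u : {malg k[V]},
  (forall b, b \in msupp u -> P b) -> free_lift id u = 0 -> u = 0.

Lemma exists_maximal_lin_indep :
  exists P, lin_indep P /\ forall Q, (P `<` Q)%classic -> ~ lin_indep Q.
Proof.
apply: Zorn_bigcup => F Find Ftot u usupp u0.
have [-> //|unz] := eqVneq u 0.
suff [P FP uP] : exists2 P, F P & forall b, b \in msupp u -> P b.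
  exact: (Find P FP).
have [b0 b0u] : exists b, b \in msupp u.
  apply/fset0Pn; apply: contra unz => /eqP s0; apply/eqP/malgP => b.
  by rewrite mcoeff0 mcoeff_outdom // s0.
have [P0 FP0 _] := usupp _ b0u.
(* The support of [u] is finite, so it lies in a single member of the chain; the version for lists
   allows induction. *)
suff H (s : seq V) : {subset s <= msupp u} ->
    exists2 P, F P & forall b, b \in s -> P b.
  exact: H.
elim: s => [|b s IHs] sub; first by exists P0.
have [|P FP sP] := IHs; first by move=> x xs; apply: sub; rewrite inE xs orbT.
have [|Q FQ Qb] := usupp b; first by apply: sub; rewrite inE eqxx.
have [PQ|QP] := Ftot _ _ FP FQ; [exists Q|exists P] => //.
- by move=> x; rewrite inE => /predU1P[->//|/sP]; apply: PQ.
- by move=> x; rewrite inE => /predU1P[->|/sP//]; apply: QP.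
Qed.

Lemma hamel_basis : exists (B : choiceType) (e : B -> V)
  (coord : V -> {malg k[B]}),
  cancel coord (free_lift e) /\ cancel (free_lift e) coord.
Proof.
have [P [Pind Pmax]] := exists_maximal_lin_indep.
pose pP : pred V := fun v => `[< P v >].
pose B : choiceType := {v : V | pP v}.
pose e (b : B) : V := val b.
pose j (u : {malg k[B]}) : {malg k[V]} := free_lift (fun b => << e b >>) u.
have jlin : linear j by move=> c u v; rewrite /j linearP.
have jcoeff u (b : B) : (j u)@_(val b) = u@_b.
  rewrite [in RHS](monalgE u) /j /free_lift !raddf_sum /=.
  apply: eq_bigr => x _; rewrite mcoeffZ !mcoeffU mulr_natr.
  by rewrite (inj_eq val_inj) mulrb.
have ej u : free_lift id (j u) = free_lift e u.
  rewrite {2}/free_lift {1}/j {2}/free_lift linear_sum; apply: eq_bigr => x _.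
  by rewrite linearZ /= free_liftU scale1r.
have jP u v : v \in msupp (j u) -> P v.
  move=> vju; apply: contrapT => nPv; move: vju.
  rewrite -mcoeff_neq0 => /negP; apply; apply/eqP.
  rewrite /j /free_lift raddf_sum /= big1 // => x _.
  rewrite mcoeffZ mcoeffU; case: eqP => [xv|]; last by rewrite mulr0.
  by case: nPv; rewrite -xv; apply/asboolP/(valP x).
have inj u : free_lift e u = 0 -> u = 0.
  rewrite -ej => /(Pind _ (@jP u)) ju0; apply/malgP => b.
  by rewrite -jcoeff ju0 !mcoeff0.
(* A vector [v] outside the span could be added to the maximal set: in a relation [u] the
   coefficient of [v] must vanish, and the rest [u1] is a relation among the old vectors. *)
have surj v : exists u, free_lift e u = v.
  apply: contrapT => nv; apply: (Pmax (P `|` [set v])%classic).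
    split; first by move=> x Px; left.
    move=> sub; apply: nv.
    have Pv : pP v by apply/asboolP/sub; right.
    by exists << (Sub v Pv : B) >>; rewrite free_liftU scale1r /e SubK.
  move=> u usupp u0.
  pose u1 := u - << u@_v *g v >>.
  have u1P b : b \in msupp u1 -> P b.
    rewrite -mcoeff_neq0 mcoeffB mcoeffU; have [->|nbv] := eqVneq v b.
      by rewrite subrr eqxx.
    rewrite subr0 mcoeff_neq0 => /usupp[//|/= bv].
    by rewrite bv eqxx in nbv.
  have [w w1] : exists w, j w = u1.
    exists (\sum_(b <- msupp u1) if insub b is Some b' then << u1@_b *g b' >> else 0).
    rewrite [in LHS](_ : j = free_lift (fun b => << e b >>)) // linear_sum.
    rewrite [RHS]monalgE !big_seq; apply: eq_bigr => b bu1.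
    have pb : pP b by apply/asboolP/u1P.
    rewrite (insubT pP pb) /= free_liftU /e SubK.
    by rewrite [RHS]malgU_scale.
  have uv : u@_v = 0.
    apply: contrapT => /eqP nz; apply: nv.
    exists (- (u@_v)^-1 *: w); rewrite linearZ /= -ej w1 linearB /= u0 sub0r.
    by rewrite free_liftU scalerN scaleNr opprK scalerA mulVf // scale1r.
  have e1 : u = u1 by rewrite /u1 uv monalgU0 subr0.
  by apply: Pind => //; rewrite e1.
have [coord coordK] := choice surj.
exists B, e, coord; split=> // u.
apply/eqP; rewrite -subr_eq0; apply/eqP; apply: inj.
by rewrite linearB /= coordK subrr.
Qed.
End Hamel.

(** * Lifting through projectives and comparison of resolutions *)

Section Kernel.
Variables (R : nzRingType) (A B : lmodType R) (f : {linear A -> B}).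

Definition ker_pred : {pred A} := [pred a | f a == 0].
Fact ker_submod_closed : submod_closed ker_pred.
Proof.
split=> [|c u v]; rewrite !inE ?linear0 // linearP.
by move=> /eqP -> /eqP ->; rewrite scaler0 addr0.
Qed.
HB.instance Definition _ := GRing.isSubmodClosed.Build R A ker_pred ker_submod_closed.
Definition ker_type : Type := {a : A | a \in ker_pred}.
HB.instance Definition _ := SubChoice.on ker_type.
HB.instance Definition _ := [SubChoice_isSubLmodule of ker_type by <:].
End Kernel.

(** Projectivity is stated for surjections only. Here the fibre product of [g] and [f] surjects onto
    [P], and a section of that projection yields the lift. *)
Lemma proj_lift (R : nzRingType) (P A B : lmodType R) (g : {linear A -> B})
    (f : {linear P -> B}) : projective P -> (forall p, exists a, g a = f p) ->
  exists h : {linear P -> A}, forall p, g (h p) = f p.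
Proof.
move=> Pproj gf.
pose phi := (g \o fst) \- (f \o snd) : {linear (A * P)%type -> B}.
pose pr : {linear ker_type phi -> P} := snd \o val.
have [|s sP] := Pproj _ _ pr idfun.
  move=> p; have [a ap] := gf p.
  have ker_ap : (a, p) \in ker_pred phi by rewrite inE /= ap subrr.
  by exists (Sub (a, p) ker_ap : ker_type phi).
exists (fst \o (val \o s)) => p /=.
have := valP (s p); rewrite inE /= subr_eq0 => /eqP ->.
by congr (f _); apply: sP.
Qed.

(* A resolution of length 2 would split the last differential of any
   resolution of length 3, by comparison of the two. *)
Lemma short_resolution_split (R : nzRingType) (M : lmodType R)
    (K P : proj_resolution M) :
  (forall x : K 4%N, x = 0) -> (forall x : P 3%N, x = 0) ->
  exists s : {linear K 2%N -> K 3%N}, forall x, s (res_diff K 2 x) = x.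
Proof.
move=> K4 P3.
have Kp n : projective (K n) by exact: res_projective.
have Pp n : projective (P n) by exact: res_projective.
have Kd n p : res_diff K n (res_diff K n.+1 p) = 0.
  by apply/res_exactS; exists p.
have Pd n p : res_diff P n (res_diff P n.+1 p) = 0.
  by apply/res_exactS; exists p.
have Ka p : res_aug K (res_diff K 0 p) = 0.
  by apply/res_exact0; exists p.
have Pa p : res_aug P (res_diff P 0 p) = 0.
  by apply/res_exact0; exists p.
have [f0 f0P] := proj_lift (g := res_aug P) (f := res_aug K) (Kp 0%N)
  (fun p => res_aug_surj P _).
have [|f1 f1P] := proj_lift (g := res_diff P 0) (f := f0 \o res_diff K 0) (Kp 1%N).
  by move=> p; apply/res_exact0; rewrite /= f0P Ka.
have [|f2 f2P] := proj_lift (g := res_diff P 1) (f := f1 \o res_diff K 1) (Kp 2%N).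
  by move=> p; apply/res_exactS; rewrite /= f1P /= Kd linear0.
have [g0 g0P] := proj_lift (g := res_aug K) (f := res_aug P) (Pp 0%N)
  (fun p => res_aug_surj K _).
have [|g1 g1P] := proj_lift (g := res_diff K 0) (f := g0 \o res_diff P 0) (Pp 1%N).
  by move=> p; apply/res_exact0; rewrite /= g0P Pa.
have [|g2 g2P] := proj_lift (g := res_diff K 1) (f := g1 \o res_diff P 1) (Pp 2%N).
  by move=> p; apply/res_exactS; rewrite /= g1P /= Pd linear0.
(* [s0], [s1], [s2] form a homotopy from the identity of [K] to [g] after [f]. In degree 3 the
   composite factors through [P 3], which is zero, so [s2] is the splitting. *)
have [|s0 s0P] := proj_lift (g := res_diff K 0) (f := idfun \- (g0 \o f0)) (Kp 0%N).
  by move=> p; apply/res_exact0; rewrite /= linearB /= g0P f0P subrr.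
have [|s1 s1P] := proj_lift (g := res_diff K 1)
    (f := (idfun \- (g1 \o f1)) \- (s0 \o res_diff K 0)) (Kp 1%N).
  move=> p; apply/res_exactS; rewrite /= !linearB /=.
  by rewrite s0P g1P /= f1P subrr.
have [|s2 s2P] := proj_lift (g := res_diff K 2)
    (f := (idfun \- (g2 \o f2)) \- (s1 \o res_diff K 1)) (Kp 2%N).
  move=> p; apply/res_exactS; rewrite /= !linearB /=.
  by rewrite s1P g2P /= f2P Kd linear0 subr0 subrr.
exists s2 => x; apply/esym/eqP; rewrite -subr_eq0; apply/eqP.
have f2d : f2 (res_diff K 2 x) = 0.
  have /res_exactS[q <-] : res_diff P 1 (f2 (res_diff K 2 x)) = 0.
    by rewrite f2P /= Kd linear0.
  by rewrite (P3 q) linear0.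
have /res_exactS[q <-] : res_diff K 2 (x - s2 (res_diff K 2 x)) = 0.
  by rewrite linearB /= s2P /= f2d Kd linear0 [s1 0]linear0 !subr0 subrr.
by rewrite (K4 q) linear0.
Qed.

(** The type is [M] itself; the phantom parameter [iota] selects its structure over [k]. *)
Definition restr (k : fieldType) (R : nzRingType) (iota : {rmorphism k -> R})
  (M : lmodType R) : Type := M.

Section RestrictScalars.
Variables (k : fieldType) (R : nzRingType) (iota : {rmorphism k -> R}).
Variable M : lmodType R.
Local Notation restr := (restr iota).

HB.instance Definition _ := GRing.Zmodule.on (restr M).

Let scale (c : k) (m : restr M) : restr M := iota c *: (m : M).
Fact restr_scalerA a b c : scale a (scale b c) = scale (a * b) c.
Proof. by rewrite /scale scalerA rmorphM. Qed.
Fact restr_scale1r : left_id 1 scale.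
Proof. by move=> c; rewrite /scale rmorph1 scale1r. Qed.
Fact restr_scalerDr : right_distributive scale +%R.
Proof. by move=> a b c; rewrite /scale scalerDr. Qed.
Fact restr_scalerDl c : {morph scale^~ c : a b / a + b}.
Proof. by move=> a b; rewrite /scale rmorphD scalerDl. Qed.
HB.instance Definition _ := GRing.Zmodule_isLmodule.Build k (restr M)
  restr_scalerA restr_scale1r restr_scalerDr restr_scalerDl.

End RestrictScalars.

(** * A resolution of an arbitrary module from graded exactness *)

Section Koszul.
Variables (k : fieldType) (R : nzRingType) (iota : {rmorphism k -> R}).
Variables (V : finType) (X : V -> R).
Variables (rk : nat -> nat) (nu : forall i, 'I_(rk i.+1) -> 'I_(rk i) -> V -> k).
Variable gr : nat -> R -> Prop.

Hypothesis iotaC : forall c r, iota c * r = r * iota c.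
Hypothesis rk0 : rk 0 = 1%N.
Hypothesis nu_sym : forall i (j : 'I_(rk i.+2)) (m : 'I_(rk i)) t s,
  \sum_l nu j l t * nu l m s = \sum_l nu j l s * nu l m t.
Definition kmx i (j : 'I_(rk i.+1)) (l : 'I_(rk i)) : R :=
  \sum_t iota (nu j l t) * X t.
Hypothesis kmx_comp : forall i (j : 'I_(rk i.+2)) (m : 'I_(rk i)),
  \sum_l kmx j l * kmx l m = 0.

Hypothesis gr0 : forall n, gr n 0.
Hypothesis grD : forall n a b, gr n a -> gr n b -> gr n (a + b).
Hypothesis grZ : forall n c a, gr n a -> gr n (iota c * a).
Hypothesis grX : forall n a t, gr n a -> gr n.+1 (a * X t).
Hypothesis gr_dec : forall a, exists (N : nat) (f : nat -> R),
        (forall n, gr n (f n)) /\ a = \sum_(n < N) f n.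
Hypothesis gr_direct : forall (N : nat) (f : nat -> R),
        (forall n, gr n (f n)) -> \sum_(n < N) f n = 0 ->
        forall n, (n < N)%N -> f n = 0.
Hypothesis gr_conn : forall a, gr 0%N a -> exists c, a = iota c.
Hypothesis gr_gen : forall n a, gr n.+1 a ->
  exists2 u : 'I_(rk 1) -> R, (forall j, gr n (u j)) &
     forall l : 'I_(rk 0), a = \sum_j u j * kmx j l.

(* exactness of the graded complex of left modules R^(rk i) *)
Hypothesis gr_exact : forall i n (u : 'I_(rk i.+1) -> R), (forall j, gr n (u j)) ->
  (forall l, \sum_j u j * kmx j l = 0) ->
  exists2 v : 'I_(rk i.+2) -> R, (forall j, if n is m.+1 then gr m (v j) else v j = 0) &
     forall l, u l = \sum_j v j * kmx j l.

Section Filtration.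

(** Degrees are strictly below [n]: [fil 0] contains only 0, which makes inductions on [n] start
    trivially. *)
Definition fil n (a : R) := exists2 f : nat -> R, (forall n, gr n (f n)) & a = \sum_(i < n) f i.

Lemma fil0 n : fil n 0.
Proof. by exists (fun=> 0) => //; rewrite big1. Qed.

Lemma filD n a b : fil n a -> fil n b -> fil n (a + b).
Proof.
move=> [f grf ->] [g grg ->]; exists (fun i => f i + g i).
  by move=> i; apply: grD.
by rewrite big_split.
Qed.

Lemma filZ n c a : fil n a -> fil n (iota c * a).
Proof.
move=> [f grf ->]; exists (fun i => iota c * f i); last by rewrite mulr_sumr.
by move=> i; apply: grZ.
Qed.

Lemma filN n a : fil n a -> fil n (- a).
Proof.
by move=> /(filZ (-1)); rewrite rmorphN rmorph1 mulN1r.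
Qed.

Lemma filB n a b : fil n a -> fil n b -> fil n (a - b).
Proof. by move=> fa /filN; apply: filD. Qed.

Lemma fil_sum n (I : Type) (r : seq I) (P : pred I) (F : I -> R) :
  (forall i, P i -> fil n (F i)) -> fil n (\sum_(i <- r | P i) F i).
Proof. by move=> h; elim/big_ind: _ => //; [apply: fil0 | apply: filD]. Qed.

Lemma fil_leq m n a : (m <= n)%N -> fil m a -> fil n a.
Proof.
move=> mn [f grf ->]; exists (fun i => if (i < m)%N then f i else 0).
  by move=> i; case: ifP.
by rewrite -big_mkcond /= (big_ord_widen _ f mn).
Qed.

Lemma filMX n a t : fil n a -> fil n.+1 (a * X t).
Proof.
move=> [f grf ->]; exists (fun i => if i is i'.+1 then f i' * X t else 0).
  by case=> // i; apply: grX.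
by rewrite big_ord_recl add0r mulr_suml.
Qed.

Lemma fil_kmx n a i (j : 'I_(rk i.+1)) l : fil n a -> fil n.+1 (a * kmx j l).
Proof.
move=> fa; rewrite mulr_sumr; apply: fil_sum => t _.
by rewrite mulrA -iotaC -mulrA; apply/filZ/filMX.
Qed.

Lemma fil_exists a : exists n, fil n a.
Proof. by have [N [f [grf ->]]] := gr_dec a; exists N, f. Qed.

Lemma filS n a : fil n.+1 a -> exists2 b, gr n b & fil n (a - b).
Proof.
move=> [f grf ->]; exists (f n) => //.
by rewrite big_ord_recr addrK; exists f.
Qed.

Lemma gr_fil n a : gr n a -> fil n a -> a = 0.
Proof.
move=> gra [f grf af].
pose g i := if (i < n)%N then f i else if i == n then - a else 0.
have grg i : gr i (g i).
  rewrite /g; case: ifP => // _; case: eqP => // ->.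
  by rewrite -mulN1r -(rmorph1 iota) -rmorphN; apply: grZ.
have := gr_direct (N := n.+1) grg; rewrite big_ord_recr /= {2}/g ltnn eqxx.
rewrite (eq_bigr (fun i : 'I_n => f i)); last by move=> i _; rewrite /g ltn_ord.
rewrite -af subrr => /(_ erefl n (ltnSn n)); rewrite /g ltnn eqxx => /eqP.
by rewrite oppr_eq0 => /eqP.
Qed.

Lemma gr_sum n (I : Type) (r : seq I) (P : pred I) (F : I -> R) :
  (forall i, P i -> gr n (F i)) -> gr n (\sum_(i <- r | P i) F i).
Proof. by move=> h; elim/big_ind: _ => //; apply: grD. Qed.

Lemma gr_kmx n a i (j : 'I_(rk i.+1)) l : gr n a -> gr n.+1 (a * kmx j l).
Proof.
move=> fa; rewrite mulr_sumr; apply: gr_sum => t _.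
by rewrite mulrA -iotaC -mulrA; apply/grZ/grX.
Qed.

(** Only the components [un] of degree [n] matter. Their image is homogeneous of degree [n.+1] and
    also lies in [fil n.+1], so it is zero, and graded exactness applies to [un]. *)
Lemma fil_exact i n (u : 'I_(rk i.+1) -> R) : (forall j, fil n.+1 (u j)) ->
  (forall l, fil n.+1 (\sum_j u j * kmx j l)) ->
  exists2 v : 'I_(rk i.+2) -> R, (forall j, fil n (v j)) &
     forall l, fil n (u l - \sum_j v j * kmx j l).
Proof.
move=> fu fuk.
have /choice[un uP] j : exists b, gr n b /\ fil n (u j - b).
  by have [b ? ?] := filS (fu j); exists b.
have [||v vP unv] := @gr_exact i n un.
- by move=> j; case: (uP j).
- move=> l; apply: (@gr_fil n.+1).
    by apply: gr_sum => j _; apply: gr_kmx; case: (uP j).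
  rewrite (_ : \sum_j _ = \sum_j u j * kmx j l - \sum_j (u j - un j) * kmx j l).
    apply: filB => //; apply: fil_sum => j _; apply: fil_kmx.
    by case: (uP j).
  by rewrite -sumrB; apply: eq_bigr => j _; rewrite mulrBl opprB addrCA subrr addr0.
exists v => [j|l]; last by rewrite -unv; case: (uP l).
case: n {fu fuk uP unv} vP => [|n] /(_ j); first by move->; apply: fil0.
move=> g; exists (fun i => if i == n then v j else 0).
  by move=> m; case: eqP => // ->.
by rewrite -big_mkcond /= (big_pred1 (@ord_max n)).
Qed.

Lemma left_exact i (u : 'I_(rk i.+1) -> R) :
  (forall l, \sum_j u j * kmx j l = 0) ->
  exists v : 'I_(rk i.+2) -> R, forall l, u l = \sum_j v j * kmx j l.
Proof.
have [n fu] : exists n, forall j, fil n (u j).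
  have /choice[N NP] j := fil_exists (u j).
  exists (\max_j N j)%N => j; apply: fil_leq (NP j).
  exact: (leq_bigmax j).
elim: n u fu => [|n IHn] u fu u0.
  exists (fun=> 0) => l; rewrite big1 => [|j _]; last by rewrite mul0r.
  by have [f _] := fu l; rewrite big_ord0.
have [|v fv fuv] := fil_exact fu; first by move=> l; rewrite u0; apply: fil0.
have [|v' v'P] := IHn _ fuv.
  move=> m; rewrite (eq_bigr (fun j => u j * kmx j m -
      \sum_l v l * (kmx l j * kmx j m))); last first.
    move=> j _; rewrite mulrBl mulr_suml; congr (_ - _).
    by apply: eq_bigr => l _; rewrite mulrA.
  rewrite sumrB u0 exchange_big big1 ?subr0 // => l _.
  by rewrite -mulr_sumr kmx_comp mulr0.
exists (fun j => v' j + v j) => l.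
rewrite (eq_bigr _ (fun j _ => mulrDl _ _ _)) big_split /=.
by rewrite -v'P subrK.
Qed.

End Filtration.

(** Linearity over [k] for maps such as [m |-> 1 (x) m] that are not [R]-linear, stated without
    leaving the type of [R]-modules. *)
Definition iota_linear (A C : lmodType R) (f : A -> C) :=
  forall c u v, f (iota c *: u + v) = iota c *: f u + f v.

Lemma iota_linearE (A C : lmodType R) (f : A -> C) :
  iota_linear f -> linear (f : restr iota A -> restr iota C).
Proof. by []. Qed.

Lemma iotaCZ (A : lmodType R) c r (a : A) : r *: (iota c *: a) = iota c *: (r *: a).
Proof. by rewrite !scalerA iotaC. Qed.

Lemma iotaZ_aux (A : lmodType R) c d x s (a a' b b' : A) :
  iota d *: (x *: (iota c *: a + a') + s *: (iota c *: b + b')) =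
  iota c *: (iota d *: (x *: a + s *: b)) + iota d *: (x *: a' + s *: b').
Proof.
by rewrite !scalerDr (iotaCZ c x) (iotaCZ c s) !(iotaCZ c (iota d)) addrACA.
Qed.

Section Complex.
Variables (M : lmodType R) (F : nat -> lmodType R).
Variables (g : forall i, 'I_(rk i) -> M -> F i).
Variables (d : forall i, {linear F i.+1 -> F i}) (aug : {linear F 0%N -> M}).
Hypothesis gP : forall i (l : 'I_(rk i)), iota_linear (g l).
Hypothesis F_ext : forall (i : nat) (A : lmodType R) (f h : {linear F i -> A}),
  (forall (l : 'I_(rk i)) m, f (g l m) = h (g l m)) -> f =1 h.
Hypothesis dg : forall i (j : 'I_(rk i.+1)) m, d i (g j m) =
  \sum_l \sum_t iota (nu j l t) *: (X t *: g l m + (-1) ^+ i.+1 *: g l (X t *: m)).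
Hypothesis augg : forall (l : 'I_(rk 0)) m, aug (g l m) = m.

Lemma g0 i (l : 'I_(rk i)) : g l 0 = 0.
Proof. by have := gP l (-1) 0 0; rewrite rmorphN1 !scaleN1r !addNr. Qed.

Lemma gZ i (l : 'I_(rk i)) c u : g l (iota c *: u) = iota c *: g l u.
Proof. by have := gP l c u 0; rewrite g0 !addr0. Qed.

Lemma g_sum i (l : 'I_(rk i)) (I : finType) (f : I -> M) :
  g l (\sum_x f x) = \sum_x g l (f x).
Proof.
apply: (big_morph (g l)); last exact: g0.
by move=> u v; have := gP l 1 u v; rewrite rmorph1 !scale1r.
Qed.

Lemma aug_diff u : aug (d 0 u) = 0.
Proof.
rewrite -[LHS]/((aug \o d 0) u) -[RHS]/((\0 : F 1 -> M) u).
apply: F_ext => j m /=.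
rewrite dg linear_sum big1 //= => l _.
rewrite linear_sum big1 //= => t _.
by rewrite linearZ linearD !linearZ /= !augg expr1 scaleN1r subrr scaler0.
Qed.

(** The square of the differential expands with coefficients [Q l t s], symmetric in [t] and [s] by
    [nu_sym]. The two mixed terms, with one variable on each side, cancel by this symmetry. The two
    remaining kinds contain the sum of [Q l t s X_t X_s], which is zero by [kmx_comp]. *)
Lemma d_diff i (u : F i.+2) : d i (d i.+1 u) = 0.
Proof.
rewrite -[LHS]/((d i \o d i.+1) u) -[RHS]/((\0 : F i.+2 -> F i) u).
apply: F_ext => j m /=.
pose Q l t s := \sum_l' nu j l' t * nu l' l s.
pose sg : R := (-1) ^+ i.+1.
have sgC r : sg * r = r * sg by apply/esym/commrX/commrN1.
transitivity (\sum_l \sum_t \sum_s iota (Q l t s) *: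
  ((X t * X s) *: g l m + (sg * X t) *: g l (X s *: m)
  - (sg * X s) *: g l (X t *: m)
  - g l ((X s * X t) *: m))).
  rewrite dg linear_sum /=.
  transitivity (\sum_l' \sum_t \sum_l \sum_s iota (nu j l' t * nu l' l s) *:
  ((X t * X s) *: g l m + (sg * X t) *: g l (X s *: m)
  - (sg * X s) *: g l (X t *: m)
  - g l ((X s * X t) *: m))).
    apply: eq_bigr => l' _; rewrite linear_sum; apply: eq_bigr => t _ /=.
    rewrite linearZ linearD !linearZ /= !dg.
    rewrite scaler_sumr [in X in _ + X]scaler_sumr -big_split scaler_sumr.
    apply: eq_bigr => l _ /=.
    rewrite scaler_sumr [in X in _ + X]scaler_sumr -big_split scaler_sumr.
    apply: eq_bigr => s _ /=.
    rewrite rmorphM -scalerA; congr (_ *: _).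
    rewrite (iotaCZ _ (X t)) (iotaCZ _ (_ ^+ _)) -scalerDr; congr (_ *: _).
    rewrite !scalerDr !scalerA -/sg [_ ^+ i.+2]exprS mulN1r -/sg.
    rewrite -!addrA; congr (_ + _).
    rewrite -[X t * sg]sgC; congr (_ + _).
    by rewrite !mulNr -expr2 -exprM mulnC exprM sqrrN !expr1n scaleN1r scaleNr.
  under [LHS]eq_bigr => l' _ do rewrite exchange_big /=.
  rewrite [LHS]exchange_big /=.
  apply: eq_bigr => l _; rewrite [LHS]exchange_big; apply: eq_bigr => t _ /=.
  rewrite [LHS]exchange_big; apply: eq_bigr => s _ /=.
  by rewrite -scaler_suml -rmorph_sum.
have Qsym l t s : Q l t s = Q l s t by apply: nu_sym.
have QX l : \sum_t \sum_s iota (Q l t s) * (X t * X s) = 0.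
  rewrite -[RHS](kmx_comp j l) /kmx.
  rewrite (eq_bigr (fun l' => \sum_t \sum_s iota (nu j l' t * nu l' l s) * (X t * X s))).
    rewrite [RHS]exchange_big; apply: eq_bigr => t _; rewrite [RHS]exchange_big.
    by apply: eq_bigr => s _; rewrite rmorph_sum mulr_suml.
  move=> l' _; rewrite mulr_suml; apply: eq_bigr => t _; rewrite mulr_sumr.
  apply: eq_bigr => s _; rewrite rmorphM -!mulrA; congr (_ * _).
  by rewrite !mulrA iotaC.
apply: big1 => l _.
under eq_bigr => t _ do under eq_bigr => s _ do rewrite !scalerDr !scalerN.
under eq_bigr => t _ do rewrite !big_split /= !sumrN.
rewrite !big_split /= !sumrN.
rewrite (_ : \sum_t \sum_s _ *: (_ * _ *: _) = 0); last first.
  rewrite -[RHS](scale0r (g l m)) -(QX l) scaler_suml.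
  apply: eq_bigr => t _; rewrite scaler_suml; apply: eq_bigr => s _.
  by rewrite scalerA.
rewrite add0r [X in _ - X - _]exchange_big /=.
rewrite [X in _ - X - _](eq_bigr (fun t => \sum_s iota (Q l t s) *:
    (sg * X t *: g l (X s *: m)))); last first.
  by move=> t _; apply: eq_bigr => s _; rewrite Qsym.
rewrite subrr sub0r exchange_big /=.
rewrite (eq_bigr (fun t => \sum_s g l ((iota (Q l t s) * (X t * X s)) *: m))).
  rewrite -[RHS]oppr0; congr (- _).
  rewrite (eq_bigr _ (fun t _ => esym (g_sum _ _))) -g_sum.
  rewrite (eq_bigr _ (fun t _ => esym (scaler_suml _ _ _ _))).
  by rewrite -scaler_suml QX scale0r g0.
move=> t _; apply: eq_bigr => s _.
by rewrite -[in RHS]scalerA gZ Qsym.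
Qed.
End Complex.

Section Resolution.
Variables (M : lmodType R) (B : choiceType) (e : B -> M).
Variable coord : M -> {malg k[B]}.
Hypothesis coordK : cancel coord (free_lift (e : B -> restr iota M)).
Hypothesis liftK : cancel (free_lift (e : B -> restr iota M)) coord.

(** This is R (x) k^(rk i) (x) M over k, made visibly free over [R] by the k-basis [e] of [M]. *)
Definition kobj i : lmodType R := {malg R[('I_(rk i) * B)%type]}.

(* the k-linear map [m |-> 1 (x) l (x) m] *)
Definition kgen i (l : 'I_(rk i)) (m : M) : kobj i :=
  free_lift (fun b => << (l, b) >> : restr iota (kobj i)) (coord m).

Lemma kgenP i (l : 'I_(rk i)) : iota_linear (kgen l).
Proof.
move=> c u v.
have -> : kgen l (iota c *: u + v) = free_lift
  (fun b => << (l, b) >> : restr iota (kobj i)) (c *: coord u + coord v).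
  apply: (congr1 (free_lift (fun b => << (l, b) >> : restr iota (kobj i)))).
  apply: (can_inj liftK).
  by rewrite linearP /= !coordK.
exact: (@free_lift_is_linear k B (restr iota (kobj i))).
Qed.

Lemma coord_e b : coord (e b) = << b >>.
Proof. by apply: (can_inj liftK); rewrite coordK free_liftU scale1r. Qed.

Lemma kgen_e i (l : 'I_(rk i)) b : kgen l (e b) = << (l, b) >>.
Proof. by rewrite /kgen coord_e free_liftU scale1r. Qed.

Lemma iota_ext (W : lmodType R) (f g : M -> W) :
  iota_linear f -> iota_linear g -> (forall b, f (e b) = g (e b)) -> f =1 g.
Proof.
move=> /iota_linearE lf /iota_linearE lg fg m.
pose f' : {linear restr iota M -> restr iota W} := HB.pack (f : restr iota M -> restr iota W)
  (GRing.isLinear.Build k (restr iota M) (restr iota W) *:%R f lf).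
pose g' : {linear restr iota M -> restr iota W} := HB.pack (g : restr iota M -> restr iota W)
  (GRing.isLinear.Build k (restr iota M) (restr iota W) *:%R g lg).
rewrite -[m]coordK.
apply: (free_ext (f := f' \o free_lift (e : B -> restr iota M))
                 (g := g' \o free_lift (e : B -> restr iota M))) => b /=.
by rewrite free_liftU scale1r.
Qed.

Definition kdiff i : kobj i.+1 -> kobj i :=
  free_lift (fun jb : 'I_(rk i.+1) * B => \sum_l \sum_t iota (nu jb.1 l t) *:
     (X t *: kgen l (e jb.2)
      + (-1) ^+ i.+1 *: kgen l (X t *: e jb.2))).
HB.instance Definition _ i := GRing.Linear.on (@kdiff i).

Definition kaug : kobj 0 -> M := free_lift (fun jb : 'I_(rk 0) * B => e jb.2 : M).
HB.instance Definition _ := GRing.Linear.on kaug.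

Lemma kdiff_gen i (j : 'I_(rk i.+1)) (m : M) : kdiff (kgen j m) = \sum_l \sum_t iota (nu j l t) *:
     (X t *: kgen l m
      + (-1) ^+ i.+1 *: kgen l (X t *: m)).
Proof.
move: m; apply: iota_ext => [c u v|c u v|b].
- by rewrite (kgenP _ c u) linearP.
- rewrite scaler_sumr -big_split /=; apply: eq_bigr => l _.
  rewrite scaler_sumr -big_split /=; apply: eq_bigr => t _.
  have -> : X t *: (iota c *: u + v) = iota c *: (X t *: u) + X t *: v.
    by rewrite scalerDr iotaCZ.
  rewrite (kgenP l c u v) (kgenP l c (X t *: u) (X t *: v)).
  exact: iotaZ_aux.
- by rewrite kgen_e /kdiff free_liftU scale1r.
Qed.

Lemma kaug_gen (l : 'I_(rk 0)) (m : M) : kaug (kgen l m) = m.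
Proof.
move: m; apply: (@iota_ext M (fun m => kaug (kgen l m)) id) => [c u v|//|b].
- by rewrite (kgenP _ c u) linearP.
- by rewrite kgen_e /kaug free_liftU scale1r.
Qed.

Lemma kgen0 i (l : 'I_(rk i)) : kgen l 0 = 0.
Proof. exact: (g0 kgenP). Qed.

Lemma kobj_ext (i : nat) (A : lmodType R) (f h : {linear kobj i -> A}) :
  (forall (l : 'I_(rk i)) m, f (kgen l m) = h (kgen l m)) -> f =1 h.
Proof. by move=> fh; apply: free_ext => -[l b]; have := fh l (e b); rewrite kgen_e. Qed.

Lemma kdiff_diff i (u : kobj i.+2) : kdiff (kdiff u) = 0.
Proof. exact: (d_diff (d := fun i => @kdiff i) kgenP kobj_ext kdiff_gen). Qed.

Lemma kaug_diff (u : kobj 1) : kaug (kdiff u) = 0.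
Proof. exact: (aug_diff (d := fun i => @kdiff i) (aug := kaug) kobj_ext kdiff_gen kaug_gen). Qed.

Definition iotac (r : R) := exists c, r = iota c.

Lemma iotac_sum (I : Type) (r : seq I) (P : pred I) (F : I -> R) :
  (forall i, iotac (F i)) -> iotac (\sum_(i <- r | P i) F i).
Proof.
move=> h; elim/big_ind: _ => //; first by exists 0; rewrite rmorph0.
by move=> _ _ [c ->] [d ->]; exists (c + d); rewrite rmorphD.
Qed.

Lemma iotacM r s : iotac r -> iotac s -> iotac (r * s).
Proof. by move=> [c ->] [d ->]; exists (c * d); rewrite rmorphM. Qed.

Lemma kgen_iotac i (l : 'I_(rk i)) m x : iotac ((kgen l m)@_x).
Proof.
rewrite (_ : kgen l m = \sum_(b <- msupp (coord m))
  iota (coord m)@_b *: (<< (l, b) >> : {malg R[('I_(rk i) * B)%type]})) //.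
rewrite raddf_sum; apply: iotac_sum => b.
exists ((coord m)@_b * ((l, b) == x)%:R).
by rewrite [LHS]mcoeffZ mcoeffU rmorphM rmorph_nat.
Qed.

(** The differential has a part that multiplies in the factor [R] and raises the filtration by one,
    and a part [klow] that acts on [M] and preserves it. Leading terms see only the first, for which
    exactness is known. *)
Definition kmain i : kobj i.+1 -> kobj i :=
  free_lift (fun jb : 'I_(rk i.+1) * B => \sum_l kmx jb.1 l *: << (l, jb.2) >>).
Definition klow i : kobj i.+1 -> kobj i :=
  free_lift (fun jb : 'I_(rk i.+1) * B => \sum_l \sum_t iota (nu jb.1 l t) *:
     ((-1) ^+ i.+1 *: kgen l (X t *: e jb.2))).

Lemma kdiff_split (A : lmodType R) i (j : 'I_(rk i.+1)) s (g : 'I_(rk i) -> A)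
    (h : 'I_(rk i) -> V -> A) :
  \sum_l \sum_t iota (nu j l t) *: (X t *: g l + s *: h l t) =
  \sum_l kmx j l *: g l + \sum_l \sum_t iota (nu j l t) *: (s *: h l t).
Proof.
rewrite -big_split; apply: eq_bigr => l _ /=.
rewrite /kmx scaler_suml -big_split; apply: eq_bigr => t _ /=.
by rewrite scalerDr scalerA.
Qed.

Lemma kdiffE i (u : kobj i.+1) : kdiff u = kmain u + klow u.
Proof.
apply: free_liftD => -[j b] /=; rewrite -(kdiff_split _ _ (fun l => << (l, b) >>)).
by apply: eq_bigr => l _; rewrite kgen_e.
Qed.

Lemma kdiff_e i (j : 'I_(rk i.+1)) b : kdiff << (j, b) >> =
  \sum_l kmx j l *: (<< (l, b) >> : kobj i) +
  \sum_l \sum_t iota (nu j l t) *: ((-1) ^+ i.+1 *: kgen l (X t *: e b)).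
Proof. by rewrite kdiffE /kmain /klow !free_liftU !scale1r. Qed.

Lemma kmain_coeff i (u : kobj i.+1) l b :
  (kmain u)@_(l, b) = \sum_j u@_(j, b) * kmx j l.
Proof.
have uE j : u@_(j, b) = \sum_(x <- msupp u) u@_x *+ (x == (j, b)).
  rewrite [in LHS](monalgE u) raddf_sum /=; apply: eq_bigr => x _.
  by rewrite mcoeffU.
under eq_bigr => j _ do rewrite uE mulr_suml.
rewrite exchange_big /kmain /free_lift raddf_sum /=.
apply: eq_bigr => -[j0 b0] _; rewrite mcoeffZ raddf_sum /=.
under eq_bigr => l' _ do rewrite mcoeffZ mcoeffU.
rewrite (bigD1 l) //= big1 ?addr0 => [|l' /negbTE nl].
  rewrite (bigD1 j0) //= big1 ?addr0 => [|j /negbTE nj].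
    by rewrite !xpair_eqE !eqxx /=; case: eqP => _; rewrite ?mulr1 // mulr0 mulr0n mulr0 mul0r.
  by rewrite xpair_eqE eq_sym nj mulr0n mul0r.
by rewrite xpair_eqE nl mulr0.
Qed.

Definition Fil n i (u : kobj i) := forall x, fil n u@_x.

(** The action on [M] is expanded in a k-basis, so the coefficients in [R] are only multiplied by
    scalars. *)
Lemma Fil_low n i (u : kobj i.+1) : Fil n u -> Fil n (klow u).
Proof.
move=> fu x; rewrite /klow /free_lift raddf_sum /=.
apply: fil_sum => -[j b] _; rewrite mcoeffZ.
suff [c ->] : iotac (\sum_l \sum_t iota (nu j l t) *:
     ((-1) ^+ i.+1 *: kgen l (X t *: e b)))@_x by rewrite -iotaC; apply: filZ.
rewrite raddf_sum; apply: iotac_sum => l; rewrite raddf_sum; apply: iotac_sum => t.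
rewrite /= mcoeffZ; apply: iotacM; first by exists (nu j l t).
rewrite mcoeffZ; apply: iotacM; last exact: kgen_iotac.
by exists ((-1) ^+ i.+1); rewrite rmorphXn rmorphN1.
Qed.

Lemma kobj_of i (v : B -> 'I_(rk i) -> R) (d : {fset B}) :
  (forall b, b \notin d -> forall j, v b j = 0) ->
  exists w : kobj i, forall j b, w@_(j, b) = v b j.
Proof.
move=> nd; exists (\sum_(b <- d) \sum_j << v b j *g (j, b) >>) => j b.
rewrite raddf_sum /=.
under eq_bigr => b' _.
  rewrite raddf_sum /= (bigD1 j) //= big1 => [|j' /negbTE nj]; last first.
    by rewrite mcoeffU xpair_eqE nj.
  rewrite addr0 mcoeffU xpair_eqE eqxx /=; over.
have [bd|bd] := boolP (b \in d).
  rewrite (big_fsetD1 b) //= eqxx big1_fset ?addr0 // => b'.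
  by rewrite !inE => /andP[/negbTE -> _].
rewrite nd // big_seq big1 // => b' bd'.
by case: eqP => // bb; rewrite -bb bd' in bd.
Qed.

(** A cycle satisfies [kmain u = - klow u], so its image under [kmain] has lower degree than
    expected; [fil_exact] then applies separately for every basis vector [b] of [M]. *)
Lemma Fil_exact_step n i (u : kobj i.+1) : Fil n.+1 u -> kdiff u = 0 ->
  exists2 v : kobj i.+2, Fil n v & Fil n (u - kdiff v).
Proof.
move=> fu du0.
have main l b : fil n.+1 (\sum_j u@_(j, b) * kmx j l).
  rewrite -kmain_coeff.
  have -> : kmain u = - klow u by apply/eqP; rewrite -addr_eq0 -kdiffE du0.
  by rewrite mcoeffN; apply/filN/Fil_low.
(* The last clause keeps the chosen family finitely supported in [b], so that it assembles to an
   element of the free module. *)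
have /choice[v vP] b : exists v : 'I_(rk i.+2) -> R,
   [/\ forall j, fil n (v j), forall l, fil n (u@_(l, b) - \sum_j v j * kmx j l)
     & (forall j, u@_(j, b) = 0) -> forall j, v j = 0].
  have [u0|nu0] := pselect (forall j, u@_(j, b) = 0).
    exists (fun=> 0); split=> // [_|l]; first exact: fil0.
    by rewrite u0 big1 ?subrr => [|j _]; [apply: fil0 | rewrite mul0r].
  have [v v1 v2] := @fil_exact i n (fun j => u@_(j, b)) (fun j => fu (j, b)) (main^~ b).
  by exists v; split.
pose d := [fset x.2 | x in msupp u]%fset.
have nd b : b \notin d -> forall j, v b j = 0.
  move=> bd j; have [_ _ h] := vP b; apply: h => {}j; apply/eqP.
  rewrite mcoeff_eq0; apply: contra bd => ju.
  by apply/imfsetP; exists (j, b).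
have [w wE] := kobj_of nd.
have fw : Fil n w by move=> [j b]; rewrite wE; case: (vP b).
exists w => // -[l b]; rewrite kdiffE opprD addrA mcoeffB.
apply: filB; last exact: Fil_low.
rewrite mcoeffB kmain_coeff; have [_ + _] := vP b => /(_ l).
by congr (fil _ (_ - _)); apply: eq_bigr => j _; rewrite wE.
Qed.

Lemma Fil_bound i (u : kobj i) : exists n, Fil n u.
Proof.
have /choice[N NP] x := fil_exists u@_x.
exists (\max_(x <- msupp u) N x)%N => x; case: (msuppP u x) => [xu|_]; last exact: fil0.
by apply: fil_leq (NP x); rewrite (big_fsetD1 x) //= leq_maxl.
Qed.

Lemma Fil0_eq0 i (u : kobj i) : Fil 0 u -> u = 0.
Proof.
move=> fu; apply/malgP => x; rewrite mcoeff0.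
by have [f _] := fu x; rewrite big_ord0.
Qed.

Lemma kdiff_exact i (u : kobj i.+1) : kdiff u = 0 -> exists v, kdiff v = u.
Proof.
have [n] := Fil_bound u; elim: n u => [|n IHn] u fu du.
  by exists 0; rewrite (Fil0_eq0 fu) linear0.
have [v fv fuv] := Fil_exact_step fu du.
have [|v' v'P] := IHn _ fuv; first by rewrite linearB /= kdiff_diff subr0.
by exists (v' + v); rewrite linearD /= v'P subrK.
Qed.

Let l0 : 'I_(rk 0) := cast_ord (esym rk0) ord0.

Lemma rk0_all (l : 'I_(rk 0)) : l = l0.
Proof. by apply/val_inj => /=; case: l => /= l; rewrite rk0; case: l. Qed.

Lemma Fil_aug_step n (u : kobj 0) : Fil n.+2 u ->
  exists2 v : kobj 1, Fil n.+1 v & Fil n.+1 (u - kdiff v).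
Proof.
move=> fu.
have /choice[v vP] b : exists v : 'I_(rk 1) -> R,
   [/\ forall j, fil n.+1 (v j), forall l, fil n.+1 (u@_(l, b) - \sum_j v j * kmx j l)
     & u@_(l0, b) = 0 -> forall j, v j = 0].
  have [u0|nu0] := pselect (u@_(l0, b) = 0).
    exists (fun=> 0); split=> // [_|l]; first exact: fil0.
    by rewrite (rk0_all l) u0 big1 ?subrr => [|j _]; [apply: fil0 | rewrite mul0r].
  have [a gra fa] := filS (fu (l0, b)).
  have [v v1 v2] := gr_gen gra.
  exists v; split=> // [j|l]; last by rewrite -v2 (rk0_all l).
  exists (fun i => if i == n then v j else 0) => [m|]; first by case: eqP => // ->.
  by rewrite -big_mkcond /= (big_pred1 (@ord_max n)).
have nd b : b \notin [fset x.2 | x in msupp u]%fset -> forall j, v b j = 0.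
  move=> bd; have [_ _ h] := vP b; apply: h; apply/eqP.
  rewrite mcoeff_eq0; apply: contra bd => ju.
  by apply/imfsetP; exists (l0, b).
have [w wE] := kobj_of nd.
have fw : Fil n.+1 w by move=> [j b]; rewrite wE; case: (vP b).
exists w => // -[l b]; rewrite kdiffE opprD addrA mcoeffB.
apply: filB; last exact: Fil_low.
rewrite mcoeffB kmain_coeff; have [_ + _] := vP b => /(_ l).
by congr (fil _ (_ - _)); apply: eq_bigr => j _; rewrite wE.
Qed.

(** Coefficients of degree 0 are scalars and can be moved across the tensor product into [M]. This
    is the base case of exactness at the augmentation. *)
Lemma Fil1_kgen (u : kobj 0) : Fil 1 u -> u = kgen l0 (kaug u).
Proof.
move=> fu.
have uc x : exists c, u@_x = iota c.
  have [f grf ->] := fu x; rewrite big_ord1; exact: gr_conn.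
have uE : u = \sum_(x <- msupp u) u@_x *: (<< x >> : kobj 0).
  by rewrite [LHS]monalgE; apply: eq_bigr => x _; rewrite [LHS]malgU_scale.
rewrite [LHS]uE /kaug /free_lift.
elim/big_rec2: _ => [|[l b] y z _ ->]; first by rewrite kgen0.
have [c ->] := uc (l, b).
by rewrite (kgenP l0 c (e b)) kgen_e (rk0_all l).
Qed.

Lemma kaug_exact (u : kobj 0) : kaug u = 0 -> exists v, kdiff v = u.
Proof.
have [n fu] := Fil_bound u.
have {fu} : Fil n.+1 u by move=> x; apply: fil_leq (fu x).
elim: n u => [|n IHn] u fu au.
  by exists 0; rewrite (Fil1_kgen fu) au linear0 kgen0.
have [v fv fuv] := Fil_aug_step fu.
have [|v' v'P] := IHn _ fuv; first by rewrite linearB /= kaug_diff subr0.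
by exists (v' + v); rewrite linearD /= v'P subrK.
Qed.

Lemma kaug_surj m : exists u, kaug u = m.
Proof. by exists (kgen l0 m); apply: kaug_gen. Qed.

Definition koszul_resolution : proj_resolution M.
Proof.
refine (@ProjResolution R M kobj (fun i => @kdiff i : {linear _ -> _})
  (kaug : {linear _ -> _}) _ kaug_surj _ _).
- by move=> n; apply: free_projective.
- move=> p; split=> [/kaug_exact[v <-]|[q <-]]; [by exists v | exact: kaug_diff].
- move=> n p; split=> [/kdiff_exact[v <-]|[q <-]]; [by exists v | exact: kdiff_diff].
Defined.

Lemma koszul_zero i (u : kobj i) : rk i = 0%N -> u = 0.
Proof.
move=> rki; apply/malgP => -[l b]; have := ltn_ord l.
by rewrite {2}rki.
Qed.

End Resolution.

Lemma koszul_gldim_le n : (forall i, (n < i)%N -> rk i = 0%N) -> left_gldim_le R n.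
Proof.
move=> rkn M; have [B [e [coord [cK lK]]]] := hamel_basis (restr iota M).
exists (koszul_resolution cK lK) => m nm p.
by apply: koszul_zero; apply: rkn.
Qed.

(** * Ext of the trivial module and the lower bound for its projective dimension *)

Section TrivialModule.
Variable eps : {rmorphism R -> k}.
Hypothesis eps_iota : forall c, eps (iota c) = c.
Hypothesis eps_X : forall t, eps (X t) = 0.

Let M : lmodType R := trivial_module eps.
Let e (x : unit) : M := (1 : k).
Let coord (c : restr iota M) : {malg k[unit]} := << (c : k) *g tt >>.

Fact triv_coordK : cancel coord (free_lift (e : unit -> restr iota M)).
Proof.
move=> c; rewrite /coord free_liftU; rewrite -[LHS]/(eps (iota c) * 1).
by rewrite eps_iota mulr1.
Qed.

Fact triv_liftK : cancel (free_lift (e : unit -> restr iota M)) coord.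
Proof.
move=> u; have -> : u = << u@_tt *g tt >> by apply/malgP => -[]; rewrite mcoeffUU.
by rewrite {1}free_liftU -[X in coord X]/(eps (iota u@_tt) * 1) eps_iota mulr1.
Qed.

Let K := koszul_resolution triv_coordK triv_liftK.

Lemma eps_kmx i (j : 'I_(rk i.+1)) l : eps (kmx j l) = 0.
Proof.
by rewrite rmorph_sum big1 // => t _; rewrite rmorphM /= eps_X mulr0.
Qed.

Lemma triv_diff i j : res_diff K i << (j, tt) >> =
  \sum_l kmx j l *: (<< (l, tt) >> : kobj unit i).
Proof.
rewrite [LHS](kdiff_e triv_coordK triv_liftK).
rewrite [X in _ + X]big1 ?addr0 // => l _; rewrite big1 // => t _.
rewrite (_ : X t *: e tt = 0); last by rewrite -[LHS]/(eps (X t) * 1) eps_X mul0r.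
by rewrite (kgen0 triv_coordK triv_liftK) !scaler0.
Qed.

Lemma linear_on_gen i (A : lmodType R) (f g : K i -> A) : linear f -> linear g ->
  (forall l, f << (l, tt) >> = g << (l, tt) >>) -> f =1 g.
Proof.
move=> lf lg fg.
pose f' : {linear {malg R[('I_(rk i) * unit)%type]} -> A} := HB.pack (f : _ -> _)
  (GRing.isLinear.Build R _ A *:%R f lf).
pose g' : {linear {malg R[('I_(rk i) * unit)%type]} -> A} := HB.pack (g : _ -> _)
  (GRing.isLinear.Build R _ A *:%R g lg).
by apply: (free_ext (f := f') (g := g')) => -[l []]; apply: fg.
Qed.

Lemma linear_kmx i (g : K i -> R^o) j : linear g ->
  g (res_diff K i << (j, tt) >>) = \sum_l kmx j l * (g << (l, tt) >> : R).
Proof.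
move=> lg; rewrite triv_diff.
pose g' : {linear kobj unit i -> R^o} := HB.pack (g : _ -> _)
  (GRing.isLinear.Build R (kobj unit i) R^o *:%R g lg).
by rewrite -[g]/(g' : _ -> _) linear_sum; apply: eq_bigr => l _; rewrite linearZ.
Qed.

Lemma triv_coboundary i (g : K i.+1 -> R^o) (h : 'I_(rk i) -> R) : linear g ->
  (forall j, (g << (j, tt) >> : R) = \sum_l kmx j l * h l) -> coboundary g.
Proof.
move=> lg gh; pose h' := free_lift (fun x : 'I_(rk i) * unit => h x.1 : R^o).
exists h'; split; first exact: free_lift_is_linear.
apply: linear_on_gen => // [c u v|j].
  by rewrite linearP [LHS](free_lift_is_linear (fun x : 'I_(rk i) * unit => h x.1 : R^o)).
rewrite gh linear_kmx; last exact: free_lift_is_linear.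
by apply: eq_bigr => l _; rewrite /h' free_liftU scale1r.
Qed.

Lemma triv_cocycle i (g : K i -> R^o) : cocycle g ->
  forall j : 'I_(rk i.+1), \sum_l kmx j l * (g << (l, tt) >> : R) = 0.
Proof. by move=> [lg g0] j; rewrite -linear_kmx. Qed.

Variable n : nat.
Hypothesis right_exact0 : forall r : 'I_(rk 0) -> R,
  (forall j, \sum_l kmx j l * r l = 0) -> forall l, r l = 0.
Hypothesis right_exactS : forall i, i != n -> forall r : 'I_(rk i.+1) -> R,
  (forall j, \sum_l kmx j l * r l = 0) ->
  exists h : 'I_(rk i) -> R, forall j, r j = \sum_l kmx j l * h l.
Hypothesis right_top : forall r, eps r = 0 -> exists h : 'I_(rk n) -> R,
  forall j, r = \sum_l kmx j l * h l.
Hypothesis rk_top : rk n.+1 = 1%N.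
Hypothesis rk_top1 : rk n.+2 = 0%N.

(** A linear map to [R] is the column of its values on the basis, and the transposed differential is
    multiplication by [kmx] from the left. Vanishing is thus exactness of a complex of right
    modules. *)
Lemma koszul_Ext_vanishes i : i != n.+1 -> Ext_vanishes M i.
Proof.
case: i => [_|i ni]; exists K => g cg; have lg := cg.1.
  rewrite /coboundary; apply: linear_on_gen => // [c u v|l].
    by rewrite scaler0 addr0.
  exact: right_exact0 (triv_cocycle cg) l.
by have [h hP] := right_exactS ni (triv_cocycle cg); apply: triv_coboundary hP.
Qed.

Let l1 : 'I_(rk n.+1) := cast_ord (esym rk_top) ord0.

Lemma rk_top_all l : l = l1.
Proof. by apply/val_inj => /=; case: l => /= l; rewrite rk_top; case: l. Qed.

(** A cochain in top degree is a single value [r], and coboundaries are the values in the right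
    ideal generated by the entries of the last differential. By [right_top] this ideal is the kernel
    of [eps]. *)
Lemma koszul_Ext_iso : Ext_iso M n.+1 (right_trivial_module eps).
Proof.
exists K, (fun g => eps (g << (l1, tt) >>)); split.
- by move=> g h _ _; rewrite rmorphD.
- by move=> r g _; rewrite rmorphM mulrC.
- move=> c; exists (free_lift (fun=> iota c : R^o)); last by rewrite free_liftU scale1r.
  split=> [|p]; first exact: free_lift_is_linear.
  rewrite (_ : p = 0); last by apply: koszul_zero.
  by rewrite !linear0.
- move=> g cg; split=> [g0|[h [lh gh]]].
    have [h hP] := right_top g0; apply: (triv_coboundary (h := h)); first exact: cg.1.
    by move=> j; rewrite (rk_top_all j); apply: hP.
  rewrite gh linear_kmx // raddf_sum big1 // => l _.
  by rewrite [LHS](rmorphM eps) eps_kmx mul0r.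
Qed.

(** A splitting of the last differential would write the generator in degree 3 as a combination with
    coefficients [kmx], which [eps] kills; applying [eps] would give 1 = 0. *)
Lemma koszul_pd_ge : n = 2 -> ~ pd_le M 2.
Proof.
move=> n2 [P P3].
have K4 (x : K 4%N) : x = 0 by apply: koszul_zero; move: rk_top1; rewrite n2.
have [s sP] := short_resolution_split K4 (P3 3%N isT).
have rk3 : rk 3 = 1%N by move: rk_top; rewrite n2.
pose l3 : 'I_(rk 3) := cast_ord (esym rk3) ord0.
pose co (u : K 3) : k := eps ((u : {malg R[('I_(rk 3) * unit)%type]})@_(l3, tt)).
have := congr1 co (sP << (l3, tt) >>); rewrite (triv_diff l3) [s _]linear_sum.
have -> : co << (l3, tt) >> = 1 by rewrite /co mcoeffUU rmorph1.
rewrite /co [X in eps X](raddf_sum (mcoeff (l3, tt))) rmorph_sum big1 => [/eqP|l _].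
  by rewrite eq_sym oner_eq0.
by rewrite linearZ [X in eps X]mcoeffZ rmorphM /= eps_kmx mul0r.
Qed.

End TrivialModule.

End Koszul.

(** * Noetherian rings that are finite over a central polynomial ring *)

Section Noetherian.
Variable R : nzRingType.

Definition subring (A : R -> Prop) :=
  [/\ A 1, forall a b, A a -> A b -> A (a - b) & forall a b, A a -> A b -> A (a * b)].

(** A module over the subring [A] is taken inside [R], so that subrings and modules are predicates
    on one and the same ring. *)
Definition subspace (A N : R -> Prop) :=
  [/\ N 0, forall a b, N a -> N b -> N (a + b) & forall r a, A r -> N a -> N (r * a)].

Definition lspan (A : R -> Prop) (g : seq R) (a : R) :=
  exists2 c : nat -> R, (forall i, A (c i)) & a = \sum_(i < size g) c i * g`_i.

Definition noeth (A N : R -> Prop) :=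
  forall I, (forall a, I a -> N a) -> subspace A I ->
  exists2 g : seq R, (forall x, x \in g -> I x) & forall a, I a -> lspan A g a.

Section Subring.
Variable A : R -> Prop.
Hypothesis Asub : subring A.

Lemma subring0 : A 0.
Proof. by case: Asub => A1 AB _; rewrite -(subrr 1); apply: AB. Qed.

Lemma subringN a : A a -> A (- a).
Proof. by case: Asub => _ AB _ Aa; rewrite -sub0r; apply: AB => //; apply: subring0. Qed.

Lemma subringD a b : A a -> A b -> A (a + b).
Proof. by case: Asub => _ AB _ Aa Ab; rewrite -[b]opprK; apply: AB => //; apply: subringN. Qed.

Lemma subspaceB N a b : subspace A N -> N a -> N b -> N (a - b).
Proof.
move=> [_ ND NM] Na Nb; apply: ND => //; rewrite -mulN1r; apply: NM => //.
by apply: subringN; case: Asub.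
Qed.

Lemma subspace_sum N (I : Type) (r : seq I) (P : pred I) (F : I -> R) :
  subspace A N -> (forall i, P i -> N (F i)) -> N (\sum_(i <- r | P i) F i).
Proof. by move=> [N0 ND _] h; elim/big_ind: _. Qed.

Lemma lspan_subspace g : subspace A (lspan A g).
Proof.
have [A1 AB AM] := Asub; split.
- by exists (fun=> 0) => [_|]; [apply: subring0 | rewrite big1 // => i _; rewrite mul0r].
- move=> _ _ [c Ac ->] [d Ad ->]; exists (fun i => c i + d i).
    by move=> i; apply: subringD.
  by rewrite -big_split; apply: eq_bigr => i _; rewrite mulrDl.
- move=> r _ Ar [c Ac ->]; exists (fun i => r * c i) => [i|]; first exact: AM.
  by rewrite mulr_sumr; apply: eq_bigr => i _; rewrite mulrA.
Qed.

Lemma mem_lspan g x : x \in g -> lspan A g x.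
Proof.
have [A1 _ _] := Asub => xg; exists (fun i => (i == index x g)%:R) => [i|].
  by case: (_ == _); [exact: A1 | exact: subring0].
have xs : (index x g < size g)%N by rewrite index_mem.
rewrite (bigD1 (Ordinal xs)) //= eqxx mul1r nth_index // big1 ?addr0 // => i.
by rewrite -val_eqE /= => /negbTE ->; rewrite mul0r.
Qed.

Lemma lspan_sub g N : subspace A N -> (forall x, x \in g -> N x) ->
  forall a, lspan A g a -> N a.
Proof.
move=> sN gN _ [c Ac ->]; apply: subspace_sum => // i _.
by case: sN => _ _ NM; apply: NM => //; apply/gN/mem_nth.
Qed.

Lemma lspan_subset g h a : {subset g <= h} -> lspan A g a -> lspan A h a.
Proof.
move=> gh; apply: lspan_sub; first exact: lspan_subspace.
by move=> x /gh; apply: mem_lspan.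
Qed.

Definition polyext (N : R -> Prop) (t a : R) :=
  exists2 p : {poly R}, (forall i, N p`_i) & a = p.[t].

End Subring.

Section Hilbert.
Variables (A : R -> Prop) (t : R).
Hypothesis Asub : subring A.
Hypothesis tC : forall r, r * t = t * r.

Lemma horner_cent (p q : {poly R}) : (p * q).[t] = p.[t] * q.[t].
Proof. by apply: hornerM_comm; rewrite /comm_poly tC. Qed.

Lemma polyext_subring : subring (polyext A t).
Proof.
have [A1 AB AM] := Asub; split.
- exists 1; last by rewrite hornerC.
  by move=> i; rewrite coef1; case: (_ == _); [exact: A1 | exact: (subring0 Asub)].
- move=> _ _ [p Ap ->] [q Aq ->]; exists (p - q); last by rewrite hornerD hornerN.
  by move=> i; rewrite coefB; apply: AB.
- move=> _ _ [p Ap ->] [q Aq ->]; exists (p * q); last by rewrite horner_cent.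
  move=> i; rewrite coefM.
  elim/big_ind: _ => [|x y|j _]; [exact: (subring0 Asub) | exact: (subringD Asub) | exact: AM].
Qed.

Lemma polyext_subspace N : subspace A N -> subspace (polyext A t) (polyext N t).
Proof.
move=> [N0 ND NM]; split.
- by exists 0; [move=> i; rewrite coef0 | rewrite horner0].
- move=> _ _ [p Ap ->] [q Aq ->]; exists (p + q); last by rewrite hornerD.
  by move=> i; rewrite coefD; apply: ND.
- move=> _ _ [p Ap ->] [q Aq ->]; exists (p * q); last by rewrite horner_cent.
  by move=> i; rewrite coefM; elim/big_ind: _ => // j _; apply: NM.
Qed.

Lemma polyextC N a : N 0 -> N a -> polyext N t a.
Proof.
by move=> N0 Na; exists a%:P; [move=> i; rewrite coefC; case: ifP | rewrite hornerC].
Qed.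

(* Hilbert's basis theorem, for the submodules of N[t] *)
Lemma polyext_noeth N : subspace A N -> noeth A N -> noeth (polyext A t) (polyext N t).
Proof.
move=> sN nN I IN sI.
have [A1 AB AM] := Asub; have [N0 ND NM] := sN; have [I0 ID IM] := sI.
have sA' := polyext_subring.
have At : polyext A t t.
  exists 'X; last by rewrite hornerX.
  by move=> i; rewrite coefX; case: (_ == _); [exact: A1 | exact: (subring0 Asub)].
have AA' a : A a -> polyext A t a by apply: polyextC; exact: (subring0 Asub).
(* The submodule of coefficients in degree [d]. It is defined through all polynomials with value in
   [I], since [t] may satisfy an equation and a value does not determine its polynomial. *)
pose L d n := exists2 p : {poly R}, (forall i, N p`_i) & [/\ (size p <= d.+1)%N, p`_d = n & I p.[t]].
have LN d n : L d n -> N n by case=> p Np [_ <- _].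
have sL d : subspace A (L d).
  split.
  - exists 0; first by move=> i; rewrite coef0.
    by rewrite size_poly0 coef0 horner0.
  - move=> _ _ [p Np [sp <- Ip]] [q Nq [sq <- Iq]]; exists (p + q).
      by move=> i; rewrite coefD; apply: ND.
    split; rewrite ?coefD ?hornerD //; last exact: ID.
    by apply: leq_trans (size_polyD _ _) _; rewrite geq_max sp.
  - move=> r _ Ar [p Np [sp <- Ip]]; exists (r%:P * p).
      by move=> i; rewrite coefCM; apply: NM.
    split; rewrite ?coefCM ?horner_cent ?hornerC //; last by apply: IM => //; apply: AA'.
    by rewrite mul_polyC; apply: leq_trans (size_scale_leq _ _) _.
have Lmono d n : L d n -> L d.+1 n.
  move=> [p Np [sp <- Ip]]; exists (p * 'X).
    by move=> i; rewrite coefMX; case: ifP.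
  split; rewrite ?coefMX ?horner_cent ?hornerX //; last first.
    by rewrite tC; apply: IM.
  by apply: leq_trans (size_polyMleq _ _) _; rewrite size_polyX addn2.
have Lleq d e n : (d <= e)%N -> L d n -> L e n.
  by move=> /subnK <-; elim: (e - d)%N => // m IHm /IHm; rewrite addSn; apply: Lmono.
have [gL gLP Lspan] := nN (fun n => exists d, L d n)
  (fun n => fun '(ex_intro d h) => @LN d n h) ltac:(split; [
    by exists 0%N; case: (sL 0%N)
  | by move=> a b [d ad] [e be]; exists (maxn d e); case: (sL (maxn d e)) => _ LD _;
       apply: LD; [apply: Lleq ad; apply: leq_maxl | apply: Lleq be; apply: leq_maxr]
  | by move=> r a Ar [d ad]; exists d; case: (sL d) => _ _; apply ]).
have [D gD] : exists D, forall x, x \in gL -> L D x.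
  elim: gL gLP {Lspan} => [|x s IHs] sP; first by exists 0%N.
  have [|D DP] := IHs; first by move=> y ys; apply: sP; rewrite inE ys orbT.
  have [|d xd] := sP x; first by rewrite inE eqxx.
  exists (maxn d D) => y; rewrite inE => /predU1P[->|/DP].
    by apply: Lleq xd; apply: leq_maxl.
  by apply: Lleq; apply: leq_maxr.
have /choice[g gP] d : exists g : seq R, (forall x, x \in g -> L d x) /\
    forall a, L d a -> lspan A g a.
  by have [g ? ?] := nN (L d) (LN d) (sL d); exists g.
have /choice[p_ pP] (dx : nat * R) : exists p : {poly R}, L dx.1 dx.2 ->
    [/\ forall i, N p`_i, (size p <= dx.1.+1)%N, p`_dx.1 = dx.2 & I p.[t]].
  have [[p Np [? ? ?]]|nL] := pselect (L dx.1 dx.2); last by exists 0.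
  by exists p.
pose G := flatten [seq [seq (p_ (d, x)).[t] | x <- g d] | d <- seq.iota 0 D.+1].
have GI x : x \in G -> I x.
  move=> /flatten_mapP[d _ /mapP[y yg ->]].
  by have [] := pP (d, y) ((gP d).1 _ yg).
have LDall d n : L d n -> (D <= d)%N -> lspan A (g D) n.
  move=> Ln _; apply: (gP D).2; apply: (lspan_sub (sL D) gD).
  by apply: Lspan; exists d.
exists G => // a Ia; have [p Np aE] := IN _ Ia.
have [SG0 SGD SGM] := lspan_subspace sA' G.
have [d sp] : exists d, (size p <= d)%N by exists (size p).
elim: d a p Ia Np aE sp => [|d IHd] a p Ia Np aE sp.
  suff -> : a = 0 by [].
  by rewrite aE (_ : p = 0) ?horner0 //; apply/eqP; rewrite -size_poly_leq0.
(* Coefficients in degree [d] that are already attained by values in the span of [G]. Once [Q]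
   contains the coefficient of [p] in degree [d], it can be subtracted and [d] drops. Beyond [D] the
   generators of [L D], times powers of [t], suffice; hence [e]. *)
pose Q n := exists2 q : {poly R}, (forall i, N q`_i) &
  [/\ (size q <= d.+1)%N, q`_d = n, I q.[t] & lspan (polyext A t) G q.[t]].
pose e := minn d D.
have sQ : subspace A Q.
  split.
  - exists 0; first by move=> i; rewrite coef0.
    by rewrite size_poly0 coef0 horner0.
  - move=> _ _ [q1 Nq1 [sq1 <- Iq1 Gq1]] [q2 Nq2 [sq2 <- Iq2 Gq2]]; exists (q1 + q2).
      by move=> i; rewrite coefD; apply: ND.
    split; rewrite ?coefD ?hornerD //; [|exact: ID|exact: SGD].
    by apply: leq_trans (size_polyD _ _) _; rewrite geq_max sq1.
  - move=> r _ Ar [q Nq [sq <- Iq Gq]]; exists (r%:P * q).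
      by move=> i; rewrite coefCM; apply: NM.
    split; rewrite ?coefCM ?horner_cent ?hornerC //.
    + by rewrite mul_polyC; apply: leq_trans (size_scale_leq _ _) _.
    + by apply: IM => //; apply: AA'.
    + by apply: SGM => //; apply: AA'.
have [q Nq [sq qd Iq Gq]] : Q p`_d.
  apply: (lspan_sub sQ (g := g e)).
    move=> x xg; have [pN ps pd pI] := pP (e, x) ((gP e).1 _ xg).
    have tI q m : I q.[t] -> I (q * 'X^m).[t].
      elim: m => [|m IHm] Iq; first by rewrite mulr1.
      by rewrite exprSr mulrA horner_cent hornerX tC; apply: IM => //; apply: IHm.
    have tG q m : lspan (polyext A t) G q.[t] -> lspan (polyext A t) G (q * 'X^m).[t].
      elim: m => [|m IHm] Iq; first by rewrite mulr1.
      by rewrite exprSr mulrA horner_cent hornerX tC; apply: SGM => //; apply: IHm.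
    exists (p_ (e, x) * 'X^(d - e)); first by move=> i; rewrite coefMXn; case: ifP.
    split.
    - apply: leq_trans (size_polyMleq _ _) _; rewrite size_polyXn /=.
      by move: ps => /=; have := geq_minl d D; rewrite -/e; lia.
    - rewrite coefMXn ltnNge leq_subr /= -[RHS]pd /=; congr (_`_ _).
      by have := geq_minl d D; rewrite -/e; lia.
    - exact: tI.
    - apply: tG; apply: mem_lspan => //.
      apply/flatten_mapP; exists e; last by apply/mapP; exists x.
      by rewrite mem_iota /= add0n ltnS geq_minr.
  have Ld : L d p`_d by exists p; rewrite // -aE.
  rewrite /e; case: (leqP D d) => Dd; last exact: (gP d).2.
  exact: (LDall d).
have -> : a = (a - q.[t]) + q.[t] by rewrite subrK.
apply: SGD => //; apply: (IHd _ (p - q)).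
- by apply: (subspaceB sA').
- by move=> i; rewrite coefB; apply: (subspaceB Asub).
- by rewrite aE hornerD hornerN.
- apply/leq_sizeP => j; rewrite leq_eqVlt => /predU1P[<-|dj].
    by rewrite coefB qd subrr.
  by rewrite coefB !nth_default ?subr0 //; [apply: leq_trans sq _ | apply: leq_trans sp _].
Qed.
End Hilbert.

(** Finite generation over a division ring, one generator at a time: an element of [I] with
    coordinate 1 on [x], if there is one, reduces [I] to its part inside the span of [s]. *)
Lemma subspace_lspan_noeth A s : subring A ->
  (forall a, A a -> a != 0 -> exists2 b, A b & b * a = 1) -> noeth A (lspan A s).
Proof.
move=> Asub Ainv; have [A1 AB AM] := Asub.
elim: s => [|x s IHs] I IN sI; have [I0 ID IM] := sI.
  by exists [::].
have [S0 SD SM] := lspan_subspace Asub s.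
have IN' a : I a -> exists2 c, A c & lspan A s (a - c * x).
  move=> /IN[c Ac ->]; exists (c 0%N) => //; exists (fun i => c i.+1) => //.
  by rewrite big_ord_recl addrC addKr.
have [g gI Ig] := IHs (fun a => I a /\ lspan A s a) (fun a h => h.2)
  ltac:(split; [by split | by move=> a b [? ?] [? ?]; split; [apply: ID | apply: SD]
  | by move=> r a Ar [? ?]; split; [apply: IM | apply: SM]]).
have [[a0 Ia0 sa0]|noI] := pselect (exists2 a, I a & lspan A s (a - x)); last first.
  exists g => [y /gI[]|a Ia] //; apply: Ig; split=> //.
  have [c Ac sac] := IN' _ Ia; have [c0|nc] := eqVneq c 0.
    by move: sac; rewrite c0 mul0r subr0.
  have [b Ab bc] := Ainv _ Ac nc; case: noI; exists (b * a); first exact: IM.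
  by rewrite -[x]mul1r -bc -mulrA -mulrBr; apply: SM.
exists (a0 :: g) => [y|a Ia].
  by rewrite inE => /predU1P[->//|/gI[]].
have [c Ac sac] := IN' _ Ia.
have [S0' SD' SM'] := lspan_subspace Asub (a0 :: g).
have -> : a = (a - c * a0) + c * a0 by rewrite subrK.
apply: SD'; last by apply: SM' => //; apply: mem_lspan => //; rewrite inE eqxx.
apply: (lspan_subset Asub (g := g)) => [y yg|]; first by rewrite inE yg orbT.
apply: Ig; split; first by apply: (subspaceB Asub) => //; apply: IM.
have -> : a - c * a0 = (a - c * x) - c * (a0 - x).
  by rewrite mulrBr opprB addrA subrK.
by apply: (subspaceB Asub) => //; apply: SM.
Qed.

Definition polyexts (N : R -> Prop) (ts : seq R) := foldr (fun t N => polyext N t) N ts.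

Lemma polyexts_noeth A N ts : (forall t r, t \in ts -> r * t = t * r) ->
  subring A -> subspace A N -> noeth A N ->
  [/\ subring (polyexts A ts), subspace (polyexts A ts) (polyexts N ts)
    & noeth (polyexts A ts) (polyexts N ts)].
Proof.
move=> tsC sA sN nN; elim: ts tsC => [|t ts IHts] tsC //=.
have [|sA' sN' nN'] := IHts; first by move=> u r uts; apply: tsC; rewrite inE uts orbT.
have tC r : r * t = t * r by apply: tsC; rewrite inE eqxx.
split; [exact: polyext_subring | exact: polyext_subspace | exact: polyext_noeth].
Qed.

Lemma polyexts_sub N ts a : N 0 -> N a -> polyexts N ts a.
Proof.
elim: ts a => //= t ts IHts a N0 Na; apply: polyextC; exact: IHts.
Qed.

Lemma polyexts_gen A ts t : subring A -> t \in ts -> polyexts A ts t.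
Proof.
move=> sA; elim: ts => //= u ts IHts; rewrite inE => /predU1P[->|/IHts tA].
  exists 'X; last by rewrite hornerX.
  move=> i; rewrite coefX; case: (_ == _); apply: polyexts_sub; try exact: (subring0 sA).
  by case: sA.
by apply: polyextC => //; apply: polyexts_sub; exact: (subring0 sA).
Qed.

(** The second hypothesis says that [s] generates [R] as a module over [k[ts]], in the form of an
    induction principle. It is applied to the span of [s] over [k], extended by the elements of
    [ts]. *)
Lemma finite_over_central_noetherian (k : fieldType) (iota : {rmorphism k -> R})
    (ts s : seq R) : (forall t r, t \in ts -> r * t = t * r) ->
  (forall N : R -> Prop, N 0 -> (forall a b, N a -> N b -> N (a + b)) ->
     (forall c a, N a -> N (iota c * a)) -> (forall t a, t \in ts -> N a -> N (t * a)) ->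
     (forall x, x \in s -> N x) -> forall r, N r) ->
  left_noetherian R.
Proof.
move=> tsC gen; pose A r := exists c, r = iota c.
have sA : subring A.
  split; first by exists 1; rewrite rmorph1.
    by move=> _ _ [c ->] [d ->]; exists (c - d); rewrite rmorphB.
  by move=> _ _ [c ->] [d ->]; exists (c * d); rewrite rmorphM.
have [sA' [N0 ND NM] nN] := polyexts_noeth tsC sA (lspan_subspace sA s)
  (subspace_lspan_noeth (s := s) sA ltac:(
    by move=> _ [c ->]; rewrite fmorph_eq0 => nc; exists (iota c^-1);
    [exists c^-1 | rewrite -rmorphM mulVf ?rmorph1])).
have NT : forall r, polyexts (lspan A s) ts r.
  apply: gen => //.
  - by move=> c a Na; apply: NM => //; apply: polyexts_sub; [exact: subring0 | exists c].
  - by move=> t a tts Na; apply: NM => //; apply: polyexts_gen.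
  - move=> x xs; apply: polyexts_sub; last exact: mem_lspan.
    have [h _ _] := lspan_subspace sA s; exact: h.
move=> I I0 ID IM.
have [g gI Ig] := nN I (fun a _ => NT a) (And3 I0 ID (fun r a _ Ia => IM r a Ia)).
exists g => a; split=> [/Ig[c _ ->]|[c ->]]; first by exists (fun i => c i).
by elim/big_ind: _ => // i _; apply/IM/gI/mem_nth.
Qed.

End Noetherian.

Lemma D_pi_eq (k : fieldType) (w : tensor3 k) a b :
  (D_pi w a == D_pi w b) = (a - b \in rel_ideal w).
Proof. by rewrite Quotient.idealrBE. Qed.

(** * Universal properties of the tensor algebra and of D(w) *)

Section TensorLift.
Variables (k : fieldType) (A : nzRingType) (iota : {rmorphism k -> A}).
Variable a : 'I_3 -> A.
Hypothesis iotaC : forall c r, iota c * r = r * iota c.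

Definition word_prod (m : {fmonom 'I_3}) : A := \prod_(i <- m) a i.

Fact word_prod_mmorphism : mmorphism word_prod.
Proof.
by split=> [m1 m2|]; rewrite /word_prod ?fmM ?big_cat // fm1 big_nil.
Qed.
HB.instance Definition _ :=
  isMultiplicative.Build {fmonom 'I_3} A word_prod word_prod_mmorphism.

Fact tlift_is_monoid_morphism : monoid_morphism (mmap iota word_prod).
Proof.
have [M1 M2] := commr_mmap_is_multiplicative
  (f := iota) (h := word_prod) (fun g m m' => iotaC _ _).
by split.
Qed.

(** The target is a ring with a central map from [k] instead of a k-algebra, so that it may be a
    converse ring, a matrix ring or a polynomial ring over D(w). *)
Lemma tensor_alg_lift : exists phi : {rmorphism tensor_alg k -> A},
  (forall i, phi (gen k i) = a i) /\ forall c b, phi (c *: b) = iota c * phi b.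
Proof.
pose phi : {rmorphism tensor_alg k -> A} := HB.pack (mmap iota word_prod : tensor_alg k -> A)
  (GRing.isZmodMorphism.Build (tensor_alg k) A _ (mmap_is_additive (f := iota) (h := word_prod)))
  (GRing.isMonoidMorphism.Build (tensor_alg k) A _ tlift_is_monoid_morphism).
exists phi; split=> [i|c b]; last exact: mmapZ.
transitivity (iota 1 * word_prod (fmu i)); first exact: mmapU.
by rewrite rmorph1 mul1r /word_prod fmU big_seq1.
Qed.

Lemma deriv_quot_lift (w : tensor3 k) :
  (forall i, \sum_(j < 3) \sum_(l < 3) iota (w [tuple i; j; l]) * (a j * a l) = 0) ->
  exists psi : {rmorphism D_alg w -> A},
  (forall i, psi (D_pi w (gen k i)) = a i) /\ forall c b, psi (c *: b) = iota c * psi b.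
Proof.
move=> rel0; have [phi [phig phiZ]] := tensor_alg_lift.
have phirel i : phi (rel_of w i) = 0.
  rewrite rmorph_sum -[RHS](rel0 i); apply: eq_bigr => j _.
  rewrite rmorph_sum; apply: eq_bigr => l _.
  by rewrite phiZ rmorphM !phig.
have phi0 b : b \in rel_ideal w -> phi b = 0.
  rewrite inE => /asboolP[s ->]; rewrite rmorph_sum big1 // => p _.
  by rewrite !rmorphM /= phirel mulr0 mul0r.
pose psi (x : D_alg w) : A := phi (repr (x : Quotient.quot (rel_ideal w))).
have psiE b : psi (D_pi w b) = phi b.
  apply/eqP; rewrite -subr_eq0 -rmorphB phi0 // -D_pi_eq.
  by apply/eqP; exact: reprK.
have piK (x : D_alg w) : exists b, x = D_pi w b.
  by exists (repr (x : Quotient.quot (rel_ideal w))); rewrite /D_pi reprK.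
have psiB : zmod_morphism psi.
  move=> x y; have [b ->] := piK x; have [c ->] := piK y.
  by rewrite -rmorphB !psiE rmorphB.
have psiM : monoid_morphism psi.
  split=> [|x y]; first by rewrite -(rmorph1 (D_pi w)) psiE rmorph1.
  have [b ->] := piK x; have [c ->] := piK y.
  by rewrite -rmorphM !psiE rmorphM.
pose psi' : {rmorphism D_alg w -> A} := HB.pack psi
  (GRing.isZmodMorphism.Build _ _ psi psiB)
  (GRing.isMonoidMorphism.Build _ _ psi psiM).
exists psi'; split=> [i|c x]; first by rewrite [LHS]psiE.
by have [b ->] := piK x; rewrite -linearZ [LHS]psiE [X in _ = _ * X]psiE.
Qed.
End TensorLift.

(** * Words and the grading of D(w) *)

Section Words.
Variables (k : fieldType) (w : tensor3 k).
Local Notation S := (D_alg w).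

Definition dx (i : 'I_3) : S := D_pi w (gen k i).
Definition dword (m : seq 'I_3) : S := \prod_(i <- m) dx i.

Lemma gen_word (m : {fmonom 'I_3}) : << m >> = \prod_(i <- m) gen k i :> tensor_alg k.
Proof.
case: m => m /=; elim: m => [|i m IHm].
  rewrite big_nil; rewrite (_ : FMonom [::] = mone) //.
  by apply/eqP; rewrite fmP fm1.
rewrite big_cons -IHm (_ : FMonom (i :: m) = mmul (fmu i) (FMonom m)); last first.
  by apply/eqP; rewrite fmP fmM fmU.
by rewrite /gen; apply/esym; rewrite [LHS]malgM_def fgmulUU mulr1.
Qed.

Lemma D_pi_word (m : {fmonom 'I_3}) : D_pi w << m >> = dword m.
Proof. by rewrite gen_word rmorph_prod. Qed.

Lemma D_piE (b : tensor_alg k) :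
  D_pi w b = \sum_(m <- msupp b) b@_m *: dword m.
Proof.
rewrite [in LHS](monalgE b) raddf_sum; apply: eq_bigr => m _.
by rewrite malgU_scale -D_pi_word; exact: D_pi_is_scalable.
Qed.

Lemma D_pi_surj (x : S) : exists b, x = D_pi w b.
Proof.
by exists (repr (x : Quotient.quot (rel_ideal w))); rewrite /D_pi reprK.
Qed.

Lemma D_grP n (x : S) : D_gr n x -> exists2 r : seq (k * seq 'I_3),
  (forall p, p \in r -> size p.2 = n) & x = \sum_(p <- r) p.1 *: dword p.2.
Proof.
move=> [b hb ->]; exists [seq (b@_m, m : seq 'I_3) | m <- msupp b].
  by move=> _ /mapP[m /hb <- ->].
by rewrite big_map D_piE.
Qed.

Lemma D_words (x : S) : exists r : seq (k * seq 'I_3), x = \sum_(p <- r) p.1 *: dword p.2.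
Proof.
have [b ->] := D_pi_surj x; exists [seq (b@_m, m : seq 'I_3) | m <- msupp b].
by rewrite big_map D_piE.
Qed.

Lemma D_gr_linear n c (x y : S) : D_gr n x -> D_gr n y -> D_gr n (c *: x + y).
Proof.
move=> [a ha ->] [b hb ->]; exists (c *: a + b); last by rewrite linearP.
move=> m /(fsubsetP (msuppD_le _ _)); rewrite in_fsetU => /orP[|/hb//].
by move=> /(fsubsetP (msuppZ_le _ _)) /ha.
Qed.

Lemma D_gr0 n : D_gr n (0 : S).
Proof. by exists 0; [move=> m; rewrite msupp0 | rewrite linear0]. Qed.

Lemma D_grD n (x y : S) : D_gr n x -> D_gr n y -> D_gr n (x + y).
Proof. by move=> gx gy; rewrite -[x]scale1r; apply: D_gr_linear. Qed.

Lemma D_grZ n c (x : S) : D_gr n x -> D_gr n (c *: x).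
Proof. by move=> gx; rewrite -[c *: x]addr0; apply: D_gr_linear => //; apply: D_gr0. Qed.

Lemma D_gr_sum n (I : Type) (r : seq I) (P : pred I) (F : I -> S) :
  (forall i, P i -> D_gr n (F i)) -> D_gr n (\sum_(i <- r | P i) F i).
Proof. by move=> h; elim/big_ind: _ => //; [apply: D_gr0 | apply: D_grD]. Qed.

Lemma D_grM m n (x y : S) : D_gr m x -> D_gr n y -> D_gr (m + n) (x * y).
Proof.
move=> [a ha ->] [b hb ->]; exists (a * b); last by rewrite rmorphM.
move=> u /(fsubsetP (msuppM_incl _ _))/imfset2P[/= u1 /ha <-] [u2 /hb <- ->].
by rewrite fmM size_cat.
Qed.

Lemma D_gr1 : D_gr 0 (1 : S).
Proof.
exists 1; last by rewrite rmorph1.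
by move=> m; rewrite msuppU1 inE => /eqP ->; rewrite fm1.
Qed.

Lemma D_gr_dx i : D_gr 1 (dx i).
Proof.
exists (gen k i) => // m; rewrite msuppU1 inE => /eqP ->.
by rewrite fmU.
Qed.

Lemma D_gr_dword m : D_gr (size m) (dword m).
Proof.
rewrite /dword; elim: m => [|i m IHm]; first by rewrite big_nil; apply: D_gr1.
by rewrite big_cons; apply: (D_grM (m := 1)) => //; apply: D_gr_dx.
Qed.

Lemma D_gr_dec (x : S) : exists (N : nat) (f : nat -> S),
  (forall n, D_gr n (f n)) /\ x = \sum_(n < N) f n.
Proof.
have [r ->] := D_words x.
pose N := (\max_(p <- r) size p.2).+1.
exists N, (fun n => \sum_(p <- r | size p.2 == n) p.1 *: dword p.2); split.
  by move=> n; apply: D_gr_sum => p /eqP <-; apply/D_grZ/D_gr_dword.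
rewrite (exchange_big_dep xpredT) //= big_seq [RHS]big_seq; apply: eq_bigr => p pr.
have ps : (size p.2 < N)%N.
  by rewrite ltnS; apply: (@leq_bigmax_seq _ r xpredT (fun p => size p.2)).
by rewrite (big_pred1 (Ordinal ps)) // => i; rewrite eq_sym.
Qed.

Lemma D_rel i : \sum_(j < 3) \sum_(l < 3) w [tuple i; j; l] *: (dx j * dx l) = 0.
Proof.
transitivity (D_pi w (rel_of w i)).
  rewrite raddf_sum; apply: eq_bigr => j _; rewrite raddf_sum; apply: eq_bigr => l _.
  by rewrite /= linearZ rmorphM.
apply/eqP; rewrite -(rmorph0 (D_pi w)) D_pi_eq subr0 inE; apply/asboolP.
by exists [:: (1, i, 1)]; rewrite big_seq1 mul1r mulr1.
Qed.

Lemma D_lift (A : nzRingType) (iota : {rmorphism k -> A}) (a : 'I_3 -> A) :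
  (forall c r, iota c * r = r * iota c) ->
  (forall i, \sum_(j < 3) \sum_(l < 3) iota (w [tuple i; j; l]) * (a j * a l) = 0) ->
  exists psi : {rmorphism S -> A},
  (forall i, psi (dx i) = a i) /\ forall c b, psi (c *: b) = iota c * psi b.
Proof. by move=> iC rel; have := deriv_quot_lift iC rel. Qed.

(* The ring morphism [S -> S['X]], [x_i |-> x_i 'X], separates the degrees. *)
Lemma D_gr_direct (N : nat) (f : nat -> S) : (forall n, D_gr n (f n)) ->
  \sum_(n < N) f n = 0 -> forall n, (n < N)%N -> f n = 0.
Proof.
move=> grf f0 n nN.
pose iota := polyC \o in_alg S : {rmorphism k -> {poly S}}.
have iotaC c r : iota c * r = r * iota c.
  apply/polyP => i; rewrite coefCM coefMC /=.
  by rewrite mulr_algl mulr_algr.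
have [|psi [psix psiZ]] := D_lift (a := fun i => (dx i)%:P * 'X) iotaC.
  move=> i; rewrite -[RHS](mul0r ('X * 'X)) -[X in _ = X * _]polyC0 -(D_rel i).
  rewrite rmorph_sum mulr_suml; apply: eq_bigr => j _.
  rewrite rmorph_sum mulr_suml; apply: eq_bigr => l _.
  rewrite -mulr_algl !rmorphM /= -!mulrA; congr (_ * (_ * _)).
  by rewrite [LHS]mulrA -[in LHS]commr_polyX -mulrA.
have psi_word m : psi (dword m) = (dword m)%:P * 'X^(size m).
  rewrite /dword; elim: m => [|i m IHm]; first by rewrite !big_nil rmorph1 mulr1.
  rewrite !big_cons !rmorphM /= IHm psix exprS -!mulrA; congr (_ * _).
  by rewrite [LHS]mulrA -[in LHS]commr_polyX -mulrA.
have psi_gr m x : D_gr m x -> psi x = x%:P * 'X^m.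
  move=> /D_grP[r rm ->]; rewrite !rmorph_sum mulr_suml !big_seq.
  apply: eq_bigr => p /rm pm; rewrite psiZ psi_word pm [LHS]mulrA.
  by rewrite -[p.1 *: dword _]mulr_algl /= polyCM.
have := congr1 (fun p : {poly S} => p`_n) (congr1 psi f0).
rewrite rmorph0 coef0 rmorph_sum coef_sum (bigD1 (Ordinal nN)) //= big1 => [|i ni].
  by rewrite (psi_gr n) // coefCM coefXn eqxx mulr1 addr0.
rewrite (psi_gr i) // coefCM coefXn (_ : n == i = false) ?mulr0 //.
by apply: contraNF ni => /eqP ni; apply/eqP/val_inj.
Qed.

Lemma D_gr0P (x : S) : D_gr 0 x <-> exists c : k, x = c%:A.
Proof.
split=> [/D_grP[r r0 ->]|[c ->]]; last by apply/D_grZ/D_gr1.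
exists (\sum_(p <- r) p.1); rewrite [RHS]scaler_suml.
rewrite [LHS]big_seq [RHS]big_seq; apply: eq_bigr => p /r0 /size0nil ->.
by rewrite /dword big_nil.
Qed.

Lemma D_connected_graded : connected_graded (@D_gr k w).
Proof.
split; last exact: D_gr0P.
split; [|exact: D_gr1|by move=> *; apply: D_grM|exact: D_gr_dec|exact: D_gr_direct].
by move=> n; split=> [|c a b]; [apply: D_gr0 | apply: D_gr_linear].
Qed.

Lemma D_augmentation : exists2 eps : {rmorphism S -> k},
  (forall c : k, eps c%:A = c) & forall i, eps (dx i) = 0.
Proof.
have [|psi [psix psiZ]] := D_lift (A := k) (iota := idfun) (a := fun=> 0) (fun c r => mulrC _ _).
  by move=> i; rewrite big1 // => j _; rewrite big1 // => l _; rewrite !mulr0.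
by exists psi => // c; rewrite psiZ rmorph1 mulr1.
Qed.

Lemma D_is_augmentation (eps : {rmorphism S -> k}) : (forall c : k, eps c%:A = c) ->
  (forall i, eps (dx i) = 0) -> is_augmentation (@D_gr k w) eps.
Proof.
move=> e1 ex; split=> // n a /D_grP[r rn ->]; rewrite rmorph_sum big_seq big1 // => p /rn.
case: p => c [|i m] //= _; rewrite -mulr_algl rmorphM /dword big_cons rmorphM /=.
by rewrite ex mul0r mulr0.
Qed.

Lemma D_gr_gen n (x : S) : D_gr n.+1 x ->
  exists2 u : 'I_3 -> S, (forall j, D_gr n (u j)) & x = \sum_j u j * dx j.
Proof.
move=> /D_grP[r rn ->]; elim: r rn => [|[c m] r IHr] rn.
  by exists (fun=> 0) => [j|]; [apply: D_gr0 | rewrite big_nil big1 // => j _; rewrite mul0r].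
have [|u uP ue] := IHr; first by move=> p pr; apply: rn; rewrite inE pr orbT.
have := rn (c, m); rewrite inE eqxx => /(_ isT) /=.
case/lastP: m {rn} => // m i; rewrite size_rcons => -[mn].
exists (fun j => (if j == i then c *: dword m else 0) + u j) => [j|].
  apply: D_grD => //; case: eqP => _; last exact: D_gr0.
  by rewrite -mn; apply/D_grZ/D_gr_dword.
rewrite (eq_bigr _ (fun j _ => mulrDl _ _ _)) big_split big_cons ue /=; congr (_ + _).
rewrite (bigD1 i) //= eqxx big1 ?addr0 => [|j /negbTE ->]; last by rewrite mul0r.
by rewrite /dword -cats1 big_cat big_seq1 -scalerAl.
Qed.
End Words.

(** The inductive step of [rel_ideal_dec] in an abstract ring: [G] stands for the generators, [r]
    for the relators, and [y0] for the constant term of the right factor. *)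
Lemma rel_dec_step (A : nzRingType) (I J : finType) (j : J) (x x' y0 : A)
    (f y G : I -> A) (g r : J -> A) : x * r j * y0 = x' * r j ->
  x * r j * (y0 + \sum_i y i * G i) + (\sum_i f i * G i + \sum_i g i * r i) =
  \sum_i (x * r j * y i + f i) * G i +
  \sum_i ((if i == j then x' else 0) + g i) * r i.
Proof.
move=> xy; rewrite mulrDr mulr_sumr xy.
rewrite [in RHS](eq_bigr _ (fun i _ => mulrDl _ _ (G i))) big_split /=.
rewrite [in RHS](eq_bigr _ (fun i _ => mulrDl _ _ (r i))) big_split /=.
rewrite [\sum_i (if _ then _ else _) * _](bigD1 j) //= eqxx.
rewrite [X in _ = _ + (_ + X + _)]big1 => [|i /negbTE ->]; last by rewrite mul0r.
rewrite addr0 [RHS]addrACA [X in X + _ = _]addrC; congr (_ + _ + _).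
by apply: eq_bigr => i _; rewrite mulrA.
Qed.

(** * Right division by generators and the syzygies of the variables *)

Section Presentation.
Variable k : fieldType.
Local Notation T := (tensor_alg k).

(** T(V) is the sum of k and of the free left module on the generators; [rdiv i] reads off the
    coefficient of the generator [i]. Reversing the word exposes its last letter. *)
Definition rdiv_word (i : 'I_3) (m : {fmonom 'I_3}) : T :=
  if rev m is j :: m' then if j == i then << FMonom (rev m') >> else 0 else 0.

Definition rdiv (i : 'I_3) : {linear {malg k[{fmonom 'I_3}]} -> T} := free_lift (rdiv_word i).

Lemma rdivU i c m : rdiv i << c *g m >> = c *: rdiv_word i m.
Proof. exact: free_liftU. Qed.

Lemma rdiv_gen i j (a : T) : rdiv i (a * gen k j) = if i == j then a else 0.
Proof.
suff H (m : {fmonom 'I_3}) : rdiv i (<< m >> * gen k j) = if i == j then << m >> else 0.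
  rewrite [a]monalgE mulr_suml !raddf_sum.
  transitivity (\sum_(m <- msupp a) a@_m *: (if i == j then << m >> else 0 : T)).
    apply: eq_bigr => m _; rewrite malgU_scale -scalerAl.
    by rewrite [LHS]linearZ H.
  case: eqP => _; last by rewrite big1 // => m _; rewrite scaler0.
  by apply: eq_bigr => m _; rewrite [RHS]malgU_scale.
have -> : << m >> * gen k j = << mmul m (fmu j) >> :> T.
  by rewrite [LHS]malgM_def fgmulUU mulr1.
rewrite rdivU scale1r /rdiv_word fmM fmU rev_cat /= eq_sym.
by case: eqP => // _; rewrite revK fmK.
Qed.

Lemma rdiv_dec (b : T) : exists c : k, b = c%:A + \sum_i rdiv i b * gen k i.
Proof.
exists (b@_mone); rewrite [b]monalgE raddf_sum scaler_suml.
under [X in _ + X]eq_bigr => i _ do rewrite raddf_sum mulr_suml.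
rewrite [X in _ + X]exchange_big -big_split /=; apply: eq_bigr => m _.
set c := b@_m; rewrite (malgU_scale c) mcoeffZ.
under eq_bigr => i _ do rewrite linearZ /= -scalerAl rdivU scale1r.
rewrite -scaler_sumr -scalerA -scalerDr; congr (_ *: _).
case: m {c} => m; case/lastP: m => [|m j].
  rewrite big1 ?addr0 => [|i _]; last by rewrite /rdiv_word mul0r.
  rewrite (_ : FMonom [::] = mone); last by apply/eqP; rewrite fmP fm1.
  by rewrite mcoeffU eqxx scale1r.
rewrite mcoeffU (_ : _ == _ = false) ?scale0r ?add0r; last first.
  by rewrite fmP fm1 -size_eq0 size_rcons.
rewrite (bigD1 j) //= big1 ?addr0 => [|i /negbTE ij]; last first.
  by rewrite /rdiv_word /= rev_rcons eq_sym ij mul0r.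
rewrite /rdiv_word /= rev_rcons eqxx revK /gen.
rewrite [RHS]malgM_def fgmulUU mulr1; congr << _ >>.
by apply/eqP; rewrite fmP fmM fmU /= cats1.
Qed.

Variable w : tensor3 k.

Definition rel_mx (j i : 'I_3) : T := \sum_(t < 3) w [tuple j; t; i] *: gen k t.

Lemma rel_ofE j : rel_of w j = \sum_i rel_mx j i * gen k i.
Proof.
rewrite /rel_of exchange_big; apply: eq_bigr => i _; rewrite mulr_suml.
by apply: eq_bigr => t _; rewrite -scalerAl.
Qed.

(** In a product [x * rel_of w j * y] the part of [y] without constant term ends in a generator, and
    what precedes this generator is still in the ideal; the constant part leaves a left multiple of
    the relator. *)
Lemma rel_ideal_dec (a : T) : a \in rel_ideal w ->
  exists f g : 'I_3 -> T, (forall i, f i \in rel_ideal w) /\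
    a = \sum_i f i * gen k i + \sum_j g j * rel_of w j.
Proof.
rewrite inE => /asboolP[s ->]; elim: s => [|[[x j] y] s [f [g [fI e]]]].
  exists (fun=> 0), (fun=> 0); split=> [i|]; first exact: rpred0.
  rewrite big_nil [X in _ = X + _]big1 => [|i _]; last by rewrite mul0r.
  by rewrite add0r big1 // => i _; rewrite mul0r.
have [c yE] := rdiv_dec y.
exists (fun i => x * rel_of w j * rdiv i y + f i), (fun i => (if i == j then c *: x else 0) + g i).
have relI : rel_of w j \in rel_ideal w.
  by rewrite inE; apply/asboolP; exists [:: (1, j, 1)]; rewrite big_seq1 mul1r mulr1.
split=> [i|]; first by apply: rpredD => //; apply/rel_idealMr/rel_idealMl.
rewrite big_cons e /= {1}yE; apply: rel_dec_step.
by rewrite mulr_algr scalerAl.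
Qed.

(** This exactness is the presentation of D(w) itself: lift [u] to T(V), decompose the resulting
    element of the ideal, and compare left coefficients of the generators by [rdiv]. *)
Lemma D_rel_exact (u : 'I_3 -> D_alg w) : \sum_i u i * dx w i = 0 ->
  exists v : 'I_3 -> D_alg w,
  forall i, u i = \sum_j v j * \sum_t w [tuple j; t; i] *: dx w t.
Proof.
move=> u0; have /choice[b bP] i := D_pi_surj (u i).
have [f [g [fI e]]] : exists f g : 'I_3 -> T, (forall i, f i \in rel_ideal w) /\
    \sum_i b i * gen k i = \sum_i f i * gen k i + \sum_j g j * rel_of w j.
  apply: rel_ideal_dec; rewrite -[X in X \in _]subr0 -D_pi_eq rmorph0 -u0 raddf_sum.
  by apply/eqP; apply: eq_bigr => i _; rewrite bP; exact: (rmorphM (D_pi w)).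
exists (fun j => D_pi w (g j)) => i.
have rdivS (F : 'I_3 -> T) : rdiv i (\sum_j F j * gen k j) = F i.
  transitivity (\sum_j (if i == j then F j else 0)).
    by rewrite raddf_sum; apply: eq_bigr => j _; exact: rdiv_gen.
  by rewrite -big_mkcond (big_pred1 i) // => j; rewrite eq_sym.
have bi : b i = f i + \sum_j g j * rel_mx j i.
  apply: (etrans (esym (rdivS b))); apply: (etrans (congr1 (rdiv i) e)).
  transitivity (rdiv i (\sum_i f i * gen k i) +
    rdiv i (\sum_j g j * rel_of w j)); first exact: raddfD.
  congr (_ + _); first exact: rdivS.
  transitivity (rdiv i (\sum_i' (\sum_j g j * rel_mx j i') * gen k i')); last exact: rdivS.
  apply: (congr1 (rdiv i)).
  transitivity (\sum_i' \sum_j g j * rel_mx j i' * gen k i'); last first.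
    by apply: eq_bigr => i' _; rewrite mulr_suml.
  rewrite exchange_big; apply: eq_bigr => j _; rewrite rel_ofE mulr_sumr.
  by apply: eq_bigr => i' _; exact: mulrA.
rewrite bP bi raddfD /=.
have -> : D_pi w (f i) = 0.
  by apply/eqP; rewrite -(rmorph0 (D_pi w)) D_pi_eq subr0 fI.
rewrite add0r raddf_sum; apply: eq_bigr => j _; rewrite [LHS]rmorphM; congr (_ * _).
by rewrite raddf_sum; apply: eq_bigr => t _; rewrite [LHS]linearZ.
Qed.
End Presentation.

(** * Central squares and spanning monomials *)

Section CentralSquares.
Variables (k : fieldType) (A : algType k).

Definition comm2 (a b : A) := a * b - b * a.

(** In the commutator of [q * r + r * q] with [q] the terms [q * r * q] cancel, leaving only the
    commutator of [q * q] with [r]. *)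
Lemma relation_comm (c : k) (p q r : A) : q * r + r * q + c *: (p * p) = 0 ->
  c *: comm2 (p * p) q = comm2 (q * q) r /\ c *: comm2 (p * p) r = comm2 (r * r) q.
Proof.
move=> /eqP; rewrite addrC addr_eq0 => /eqP cp.
split; rewrite /comm2 scalerBr [_ *: (p * p * _)]scalerAl [_ *: (_ * (p * p))]scalerAr cp.
  by rewrite mulNr mulrN opprK mulrDl mulrDr !mulrA addrC opprD addrA addrK.
rewrite mulNr mulrN opprK mulrDl mulrDr !mulrA addrC [q * r * r + _]addrC.
by rewrite [r * q * r + _]addrC opprD addrA addrK.
Qed.

Variables (al be ga : k) (x y z : A).
Hypothesis Rx : y * z + z * y + al *: (x * x) = 0.
Hypothesis Ry : z * x + x * z + be *: (y * y) = 0.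
Hypothesis Rz : x * y + y * x + ga *: (z * z) = 0.
Hypothesis abc : al * be * ga != 1.

Lemma scale_fix_eq0 (c : k) (a : A) : c != 1 -> a = c *: a -> a = 0.
Proof.
move=> c1 ac; have : (1 - c) *: a = 0 by rewrite scalerBl scale1r -ac subrr.
by move/eqP; rewrite scaler_eq0 subr_eq0 eq_sym (negbTE c1) => /eqP.
Qed.

(** Three uses of [relation_comm] lead from [x^2, y] back to itself with the factor al be ga, which
    differs from 1. *)
Lemma squares_central : [/\ comm2 (x * x) y = 0, comm2 (x * x) z = 0,
  comm2 (y * y) x = 0, comm2 (y * y) z = 0 & comm2 (z * z) x = 0 /\ comm2 (z * z) y = 0].
Proof.
have [x1 x2] := relation_comm Rx.
have [y1 y2] := relation_comm Ry.
have [z1 z2] := relation_comm Rz.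
have xy0 : comm2 (x * x) y = 0.
  apply: (@scale_fix_eq0 (al * be * ga)) => //.
  by rewrite -{1}z1 -y1 -x1 !scalerA; congr (_ *: _); ring.
have xz0 : comm2 (x * x) z = 0.
  apply: (@scale_fix_eq0 (al * be * ga)) => //.
  by rewrite -{1}y2 -z2 -x2 !scalerA; congr (_ *: _); ring.
have yz0 : comm2 (y * y) z = 0 by rewrite -x1 xy0 scaler0.
have zy0 : comm2 (z * z) y = 0 by rewrite -x2 xz0 scaler0.
by split=> //; [rewrite -z2 zy0 scaler0 | split=> //; rewrite -y1 yz0 scaler0].
Qed.

Lemma xxC : (x * x) * y = y * (x * x) /\ (x * x) * z = z * (x * x).
Proof. by have [/subr0_eq ? /subr0_eq ? _ _ _] := squares_central. Qed.
Lemma yyC : (y * y) * x = x * (y * y) /\ (y * y) * z = z * (y * y).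
Proof. by have [_ _ /subr0_eq ? /subr0_eq ? _] := squares_central. Qed.
Lemma zzC : (z * z) * x = x * (z * z) /\ (z * z) * y = y * (z * z).
Proof. by have [_ _ _ _ [/subr0_eq ? /subr0_eq ?]] := squares_central. Qed.

Definition xyz p q r : A := x ^+ p * y ^+ q * z ^+ r.

Definition span_xyz n (a : A) := exists s : seq (k * (nat * nat * nat)),
  (forall t, t \in s -> (t.2.1.1 + t.2.1.2 + t.2.2)%N = n) /\
  a = \sum_(t <- s) t.1 *: xyz t.2.1.1 t.2.1.2 t.2.2.

Lemma span_xyz0 n : span_xyz n 0.
Proof. by exists [::]; split=> //; rewrite big_nil. Qed.

Lemma span_xyzD n a b : span_xyz n a -> span_xyz n b -> span_xyz n (a + b).
Proof.
move=> [s [sn ->]] [t [tn ->]]; exists (s ++ t); split; last by rewrite big_cat.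
by move=> u; rewrite mem_cat => /orP[/sn|/tn].
Qed.

Lemma span_xyzZ n c a : span_xyz n a -> span_xyz n (c *: a).
Proof.
move=> [s [sn ->]]; exists [seq (c * t.1, t.2) | t <- s]; split.
  by move=> _ /mapP[t /sn <- ->].
by rewrite big_map scaler_sumr; apply: eq_bigr => t _; rewrite scalerA.
Qed.

Lemma span_xyzN n a : span_xyz n a -> span_xyz n (- a).
Proof. by move=> /(span_xyzZ (-1)); rewrite scaleN1r. Qed.

Lemma mem_span_xyz n p q r : (p + q + r)%N = n -> span_xyz n (xyz p q r).
Proof.
move=> e; exists [:: (1, (p, q, r))]; split; last by rewrite big_seq1 scale1r.
by move=> t; rewrite inE => /eqP ->.
Qed.

Lemma expr_even (a b : A) p : a * a * b = b * (a * a) -> ~~ odd p -> a ^+ p * b = b * a ^+ p.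
Proof.
move=> ab ep; rewrite -(odd_double_half p) (negbTE ep) add0n -mul2n exprM expr2.
exact/esym/commrX/esym.
Qed.

(** Even powers of [x] are central, so at most one exchange of [y] with [x] is needed; its
    correction [z * z] is central and moves to the end, whence [r.+2]. *)
Lemma mul_y_xyz p q r : y * xyz p q r =
  if odd p then - xyz p q.+1 r - ga *: xyz p.-1 q r.+2 else xyz p q.+1 r.
Proof.
have [xy _] := xxC; have [zx zy] := zzC; rewrite /xyz.
case: ifP => [op|/negbT ep]; last first.
  by rewrite !mulrA -(expr_even xy ep) exprS !mulrA.
case: p op => //= p ep.
have yx : y * x = - (x * y) - ga *: (z * z).
  apply/eqP; rewrite -subr_eq0 opprB opprK; apply/eqP.
  by rewrite addrA addrC addrA Rz.
rewrite exprS -!mulrA mulrA yx mulrBl !mulNr; congr (- _ - _).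
  by rewrite -!mulrA; congr (_ * _); rewrite exprS !mulrA -(expr_even xy ep).
rewrite -scalerAl; congr (_ *: _).
have zzx u : z * z * x ^+ p * u = x ^+ p * (z * z * u).
  by rewrite [RHS]mulrA; congr (_ * u); exact: (commrX p zx).
have zzy u : z * z * (y ^+ q * u) = y ^+ q * (z * z * u).
  by rewrite [LHS]mulrA [RHS]mulrA; congr (_ * u); exact: (commrX q zy).
by rewrite [LHS]mulrA zzx zzy !exprS !mulrA.
Qed.

Lemma z_expr_y q u : z * (y ^+ q * u) =
  if odd q then - (y ^+ q * (z * u)) - al *: (x * x * (y ^+ q.-1 * u)) else y ^+ q * (z * u).
Proof.
have [xy xz] := xxC; have [_ yz] := yyC.
case: ifP => [oq|/negbT eq]; last by rewrite !mulrA -(expr_even yz eq).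
case: q oq => //= q eq.
have zy : z * y = - (y * z) - al *: (x * x).
  apply/eqP; rewrite -subr_eq0 opprB opprK; apply/eqP.
  by rewrite addrA addrC addrA Rx.
rewrite exprS -!mulrA mulrA zy mulrBl !mulNr; congr (- _ - _).
  by rewrite -!mulrA; congr (_ * _); rewrite !mulrA -(expr_even yz eq).
by rewrite -scalerAl !mulrA.
Qed.

Lemma mul_z_xyz p q r : span_xyz (p + q + r).+1 (z * xyz p q r).
Proof.
have [xy xz] := xxC; have [yx yz] := yyC.
have xzy p' : span_xyz (p' + q + r).+1 (x ^+ p' * (z * (y ^+ q * z ^+ r))).
  rewrite z_expr_y; case: ifP => [oq|_]; last first.
    by rewrite -exprS mulrA; apply: mem_span_xyz; lia.
  rewrite mulrBr mulrN; apply: span_xyzD; apply: span_xyzN.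
    by rewrite -exprS mulrA; apply: mem_span_xyz; lia.
  rewrite -scalerAr; apply: span_xyzZ.
  rewrite !mulrA -!exprSr; apply: mem_span_xyz.
  by case: q oq => //= q' _; lia.
rewrite /xyz -!mulrA; have [op|ep] := boolP (odd p); last first.
  by rewrite mulrA -(expr_even xz ep) -mulrA.
case: p op xzy => //= p ep xzy.
have zx : z * x = - (x * z) - be *: (y * y).
  apply/eqP; rewrite -subr_eq0 opprB opprK; apply/eqP.
  by rewrite [_ + x * z]addrC addrA Ry.
rewrite exprS -!mulrA mulrA zx mulrBl mulNr; apply: span_xyzD; apply: span_xyzN.
  have -> u : x * z * (x ^+ p * u) = x ^+ p.+1 * (z * u).
    by rewrite exprS -!mulrA; congr (_ * _); rewrite !mulrA (expr_even xz ep).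
  exact: xzy.
rewrite -scalerAl; apply: span_xyzZ.
have -> : y * y * (x ^+ p * (y ^+ q * z ^+ r)) = xyz p q.+2 r.
  by rewrite /xyz !exprS !mulrA; do 2![congr (_ * _)]; rewrite -[RHS]mulrA (commrX p yx).
by apply: mem_span_xyz; lia.
Qed.

Lemma span_xyz_mul n a : span_xyz n a ->
  [/\ span_xyz n.+1 (x * a), span_xyz n.+1 (y * a) & span_xyz n.+1 (z * a)].
Proof.
have sum (u : A) s : (forall t : k * (nat * nat * nat), t \in s -> (t.2.1.1 + t.2.1.2 + t.2.2)%N = n) ->
   (forall p q r, (p + q + r)%N = n -> span_xyz n.+1 (u * xyz p q r)) ->
   span_xyz n.+1 (u * \sum_(t <- s) t.1 *: xyz t.2.1.1 t.2.1.2 t.2.2).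
  elim: s => [|t s IHs] sn su; first by rewrite big_nil mulr0; apply: span_xyz0.
  rewrite big_cons mulrDr -scalerAr; apply: span_xyzD; last first.
    by apply: IHs => // v vs; apply: sn; rewrite inE vs orbT.
  by apply/span_xyzZ/su/sn; rewrite inE eqxx.
move=> [s [sn ->]]; split; apply: sum => // p q r e.
- by rewrite /xyz !mulrA -exprS; apply: mem_span_xyz; lia.
- rewrite mul_y_xyz; case: ifP => [op|_]; last by apply: mem_span_xyz; lia.
  apply: span_xyzD; apply: span_xyzN; last apply: span_xyzZ; apply: mem_span_xyz; first lia.
  by case: p op e => //= p _; lia.
- by rewrite -e; apply: mul_z_xyz.
Qed.
End CentralSquares.

(** * Clifford algebras by iterated doubling *)

Section Doubling.
Variable Q : nzRingType.

Definition mx2 (a b c d : Q) : 'M[Q]_2 :=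
  \matrix_(i < 2, j < 2) if i == ord0 then (if j == ord0 then a else b)
                         else (if j == ord0 then c else d).

Lemma mx2P (M N : 'M[Q]_2) : M ord0 ord0 = N ord0 ord0 -> M ord0 ord_max = N ord0 ord_max ->
  M ord_max ord0 = N ord_max ord0 -> M ord_max ord_max = N ord_max ord_max -> M = N.
Proof.
move=> e1 e2 e3 e4; apply/matrixP => i j.
have H (u : 'I_2) : u = ord0 \/ u = ord_max.
  by case: u => [[|[]]] // h; [left | right]; apply/val_inj.
by case: (H i) => ->; case: (H j) => ->.
Qed.

Lemma mul_mx2 a b c d a' b' c' d' : mx2 a b c d * mx2 a' b' c' d' =
  mx2 (a * a' + b * c') (a * b' + b * d') (c * a' + d * c') (c * b' + d * d').
Proof.
by apply: mx2P; rewrite mxE big_ord_recl big_ord1 !mxE.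
Qed.

Lemma add_mx2 a b c d a' b' c' d' : mx2 a b c d + mx2 a' b' c' d' =
  mx2 (a + a') (b + b') (c + c') (d + d').
Proof. by apply: mx2P; rewrite !mxE. Qed.

Lemma scalar_mx2 s : s%:M = mx2 s 0 0 s.
Proof. by apply: mx2P; rewrite !mxE. Qed.

Lemma scalar_mx_central s : (forall t : Q, s * t = t * s) ->
  forall M : 'M[Q]_2, s%:M * M = M * s%:M.
Proof.
move=> sC M; rewrite -[M](_ : mx2 (M ord0 ord0) (M ord0 ord_max) (M ord_max ord0)
  (M ord_max ord_max) = M); last by apply: mx2P; rewrite !mxE.
by rewrite scalar_mx2 !mul_mx2 !mul0r !mulr0 !addr0 !add0r !sC.
Qed.

(* the left multiplications by a new generator, by a generator [u] of [Q]
   whose anticommutator with it is [f], and by [v] likewise *)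
Section Relations.
Variables (a u f v g : Q).
Hypothesis aC : forall t : Q, a * t = t * a.
Hypothesis fC : forall t : Q, f * t = t * f.
Hypothesis gC : forall t : Q, g * t = t * g.
Let X := mx2 0 a 1 0.
Let Y := mx2 u f 0 (- u).
Let Z := mx2 v g 0 (- v).

Lemma doubling_sqrX : X * X = a%:M.
Proof. by rewrite mul_mx2 scalar_mx2 !mul0r !mul1r !mulr1 !mulr0 !addr0 !add0r. Qed.

Lemma doubling_sqr : Y * Y = (u * u)%:M.
Proof.
by rewrite mul_mx2 scalar_mx2 !mul0r !mulr0 !addr0 !add0r mulrNN mulrN (fC u) subrr.
Qed.

Lemma doubling_anticommX : X * Y + Y * X = f%:M.
Proof.
rewrite !mul_mx2 add_mx2 scalar_mx2 !mul0r !mul1r !mulr1 !mulr0 !addr0 !add0r.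
by rewrite mulrN aC addNr subrr.
Qed.

Lemma doubling_anticomm : Y * Z + Z * Y = (u * v + v * u)%:M.
Proof.
rewrite !mul_mx2 add_mx2 scalar_mx2 !mul0r !mulr0 !addr0 !add0r !mulrNN.
by rewrite !mulrN (fC v) (gC u) addrA subrK subrr.
Qed.
End Relations.

(* the first column of [X ^+ p * T], for [T] upper triangular *)
Lemma doubling_exprX (a : Q) (T : 'M[Q]_2) p (i : 'I_2) :
  (forall t : Q, a * t = t * a) -> T ord_max ord0 = 0 ->
  (mx2 0 a 1 0 ^+ p * T) i ord0 = if i == odd p :> nat then a ^+ p./2 * T ord0 ord0 else 0.
Proof.
move=> aC T0; elim: p i => [|p IHp] i.
  rewrite expr0 !mul1r; case: eqP => [i0|ni]; first by congr (T _ _); apply/val_inj.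
  by rewrite -T0; congr (T _ _); apply/val_inj; case: i ni => [[|[]]].
rewrite exprS -mulrA [LHS]mxE big_ord_recl big_ord1 !IHp !mxE /= uphalf_half.
case: i => [[|[]]] //= hi; case: (odd p);
  rewrite /= ?mul0r ?mul1r ?mulr0 ?add0r ?addr0 ?add1n ?add0n //.
by rewrite mulrA -exprS.
Qed.

Lemma mul_upper (T T' : 'M[Q]_2) : T ord_max ord0 = 0 -> T' ord_max ord0 = 0 ->
  (T * T') ord_max ord0 = 0 /\ (T * T') ord0 ord0 = T ord0 ord0 * T' ord0 ord0.
Proof.
move=> t t'; rewrite !mxE !big_ord_recl !big_ord0 /=.
have -> : lift ord0 ord0 = ord_max :> 'I_2 by apply/val_inj.
by rewrite t t' mul0r !mulr0 !addr0.
Qed.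

Lemma expr_upper (T : 'M[Q]_2) n : T ord_max ord0 = 0 ->
  (T ^+ n) ord_max ord0 = 0 /\ (T ^+ n) ord0 ord0 = T ord0 ord0 ^+ n.
Proof.
move=> t; elim: n => [|n [IH0 IH1]]; first by rewrite expr0 !mxE.
by rewrite !exprS; have [-> ->] := mul_upper t IH0; rewrite IH1.
Qed.
End Doubling.

Section Model.
Variables (k : fieldType) (al be ga : k).

Let C : nzRingType := {poly {poly {poly k}}}.
Let a : C := 'X.
Let b : C := 'X%:P.
Let c : C := 'X%:P%:P.
Let ic : {rmorphism k -> C} := polyC \o (polyC \o polyC).
Let M1 : nzRingType := 'M[C]_2.
Let M2 : nzRingType := 'M[M1]_2.
Let M3 : nzRingType := 'M[M2]_2.

(** The squares of [X], [Y], [Z] are independent central variables a, b, c, and the relations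
    prescribe the anticommutators -ga c, -be b, -al a. Adjoining [Z], then [Y], then [X] by left
    multiplications gives 2 x 2 matrices nested three times over k[a, b, c]. *)
Lemma clifford_model : exists (Q : nzRingType) (iota : {rmorphism k -> Q}) (X Y Z : Q)
    (phi : nat -> nat -> nat -> Q -> k),
  [/\ forall s r, iota s * r = r * iota s,
     [/\ Y * Z + Z * Y + iota al * (X * X) = 0,
        Z * X + X * Z + iota be * (Y * Y) = 0 & X * Y + Y * X + iota ga * (Z * Z) = 0],
     forall p q r u v, phi p q r (u + v) = phi p q r u + phi p q r v,
     forall p q r s u, phi p q r (iota s * u) = s * phi p q r u
   & forall p q r p' q' r', phi p q r (X ^+ p' * Y ^+ q' * Z ^+ r') =
       [&& p == p', q == q' & r == r']%:R].
Proof.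
have C1 (s t : C) : s * t = t * s by exact: (mulrC (s : {poly {poly {poly k}}})).
pose s1 (s : C) : M1 := s%:M; pose s2 (s : C) : M2 := (s%:M : M1)%:M.
pose s3 (s : C) : M3 := ((s%:M : M1)%:M : M2)%:M.
have C2 s (t : M1) : s1 s * t = t * s1 s by apply: scalar_mx_central.
have C3 s (t : M2) : s2 s * t = t * s2 s by apply: scalar_mx_central.
have C4 s (t : M3) : s3 s * t = t * s3 s by apply: scalar_mx_central; exact: (C3 s).
pose Z1 : M1 := mx2 0 c 1 0.
pose Z2 : M2 := mx2 Z1 (s1 (- ic al * a)) 0 (- Z1).
pose Y2 : M2 := mx2 0 (s1 b) 1 0.
pose Z3 : M3 := mx2 Z2 (s2 (- ic be * b)) 0 (- Z2).
pose Y3 : M3 := mx2 Y2 (s2 (- ic ga * c)) 0 (- Y2).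
pose X3 : M3 := mx2 0 (s2 a) 1 0.
pose iota : {rmorphism k -> M3} :=
  (scalar_mx : M2 -> M3) \o ((scalar_mx : M1 -> M2) \o ((scalar_mx : C -> M1) \o ic)).
have iotaE s : iota s = s3 (ic s) by [].
have s1M s t : s1 (s * t) = s1 s * s1 t by exact: (rmorphM (scalar_mx : C -> M1)).
have s2M s t : s2 (s * t) = s2 s * s2 t.
  by rewrite /s2 (rmorphM (scalar_mx : C -> M1)) (rmorphM (scalar_mx : M1 -> M2)).
have s3M s t : s3 (s * t) = s3 s * s3 t.
  by rewrite /s3 (rmorphM (scalar_mx : C -> M1)) (rmorphM (scalar_mx : M1 -> M2))
             (rmorphM (scalar_mx : M2 -> M3)).
have s1N s : s1 (- s) = - s1 s by exact: (rmorphN (scalar_mx : C -> M1)).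
have s2N s : s2 (- s) = - s2 s.
  by rewrite /s2 (rmorphN (scalar_mx : C -> M1)) (rmorphN (scalar_mx : M1 -> M2)).
have s3N s : s3 (- s) = - s3 s.
  by rewrite /s3 (rmorphN (scalar_mx : C -> M1)) (rmorphN (scalar_mx : M1 -> M2))
             (rmorphN (scalar_mx : M2 -> M3)).
have Z1sq : Z1 * Z1 = s1 c by apply: doubling_sqrX.
have Y2sq : Y2 * Y2 = s2 b by apply: doubling_sqrX.
have X3sq : X3 * X3 = s3 a by apply: doubling_sqrX.
have Z2sq : Z2 * Z2 = s2 c by rewrite /s2 -/(s1 c) -Z1sq; apply: doubling_sqr.
have Y3sq : Y3 * Y3 = s3 b by rewrite /s3 -/(s2 b) -Y2sq; apply: doubling_sqr.
have Z3sq : Z3 * Z3 = s3 c by rewrite /s3 -/(s2 c) -Z2sq; apply: doubling_sqr.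
have YZ2 : Y2 * Z2 + Z2 * Y2 = s2 (- ic al * a) by apply: doubling_anticommX.
have YZ3 : Y3 * Z3 + Z3 * Y3 = s3 (- ic al * a).
  by rewrite /s3 -/(s2 _) -YZ2; apply: doubling_anticomm.
have XZ3 : Z3 * X3 + X3 * Z3 = s3 (- ic be * b).
  by rewrite addrC; apply: doubling_anticommX.
have XY3 : X3 * Y3 + Y3 * X3 = s3 (- ic ga * c) by apply: doubling_anticommX.
have s3_cancel s t : s3 (- s * t) + s3 s * s3 t = 0.
  by rewrite -[s3 s * s3 t]s3M mulNr s3N addNr.
pose o (d : bool) : 'I_2 := if d then ord_max else ord0.
have oE d : o d = d :> nat by case: d.
(* The first column is the action on 1. Parities of the exponents select an entry in it, their
   halves the exponents of a, b and c. *)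
pose phi p q r (u : M3) : k := (((u (o (odd p)) ord0 : M2) (o (odd q)) ord0 : M1)
  (o (odd r)) ord0 : {poly {poly {poly k}}})`_p./2`_q./2`_r./2.
have s3_entry s (u : M3) i j : (s3 s * u) i j = s2 s * u i j.
  by rewrite /s3 -[_ * u]/(_ *m u) mul_scalar_mx mxE.
have s2_entry s (u : M2) i j : (s2 s * u) i j = s1 s * u i j.
  by rewrite /s2 -[_ * u]/(_ *m u) mul_scalar_mx mxE.
have s1_entry s (u : M1) i j : (s1 s * u) i j = s * u i j.
  by rewrite /s1 -[_ * u]/(_ *m u) mul_scalar_mx mxE.
exists M3, iota, X3, Y3, Z3, phi; split.
- by move=> s r; rewrite iotaE C4.
- by split; [rewrite YZ3 X3sq | rewrite XZ3 Y3sq | rewrite XY3 Z3sq]; exact: s3_cancel.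
- by move=> p q r u v; rewrite /phi !mxE !coefD.
- by move=> p q r s u; rewrite /phi iotaE s3_entry s2_entry s1_entry !coefCM.
move=> p q r p' q' r'.
have Y30 : Y3 ord_max ord0 = 0 by rewrite mxE.
have Z30 : Z3 ord_max ord0 = 0 by rewrite mxE.
have Z20 : Z2 ord_max ord0 = 0 by rewrite mxE.
have [Yq1 Yq2] := expr_upper q' Y30.
have [Zr1 Zr2] := expr_upper r' Z30.
have [Z2r1 Z2r2] := expr_upper r' Z20.
have [T1 T2] := mul_upper Yq1 Zr1.
have Y300 : Y3 ord0 ord0 = Y2 by rewrite mxE.
have Z300 : Z3 ord0 ord0 = Z2 by rewrite mxE.
have Z200 : Z2 ord0 ord0 = Z1 by rewrite mxE.
have s2X s n : s2 s ^+ n = s2 (s ^+ n).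
  exact: (esym (rmorphXn ((scalar_mx : M1 -> M2) \o (scalar_mx : C -> M1)) n s)).
have s1X s n : s1 s ^+ n = s1 (s ^+ n).
  exact: (esym (rmorphXn (scalar_mx : C -> M1) n s)).
rewrite /phi -mulrA (doubling_exprX _ _ (C3 a) T1) oE.
have parity m n : (m == n) = (odd m == odd n) && (m./2 == n./2).
  apply/eqP/andP => [->|[/eqP om /eqP hm]]; first by rewrite !eqxx.
  by rewrite -(odd_double_half m) -(odd_double_half n) om hm.
have oddE (d d' : bool) : (d == d' :> nat) = (d == d') by case: d; case: d'.
rewrite (parity p) (parity q) (parity r) !oddE.
case: (odd p == odd p'); last by rewrite !mxE !coef0.
rewrite s2X s2_entry T2 Yq2 Zr2 Y300 Z300 (doubling_exprX _ _ (C2 b) Z2r1) oE oddE.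
case: (odd q == odd q'); last by rewrite mulr0 mxE !coef0 andbF.
rewrite s1X !s1_entry Z2r2 Z200 -[Z1 ^+ r']mulr1.
have one0 : (1 : M1) ord_max ord0 = 0 by rewrite mxE.
rewrite (doubling_exprX _ _ (C1 c) one0) oE oddE.
case: (odd r == odd r'); last by rewrite !mulr0 !coef0 !andbF.
rewrite /= [(1 : M1) _ _]mxE mulr1.
have -> : b ^+ q'./2 * c ^+ r'./2 = ('X^(q'./2) * ('X^(r'./2))%:P)%:P :> C.
  by rewrite polyCM !rmorphXn.
rewrite coefMC coefXn; case: (p./2 == _); last by rewrite mul0r !coef0.
rewrite mul1r coefMC coefXn; case: (q./2 == _); last by rewrite mul0r !coef0.
by rewrite mul1r coefXn.
Qed.
End Model.

(** * Exactness by counting dimensions *)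

Section ExactByDimension.
Variable k : fieldType.

Lemma linear_hom (U V : vectType k) (f : U -> V) : linear f ->
  exists F : 'Hom(U, V), forall u, F u = f u.
Proof.
move=> lf; pose f' : {linear U -> V} := HB.pack f (GRing.isLinear.Build k U V *:%R f lf).
by exists (linfun f') => u; rewrite lfunE.
Qed.

(** With exactness at the other places, rank and nullity make the image of [d3] as large as the
    kernel of [d2]. *)
Lemma exact_by_dimension (U0 U1 U2 U3 : vectType k) (d3 : 'Hom(U0, U1))
    (d2 : 'Hom(U1, U2)) (d1 : 'Hom(U2, U3)) :
  (forall u, d3 u = 0 -> u = 0) -> (forall u, d2 (d3 u) = 0) ->
  (forall u, d1 u = 0 <-> exists v, d2 v = u) -> (forall u, exists v, d1 v = u) ->
  (dim U0 + dim U2 = dim U1 + dim U3)%N ->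
  forall u, d2 u = 0 -> exists v, d3 v = u.
Proof.
move=> inj3 d23 ex1 surj1 dimE u d2u.
have rk3 : \dim (d3 @: fullv) = dim U0.
  rewrite limg_dim_eq ?dimvf // capfv; apply/eqP; rewrite -subv0; apply/subvP => v.
  by rewrite memv_ker memv0 => /eqP/inj3 ->.
have rk1 : \dim (d1 @: fullv) = dim U3.
  rewrite -dimvf; congr (\dim _); apply/eqP; rewrite eqEsubv subvf; apply/subvP => v _.
  by have [w <-] := surj1 v; apply: memv_img; apply: memvf.
have ker1 : lker d1 = (d2 @: fullv)%VS.
  apply/eqP; rewrite eqEsubv; apply/andP; split; apply/subvP => v.
    by rewrite memv_ker => /eqP/ex1[w <-]; apply: memv_img; apply: memvf.
  by move=> /memv_imgP[w _ ->]; rewrite memv_ker; apply/eqP/ex1; exists w.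
have := limg_ker_dim d1 fullv; have := limg_ker_dim d2 fullv.
rewrite !capfv ker1 rk1 !dimvf => e2 e1.
have ker2 : lker d2 = (d3 @: fullv)%VS.
  apply/esym/eqP; rewrite eqEdim; apply/andP; split.
    by apply/subvP => v /memv_imgP[w _ ->]; rewrite memv_ker d23.
  by rewrite rk3; lia.
have : u \in lker d2 by rewrite memv_ker d2u.
by rewrite ker2 => /memv_imgP[v _ ->]; exists v.
Qed.

(** Transfers a subspace given by a predicate to row vectors, where dimensions are available. The
    coordinate map [psi] is arbitrary outside [U]. *)
Lemma has_dim_iso (A : algType k) (U : A -> Prop) n : has_dim U n ->
  exists (phi : {linear 'rV[k]_n -> A}) (psi : A -> 'rV[k]_n),
  [/\ forall c, U (phi c), forall a, U a -> phi (psi a) = a & cancel phi psi].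
Proof.
move=> [e [ind span]].
pose f (c : 'rV[k]_n) : A := \sum_i c ord0 i *: e i.
have lf : linear f.
  move=> s u v; rewrite /f scaler_sumr -big_split; apply: eq_bigr => i _.
  by rewrite !mxE scalerDl scalerA.
pose phi : {linear 'rV[k]_n -> A} := HB.pack f (GRing.isLinear.Build k _ A *:%R f lf).
have phiU c : U (phi c) by apply/span; exists (fun i => c ord0 i).
have /choice[psi psiP] a : exists c, U a -> phi c = a.
  have [Ua|nU] := pselect (U a); last by exists 0.
  have [c ac] := (span a).1 Ua; exists (\row_i c i) => _.
  by rewrite ac; apply: eq_bigr => i _; rewrite mxE.
exists phi, psi; split=> // c; apply/eqP; rewrite -subr_eq0; apply/eqP/rowP => i.
rewrite [RHS]mxE; apply: (ind (fun i => (psi (phi c) - c) ord0 i)).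
by rewrite -[LHS]/(phi _) linearB (psiP _ (phiU c)) subrr.
Qed.

Variables (A : algType k) (gr : nat -> A -> Prop) (X : 'I_3 -> A) (M : 'I_3 -> 'I_3 -> A).
Hypothesis gr_dim : forall n, has_dim (gr n) 'C(n.+2, 2).
Hypothesis gr0 : forall n, gr n 0.
Hypothesis grD : forall n a b, gr n a -> gr n b -> gr n (a + b).
Hypothesis grX : forall n a j, gr n a -> gr n.+1 (a * X j).
Hypothesis grM : forall n a j l, gr n a -> gr n.+1 (a * M j l).
Hypothesis gr_gen : forall n a, gr n.+1 a ->
  exists2 u : 'I_3 -> A, (forall j, gr n (u j)) & a = \sum_j u j * X j.
Hypothesis XM : forall l, \sum_j X j * M j l = 0.
Hypothesis MX : forall j, \sum_l M j l * X l = 0.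
Hypothesis exact1 : forall n (u : 'I_3 -> A), (forall j, gr n.+1 (u j)) ->
  \sum_j u j * X j = 0 -> exists2 v : 'I_3 -> A, (forall j, gr n (v j)) &
  forall l, u l = \sum_j v j * M j l.
Hypothesis exact3 : forall n s, gr n s -> (forall j, s * X j = 0) -> s = 0.

(** The terms have degrees n-1, n, n+1, n+2 and ranks 1, 3, 3, 1. The alternating sum of their
    dimensions is a third difference of the quadratic polynomial C(n+2, 2), hence zero; the part of
    degree -1 is 0. *)
Lemma exact2 n (u : 'I_3 -> A) : (forall j, gr n (u j)) ->
  (forall l, \sum_j u j * M j l = 0) ->
  exists2 s, (if n is m.+1 then gr m s else s = 0) & forall l, u l = s * X l.
Proof.
move=> gu uM.
pose gr' n a := if n is m.+1 then gr m a else a = 0.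
have gr'_dim : has_dim (gr' n) 'C(n.+1, 2).
  rewrite /gr'; case: (n) => [|m] //=; exists (fun=> 0); split=> [c _|a]; first by case.
  split=> [->|[c ->]]; last by rewrite big_ord0.
  by exists (fun=> 0); rewrite big_ord0.
have gr'X a j : gr' n a -> gr n (a * X j).
  by rewrite /gr'; case: (n) => [->|m]; [rewrite mul0r | apply: grX].
have exact3' a : gr' n a -> (forall j, a * X j = 0) -> a = 0.
  by rewrite /gr'; case: (n) => [->|m] //; apply: exact3.
have [p0 [q0 [p0U p0K q0K]]] := has_dim_iso gr'_dim.
have [p1 [q1 [p1U p1K q1K]]] := has_dim_iso (gr_dim n).
have [p2 [q2 [p2U p2K q2K]]] := has_dim_iso (gr_dim n.+1).
have [p3 [q3 [p3U p3K q3K]]] := has_dim_iso (gr_dim n.+2).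
have gr_sum m (F : 'I_3 -> A) : (forall j, gr m (F j)) -> gr m (\sum_j F j).
  by move=> h; elim/big_ind: _ => //; apply: grD.
pose V m := {ffun 'I_3 -> 'rV[k]_m}.
have K3 c j : p1 (q1 (p0 c * X j)) = p0 c * X j by apply/p1K/gr'X/p0U.
have K2 (f : 'I_3 -> 'rV_'C(n.+2, 2)) l :
    p2 (q2 (\sum_j p1 (f j) * M j l)) = \sum_j p1 (f j) * M j l.
  by apply/p2K/gr_sum => j; apply: grM.
have K1 (f : 'I_3 -> 'rV_'C(n.+3, 2)) :
    p3 (q3 (\sum_j p2 (f j) * X j)) = \sum_j p2 (f j) * X j.
  by apply/p3K/gr_sum => j; apply: grX.
have lin3 : linear (fun c => [ffun j => q1 (p0 c * X j)] : V _).
  move=> s a b; apply/ffunP => j; rewrite !ffunE; apply: (can_inj q1K).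
  by rewrite [RHS]linearP /= !K3 linearP mulrDl -scalerAl.
have lin2 : linear (fun f : V _ => [ffun l => q2 (\sum_j p1 (f j) * M j l)] : V _).
  move=> s a b; apply/ffunP => l; rewrite !ffunE; apply: (can_inj q2K).
  rewrite [RHS]linearP /= !K2 scaler_sumr -big_split; apply: eq_bigr => j _.
  by rewrite !ffunE linearP mulrDl -scalerAl.
have lin1 : linear (fun f : V _ => q3 (\sum_j p2 (f j) * X j)).
  move=> s a b; apply: (can_inj q3K).
  rewrite [RHS]linearP /= !K1 scaler_sumr -big_split; apply: eq_bigr => j _.
  by rewrite !ffunE linearP mulrDl -scalerAl.
have [d3 d3E] := linear_hom lin3.
have [d2 d2E] := linear_hom lin2.
have [d1 d1E] := linear_hom lin1.
have [||||||c dc] := @exact_by_dimension _ _ _ _ d3 d2 d1 _ _ _ _ _ [ffun j => q1 (u j)].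
- move=> c; rewrite d3E => /ffunP c0; apply: (can_inj q0K); rewrite linear0.
  apply: (exact3' _ (p0U c)) => j; have := c0 j; rewrite !ffunE => q0'.
  by rewrite -K3 q0' linear0.
- move=> c; rewrite d2E; apply/ffunP => l; rewrite !ffunE; apply: (can_inj q2K).
  rewrite linear0 K2.
  under eq_bigr => j _ do rewrite d3E ffunE K3 -mulrA.
  by rewrite -mulr_sumr XM mulr0.
- move=> f; rewrite d1E; split=> [f0|[g <-]].
    have [||v gv vP] := exact1 (n := n) (u := fun j => p2 (f j)) => //.
      by rewrite -K1 f0 linear0.
    exists [ffun j => q1 (v j)]; rewrite d2E; apply/ffunP => l; rewrite ffunE.
    apply: (can_inj q2K); rewrite vP K2.
    by apply: eq_bigr => j _; rewrite ffunE p1K.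
  apply: (can_inj q3K); rewrite linear0 K1.
  rewrite d2E (eq_bigr (fun l => \sum_j p1 (g j) * (M j l * X l))); last first.
    by move=> l _; rewrite ffunE K2 mulr_suml; apply: eq_bigr => j _; rewrite mulrA.
  by rewrite exchange_big big1 // => j _; rewrite -mulr_sumr MX mulr0.
- move=> c; have [v gv cv] := gr_gen (p3U c).
  exists [ffun j => q2 (v j)]; apply: (can_inj q3K); rewrite d1E K1.
  by rewrite cv; apply: eq_bigr => j _; rewrite ffunE p2K.
- have dimV m : dim {ffun 'I_3 -> 'rV[k]_m} = (3 * m)%N.
    by rewrite [LHS]/dim /= card_ord; congr (3 * _)%N; exact: mul1n.
  by rewrite !dimV !dim_matrix !binS !bin1 !bin0; lia.
- rewrite d2E; apply/ffunP => l; rewrite !ffunE; apply: (can_inj q2K).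
  rewrite linear0 K2.
  by rewrite -[RHS](uM l); apply: eq_bigr => j _; rewrite ffunE p1K.
exists (p0 c); first exact: p0U.
move=> l; move/ffunP: dc => /(_ l); rewrite d3E !ffunE => e.
by rewrite -[LHS]p1K // -e K3.
Qed.
End ExactByDimension.

(** * The Hilbert series and the monomial basis *)

Lemma card_simplex n : #|[set t : 'I_n.+1 * 'I_n.+1 | (t.1 + t.2 <= n)%N]| = 'C(n.+2, 2).
Proof.
transitivity (\sum_(p < n.+1) \sum_(q < n.+1 | (p + q <= n)%N) 1)%N.
  by rewrite pair_big_dep /= -sum1_card; apply: eq_bigl => t; rewrite inE.
rewrite (eq_bigr (fun p : 'I_n.+1 => (n - p).+1)) => [|p _].
  rewrite (reindex_inj rev_ord_inj) /=.
  rewrite (eq_bigr (fun p : 'I_n.+1 => p.+1)) => [|p _]; last first.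
    by have := ltn_ord p; rewrite ltnS => h; rewrite subSS subKn.
  by rewrite -bin2_sum big_mkord [RHS]big_ord_recl add0n.
have pn : ((n - p).+1 <= n.+1)%N by lia.
rewrite -[RHS]card_ord -sum1_card (big_ord_widen _ (fun=> 1%N) pn).
by apply: eq_bigl => q; have := ltn_ord p; rewrite !ltnS => h; apply/idP/idP; lia.
Qed.

Lemma hilbert_coef n :
  \sum_(i < n.+1) ((1 - 'X : {poly int}) ^+ 3)`_i * ('C((n - i).+2, 2))%:R = (n == 0%N)%:R.
Proof.
have coefE i : ((1 - 'X : {poly int}) ^+ 3)`_i = nth 0 [:: 1; -3%:Z; 3%:Z; -1] i.
  have -> : (1 - 'X : {poly int}) ^+ 3 = 1 - 3%:R%:P * 'X + 3%:R%:P * 'X^2 - 'X^3.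
    by rewrite polyC_natr; ring.
  rewrite !(coefD, coefN) coef1 !coefCM coefX !coefXn.
  by case: i => [|[|[|[|i]]]] //=; rewrite ?nth_nil ?mulr0 ?mulr1 ?subr0 ?addr0 ?sub0r ?add0r ?oppr0.
under eq_bigr => i _ do rewrite coefE.
case: n => [|[|[|n]]].
- by rewrite big_ord1.
- by rewrite !big_ord_recl big_ord0.
- by rewrite !big_ord_recl big_ord0.
rewrite 4!big_ord_recl big1 ?addr0 => [|i _]; last by rewrite /= nth_nil mul0r.
rewrite [_ == _]/= /bump /= !mul1r !mulN1r.
rewrite (_ : (n.+3 - (1 + 0) = n.+2)%N); last by lia.
rewrite (_ : (n.+3 - (1 + (1 + 0)) = n.+1)%N); last by lia.
rewrite (_ : (n.+3 - (1 + (1 + (1 + 0))) = n)%N); last by lia.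
by rewrite !binS !bin1 !bin0 !natrD; ring.
Qed.

Section XYZBasis.
Variables (k : fieldType) (A : algType k) (gr : nat -> A -> Prop) (x y z : A).
Variable phi : nat -> nat -> nat -> A -> k.
Hypothesis phiD : forall p q r u v, phi p q r (u + v) = phi p q r u + phi p q r v.
Hypothesis phiZ : forall p q r c u, phi p q r (c *: u) = c * phi p q r u.
Hypothesis phi_xyz : forall p q r p' q' r',
  phi p q r (xyz x y z p' q' r') = [&& p == p', q == q' & r == r']%:R.
Hypothesis gr0 : forall n, gr n 0.
Hypothesis grD : forall n a b, gr n a -> gr n b -> gr n (a + b).
Hypothesis grZ : forall n c a, gr n a -> gr n (c *: a).
Hypothesis gr_xyz : forall p q r, gr (p + q + r) (xyz x y z p q r).
Hypothesis gr_span : forall n a, gr n a -> span_xyz x y z n a.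

Lemma phi0 p q r : phi p q r 0 = 0.
Proof. by rewrite -(scale0r 0) phiZ mul0r. Qed.

Lemma phi_sum p q r (I : Type) (s : seq I) (P : pred I) (F : I -> A) :
  phi p q r (\sum_(i <- s | P i) F i) = \sum_(i <- s | P i) phi p q r (F i).
Proof.
apply: (big_morph (phi p q r)); first exact: phiD.
exact: phi0.
Qed.

Let simplex n := [set t : 'I_n.+1 * 'I_n.+1 | (t.1 + t.2 <= n)%N].
Let mon n (t : 'I_n.+1 * 'I_n.+1) := xyz x y z t.1 t.2 (n - t.1 - t.2).

Lemma span_simplex n a : span_xyz x y z n a ->
  exists c, a = \sum_(t in simplex n) c t *: mon t.
Proof.
move=> [s [sn ->]]; elim: s sn => [|[c [[p q] r]] s IHs] sn.
  by exists (fun=> 0); rewrite big_nil big1 // => t _; rewrite scale0r.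
have [|d dP] := IHs; first by move=> t ts; apply: sn; rewrite inE ts orbT.
have := sn (c, (p, q, r)); rewrite inE eqxx => /(_ isT) /= pqr.
have pn : (p < n.+1)%N by lia.
have qn : (q < n.+1)%N by lia.
pose t0 : 'I_n.+1 * 'I_n.+1 := (Ordinal pn, Ordinal qn).
have t0S : t0 \in simplex n by rewrite inE /=; lia.
exists (fun t => (if t == t0 then c else 0) + d t).
rewrite big_cons dP; under [in RHS]eq_bigr => t _ do rewrite scalerDl.
rewrite big_split /= [X in _ = X + _](bigD1 t0) //= eqxx [X in _ = _ + X + _]big1 ?addr0 => [|t /andP[_ /negbTE ->]].
  by congr (_ *: xyz _ _ _ _ _ _ + _); rewrite /=; lia.
by rewrite scale0r.
Qed.

(** The shift [d] of the first exponent is 0 for the independence of the monomials and 2 for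
    multiplication by [x * x]. *)
Lemma phi_simplex n (c : 'I_n.+1 * 'I_n.+1 -> k) d t0 : t0 \in simplex n ->
  phi (d + t0.1) t0.2 (n - t0.1 - t0.2)
    (\sum_(t in simplex n) c t *: xyz x y z (d + t.1) t.2 (n - t.1 - t.2)) = c t0.
Proof.
move=> t0S; rewrite phi_sum (bigD1 t0) //= phiZ phi_xyz !eqxx mulr1 big1 ?addr0 //.
move=> t /andP[_ tt0]; rewrite phiZ phi_xyz eqn_add2l.
case: eqP => [e1|]; last by rewrite mulr0.
case: eqP => [e2|]; last by rewrite mulr0.
by case/eqP: tt0; case: t t0 e1 e2 {t0S} => t1 t2 [u1 u2] /= /val_inj -> /val_inj ->.
Qed.

Lemma xyz_has_dim n : has_dim (gr n) 'C(n.+2, 2).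
Proof.
rewrite -card_simplex; pose e (i : 'I_#|simplex n|) := mon (enum_val i).
have sumE c : \sum_i c i *: e i = \sum_(t in simplex n)
    (if [pick i | enum_val i == t] is Some i then c i else 0) *: mon t.
  rewrite [RHS]big_enum_val; apply: eq_bigr => i _.
  by case: pickP => [j /eqP/enum_val_inj ->|/(_ i)] //; rewrite eqxx.
exists e; split=> [c c0 i|a].
  have tS := enum_valP i.
  have := phi_simplex (fun t => if [pick i | enum_val i == t] is Some i then c i else 0) 0 tS.
  rewrite -sumE c0; case: pickP => [j /eqP/enum_val_inj -> <-|/(_ i)]; last by rewrite eqxx.
  by rewrite phi0.
split=> [/gr_span/span_simplex[c ->]|[c ->]].
  exists (fun i => c (enum_val i)).
  by rewrite [LHS]big_enum_val.
elim/big_ind: _ => // [u v|i _]; first exact: grD.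
apply: grZ; have := enum_valP i; rewrite inE => h.
rewrite /e /mon; move: (enum_val i) h => [[p hp] [q hq]] /= h.
by have := gr_xyz p q (n - p - q); rewrite (_ : p + q + _ = n)%N //; lia.
Qed.

(** From [s * x = 0] follows [s * (x * x) = 0], and multiplication by the central square only shifts
    the monomial basis. *)
Lemma xyz_mulx_inj n s : (forall p q r, x * x * xyz x y z p q r = xyz x y z p q r * (x * x)) ->
  gr n s -> s * x = 0 -> s = 0.
Proof.
move=> xxC /gr_span/span_simplex[c ->] sx.
have : (\sum_(t in simplex n) c t *: mon t) * (x * x) = 0 by rewrite mulrA sx mul0r.
rewrite mulr_suml.
rewrite (eq_bigr (fun t => c t *: xyz x y z (2 + t.1) t.2 (n - t.1 - t.2))) => [h|t _].
  by apply: big1 => t tS; rewrite -(phi_simplex c 2 tS) h phi0 scale0r.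
by rewrite -scalerAl -xxC /mon /xyz !exprS !mulrA.
Qed.
End XYZBasis.

(** * The complex of length three of a symmetric potential *)

Section KoszulThree.
Variables (k : fieldType) (w : tensor3 k).

Definition krk := nth 0%N [:: 1; 3; 3; 1]%N.

Lemma krk_big i : (3 < i)%N -> krk i = 0%N.
Proof. by move=> i3; rewrite /krk nth_default. Qed.

Lemma krk_empty i : (3 < i)%N -> 'I_(krk i) -> False.
Proof.
by move=> i3 j; have := leq_ltn_trans (leq0n j) (ltn_ord j); rewrite krk_big.
Qed.

(** The outer differentials are the column and the row of the three variables, and the middle one is
    the matrix [polar_mx] of linear forms. With this choice [knu_sym] becomes the symmetry of [w] in
    adjacent indices. *)
Definition knu i : 'I_(krk i.+1) -> 'I_(krk i) -> 'I_3 -> k :=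
  match i return 'I_(krk i.+1) -> 'I_(krk i) -> 'I_3 -> k with
  | 0%N => fun j _ t => (j == t :> 'I_3)%:R
  | 1%N => fun j l t => w [tuple j; t; l]
  | 2%N => fun _ l t => (l == t :> 'I_3)%:R
  | _ => fun _ _ _ => 0
  end.

Definition symmetric_coefs :=
  (forall i j l, w [tuple i; j; l] = w [tuple j; i; l]) /\
  (forall i j l, w [tuple i; j; l] = w [tuple i; l; j]).

Lemma knu_sym : symmetric_coefs ->
  forall i (j : 'I_(krk i.+2)) (m : 'I_(krk i)) t s,
  \sum_l knu j l t * knu l m s = \sum_l knu j l s * knu l m t.
Proof.
have pick (F : 'I_3 -> k) t : \sum_l (l == t)%:R * F l = F t.
  rewrite (bigD1 t) //= eqxx mul1r big1 ?addr0 // => l /negbTE ->.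
  by rewrite mul0r.
have pick' (F : 'I_3 -> k) t : \sum_l F l * (l == t)%:R = F t.
  by under eq_bigr => l _ do rewrite mulrC; exact: pick.
move=> [w1 w2] [|[|i]] j m t s /=.
- by rewrite !pick' w2.
- by rewrite !pick w1.
- by rewrite [LHS]big1 ?[RHS]big1 // => l _; rewrite mul0r.
Qed.

Section Data.
Variables (R : nzRingType) (iota : {rmorphism k -> R}) (X : 'I_3 -> R).
Variables (gr : nat -> R -> Prop) (eps : {rmorphism R -> k}).

Definition polar_mx j l : R := \sum_t iota (w [tuple j; t; l]) * X t.

Record graded_generated : Prop := GradedGenerated {
  gg_cent : forall c r, iota c * r = r * iota c;
  gg_0 : forall n, gr n 0;
  gg_D : forall n a b, gr n a -> gr n b -> gr n (a + b);
  gg_Z : forall n c a, gr n a -> gr n (iota c * a);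
  gg_X : forall n a t, gr n a -> gr n.+1 (a * X t);
  gg_dec : forall a, exists (N : nat) (f : nat -> R),
        (forall n, gr n (f n)) /\ a = \sum_(n < N) f n;
  gg_direct : forall (N : nat) (f : nat -> R),
        (forall n, gr n (f n)) -> \sum_(n < N) f n = 0 ->
        forall n, (n < N)%N -> f n = 0;
  gg_conn : forall a, gr 0%N a -> exists c, a = iota c;
  gg_gen : forall n a, gr n.+1 a ->
    exists2 u : 'I_3 -> R, (forall j, gr n (u j)) & a = \sum_j u j * X j;
  gg_rel : forall j, \sum_l polar_mx j l * X l = 0
}.

(** The part of degree [n - 1], where degree -1 means 0. *)
Definition pregr n a := if n is m.+1 then gr m a else a = 0.

Definition graded_exact : Prop :=
  [/\ forall n (u : 'I_3 -> R), (forall j, gr n (u j)) -> \sum_j u j * X j = 0 ->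
        exists2 v, (forall j, pregr n (v j)) & forall l, u l = \sum_j v j * polar_mx j l,
      forall n (u : 'I_3 -> R), (forall j, gr n (u j)) -> (forall l, \sum_j u j * polar_mx j l = 0) ->
        exists2 s, pregr n s & forall l, u l = s * X l
    & forall n s, gr n s -> (forall j, s * X j = 0) -> s = 0].

Definition ungraded_exact : Prop :=
  [/\ forall u : 'I_3 -> R, \sum_j u j * X j = 0 ->
        exists v, forall l, u l = \sum_j v j * polar_mx j l,
      forall u : 'I_3 -> R, (forall l, \sum_j u j * polar_mx j l = 0) ->
        exists s, forall l, u l = s * X l
    & forall s, (forall j, s * X j = 0) -> s = 0].

Hypothesis sym : symmetric_coefs.
Hypothesis gg : graded_generated.
Hypothesis ge : graded_exact.

Let kmx := kmx iota X knu.

Lemma iota_pick (F : 'I_3 -> R) t : \sum_s iota (t == s)%:R * F s = F t.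
Proof.
rewrite (bigD1 t) //= eqxx rmorph1 mul1r big1 ?addr0 // => l.
by rewrite eq_sym => /negbTE ->; rewrite rmorph0 mul0r.
Qed.

Lemma kmx0 j l : kmx (i := 0) j l = X j.
Proof. exact: iota_pick. Qed.

Lemma kmx2 j l : kmx (i := 2) j l = X l.
Proof. exact: iota_pick. Qed.

Lemma polar_mx_sym j l : polar_mx j l = polar_mx l j.
Proof.
case: sym => w1 w2; apply: eq_bigr => t _; congr (iota _ * _).
by rewrite w2 w1 w2.
Qed.

Lemma X_polar l : \sum_j X j * polar_mx j l = 0.
Proof.
rewrite -[RHS](gg_rel gg l) /polar_mx.
under eq_bigr => j _ do rewrite mulr_sumr.
under [RHS]eq_bigr => j _ do rewrite mulr_suml.
rewrite [RHS]exchange_big; apply: eq_bigr => j _; apply: eq_bigr => t _.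
case: sym => w1 w2.
by rewrite mulrA -(gg_cent gg) -!mulrA w2 w1.
Qed.

Lemma kmx_comp3 : forall i (j : 'I_(krk i.+2)) (m : 'I_(krk i)),
  \sum_l kmx j l * kmx l m = 0.
Proof.
case=> [|[|i]] j m.
- by rewrite -[RHS](gg_rel gg j); apply: eq_bigr => l _; rewrite kmx0.
- by rewrite -[RHS](X_polar m); apply: eq_bigr => l _; rewrite kmx2.
- apply: big1 => l _; rewrite [X in X * _]big1 ?mul0r // => t _.
  by case: i j m l => [|i] j m l; rewrite /= rmorph0 mul0r.
Qed.

Lemma kgr_gen n a : gr n.+1 a ->
  exists2 u : 'I_(krk 1) -> R, (forall j, gr n (u j)) &
     forall l : 'I_(krk 0), a = \sum_j u j * kmx j l.
Proof.
move=> /(gg_gen gg)[u gu ->]; exists u => // l.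
by apply: eq_bigr => j _; rewrite kmx0.
Qed.

Lemma kgr_exact i n (u : 'I_(krk i.+1) -> R) : (forall j, gr n (u j)) ->
  (forall l, \sum_j u j * kmx j l = 0) ->
  exists2 v : 'I_(krk i.+2) -> R, (forall j, if n is m.+1 then gr m (v j) else v j = 0) &
     forall l, u l = \sum_j v j * kmx j l.
Proof.
case: ge => e1 e2 e3; case: i u => [|[|[|i]]] u gu uk.
- have [|v gv vP] := e1 n u gu; last by exists v.
  by rewrite -[RHS](uk ord0); apply: eq_bigr => j _; rewrite kmx0.
- have [//|s gs sP] := e2 n u gu.
  by exists (fun=> s) => // l; rewrite big_ord1 kmx2.
- exists (fun=> 0) => [j|l]; first by case: j.
  rewrite big_ord0; apply: (e3 n); first exact: gu.
  move=> j; rewrite -[RHS](uk j) big_ord1 kmx2; congr (u _ * _).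
  by apply/val_inj; case: l => [[]].
- by exists (fun=> 0) => [j|l]; [case: (krk_empty _ j) | case: (krk_empty _ l)].
Qed.

Lemma three_gldim_le : left_gldim_le R 3.
Proof.
apply: (koszul_gldim_le (iota := iota) (X := X) (nu := knu) (gr := gr)
  (gg_cent gg) erefl (knu_sym sym) kmx_comp3 (gg_0 gg) (gg_D gg) (gg_Z gg) (gg_X gg)
  (gg_dec gg) (gg_direct gg) (gg_conn gg) kgr_gen kgr_exact).
exact: krk_big.
Qed.

Lemma three_ungraded_exact : ungraded_exact.
Proof.
have ex := @left_exact _ _ iota _ X krk knu gr (gg_cent gg)
  kmx_comp3 (gg_0 gg) (gg_D gg) (gg_Z gg) (gg_X gg) (gg_dec gg) (gg_direct gg) kgr_exact.
split.
- move=> u u0; have [|v vP] := ex 0%N u; last by exists v.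
  by move=> l; rewrite -[RHS]u0; apply: eq_bigr => j _; congr (_ * _); apply: kmx0.
- move=> u u0; have [//|v vP] := ex 1%N u; exists (v ord0) => l.
  by rewrite vP big_ord1; congr (_ * _); apply: kmx2.
- move=> s s0; have [|v vP] := ex 2%N (fun=> s); last by rewrite (vP ord0) big_ord0.
  by move=> l; rewrite big_ord1 -[RHS](s0 l); congr (_ * _); apply: kmx2.
Qed.

Hypothesis eps_iota : forall c, eps (iota c) = c.
Hypothesis eps_X : forall t, eps (X t) = 0.

Section Right.
Hypothesis right0 : forall r, eps r = 0 -> exists h, r = \sum_l X l * h l.
Hypothesis right1 : forall r, \sum_l X l * r l = 0 ->
  exists h, forall j, r j = \sum_l polar_mx j l * h l.
Hypothesis right2 : forall r, (forall j, \sum_l polar_mx j l * r l = 0) ->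
  exists h, forall j, r j = X j * h.
Hypothesis right3 : forall r, (forall j, X j * r = 0) -> r = 0.

Lemma three_right_exact0 (r : 'I_(krk 0) -> R) :
  (forall j, \sum_l kmx j l * r l = 0) -> forall l, r l = 0.
Proof.
move=> r0 l; apply: right3 => j; rewrite -[RHS](r0 j) big_ord1 kmx0.
by congr (_ * r _); apply/val_inj; case: l => [[]].
Qed.

Lemma three_right_exactS i : i != 2 -> forall r : 'I_(krk i.+1) -> R,
  (forall j, \sum_l kmx j l * r l = 0) ->
  exists h : 'I_(krk i) -> R, forall j, r j = \sum_l kmx j l * h l.
Proof.
case: i => [|[|[|i]]] // _ r r0.
- have [h hP] := right2 r0; exists (fun=> h) => j.
  by rewrite hP big_ord1 kmx0.
- have [|h hP] := @right1 r; last by exists h.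
  by rewrite -[RHS](r0 ord0); apply: eq_bigr => l _; rewrite kmx2.
- by exists (fun=> 0) => j; case: (krk_empty _ j).
Qed.

Lemma three_right_top r : eps r = 0 -> exists h : 'I_(krk 2) -> R,
    forall j, r = \sum_l kmx j l * h l.
Proof.
move=> /right0[h ->]; exists h => j.
by apply: eq_bigr => l _; rewrite kmx2.
Qed.

Lemma three_Ext_iso : Ext_iso (trivial_module eps) 3 (right_trivial_module eps).
Proof.
exact: (koszul_Ext_iso (iota := iota) (X := X) (nu := knu) (gr := gr)
  (gg_cent gg) erefl (knu_sym sym) kmx_comp3 (gg_0 gg) (gg_D gg) (gg_Z gg) (gg_X gg)
  (gg_dec gg) (gg_direct gg) (gg_conn gg) kgr_gen kgr_exact eps_iota eps_X
  three_right_top erefl erefl).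
Qed.

Lemma three_Ext_vanishes i : i != 3 -> Ext_vanishes (trivial_module eps) i.
Proof.
exact: (koszul_Ext_vanishes (iota := iota) (X := X) (nu := knu) (gr := gr)
  (gg_cent gg) erefl (knu_sym sym) kmx_comp3 (gg_0 gg) (gg_D gg) (gg_Z gg) (gg_X gg)
  (gg_dec gg) (gg_direct gg) (gg_conn gg) kgr_gen kgr_exact eps_iota eps_X
  three_right_exact0 three_right_exactS).
Qed.
End Right.

Lemma three_left_gldim : left_gldim R 3.
Proof.
split=> [|m m3 /(_ (trivial_module eps))[P P0]]; first exact: three_gldim_le.
apply: (koszul_pd_ge (iota := iota) (X := X) (nu := knu) (gr := gr)
  (gg_cent gg) erefl (knu_sym sym) kmx_comp3 (gg_0 gg) (gg_D gg) (gg_Z gg) (gg_X gg)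
  (gg_dec gg) (gg_direct gg) (gg_conn gg) kgr_gen kgr_exact eps_iota eps_X (n := 2)
  erefl erefl erefl).
by exists P => i i2; apply: P0; apply: leq_trans i2; rewrite ltnS in m3 *.
Qed.
End Data.
End KoszulThree.

Lemma sum_ord3 (A : nmodType) (F : 'I_3 -> A) : \sum_i F i = F vx + F vy + F vz.
Proof.
rewrite !big_ord_recl big_ord0 addr0 addrA.
by congr (F _ + F _ + F _); apply/val_inj.
Qed.

Lemma ord3P (i : 'I_3) : [\/ i = vx, i = vy | i = vz].
Proof.
by case: i => [[|[|[|]]]] // h; [constructor 1|constructor 2|constructor 3]; apply/val_inj.
Qed.

Lemma central_words (k : fieldType) (A : algType k) (I : Type) (X : I -> A) (c : A)
    (s : seq (k * seq I)) : (forall j, c * X j = X j * c) ->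
  c * (\sum_(p <- s) p.1 *: \prod_(i <- p.2) X i) =
  (\sum_(p <- s) p.1 *: \prod_(i <- p.2) X i) * c.
Proof.
move=> cX; rewrite mulr_sumr mulr_suml; apply: eq_bigr => [[d m]] _ /=.
rewrite -scalerAr -scalerAl; congr (_ *: _).
elim: m => [|j m IHm]; first by rewrite big_nil mulr1 mul1r.
by rewrite big_cons mulrA cX -mulrA IHm mulrA.
Qed.

(** * The algebra of a Hesse form *)

Section HesseAlgebra.
Variables (k : fieldType) (al be ga : k) (w : tensor3 k).

(* the symmetric tensor [6 xyz + al x^3 + be y^3 + ga z^3] *)
Definition hesse_coef (i j l : 'I_3) : k :=
  if [&& i != j, j != l & i != l] then 1
  else if (i == j) && (j == l) then nth 0 [:: al; be; ga] i else 0.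

Hypothesis abc : al * be * ga != 1.
Hypothesis wE : forall i j l, w [tuple i; j; l] = hesse_coef i j l.
Local Notation S := (D_alg w).
Local Notation x := (dx w vx).
Local Notation y := (dx w vy).
Local Notation z := (dx w vz).

Lemma hesse_symmetric : symmetric_coefs w.
Proof.
split=> i j l; rewrite !wE;
by case: (ord3P i) => ->; case: (ord3P j) => ->; case: (ord3P l) => ->.
Qed.

Lemma hesse_rel_sums (A : lmodType k) (F : 'I_3 -> 'I_3 -> A) :
  [/\ \sum_j \sum_l hesse_coef vx j l *: F j l = F vy vz + F vz vy + al *: F vx vx,
     \sum_j \sum_l hesse_coef vy j l *: F j l = F vz vx + F vx vz + be *: F vy vy
   & \sum_j \sum_l hesse_coef vz j l *: F j l = F vx vy + F vy vx + ga *: F vz vz].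
Proof.
rewrite !sum_ord3 /hesse_coef /= !scale0r !scale1r !add0r !addr0; split=> //.
  by rewrite -addrA addrC.
by rewrite addrAC [F vx vz + _]addrC.
Qed.

Lemma hesse_D_rel i : \sum_j \sum_l hesse_coef i j l *: (dx w j * dx w l) = 0.
Proof.
by rewrite -[RHS](D_rel w i); apply: eq_bigr => j _; apply: eq_bigr => l _; rewrite wE.
Qed.

Lemma hesse_Rx : y * z + z * y + al *: (x * x) = 0.
Proof.
have [h _ _] := hesse_rel_sums (fun j l => dx w j * dx w l).
exact: (etrans (esym h) (hesse_D_rel vx)).
Qed.

Lemma hesse_Ry : z * x + x * z + be *: (y * y) = 0.
Proof.
have [_ h _] := hesse_rel_sums (fun j l => dx w j * dx w l).
exact: (etrans (esym h) (hesse_D_rel vy)).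
Qed.

Lemma hesse_Rz : x * y + y * x + ga *: (z * z) = 0.
Proof.
have [_ _ h] := hesse_rel_sums (fun j l => dx w j * dx w l).
exact: (etrans (esym h) (hesse_D_rel vz)).
Qed.

Lemma hesse_span n a : D_gr n a -> span_xyz x y z n a.
Proof.
move=> /D_grP[s sn ->]; elim: s sn => [|[c m] s IHs] sn; first by rewrite big_nil; apply: span_xyz0.
rewrite big_cons; apply: span_xyzD; last first.
  by apply: IHs => p ps; apply: sn; rewrite inE ps orbT.
have := sn (c, m); rewrite inE eqxx => /(_ isT) /= <-; apply: span_xyzZ.
elim: m {sn} => [|i m IHm] /=.
  rewrite /dword big_nil; exists [:: (1, (0%N, 0%N, 0%N))]; split; first by move=> t; rewrite inE => /eqP ->.
  by rewrite big_seq1 /xyz !expr0 !mulr1 scale1r.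
rewrite /dword big_cons -/(dword w m).
have [h1 h2 h3] := span_xyz_mul hesse_Rx hesse_Ry hesse_Rz abc IHm.
by case: (ord3P i) => ->.
Qed.

(** The coefficient functionals of the Clifford model, pulled back along the map from D(w) that its
    relations provide. *)
Lemma hesse_functional : exists phi : nat -> nat -> nat -> S -> k,
  [/\ forall p q r u v, phi p q r (u + v) = phi p q r u + phi p q r v,
      forall p q r c u, phi p q r (c *: u) = c * phi p q r u
    & forall p q r p' q' r',
      phi p q r (xyz x y z p' q' r') = [&& p == p', q == q' & r == r']%:R].
Proof.
have [Q [iota [X [Y [Z [phi [iC [r1 r2 r3] pD pZ pM]]]]]]] := clifford_model al be ga.
pose a (i : 'I_3) := nth 0 [:: X; Y; Z] i.
have [|psi [psix psiZ]] := D_lift (w := w) (a := a) iC.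
  move=> i; rewrite !sum_ord3 !wE.
  case: (ord3P i) => ->; rewrite /hesse_coef /= !rmorph0 !rmorph1 !mul0r !mul1r !add0r !addr0.
  - by rewrite /a /= -addrA addrC r1.
  - by rewrite /a /= addrAC [X * Z + _]addrC r2.
  - by rewrite /a /= r3.
exists (fun p q r u => phi p q r (psi u)); split.
- by move=> p q r u v; rewrite rmorphD pD.
- by move=> p q r c u; rewrite psiZ pZ.
- by move=> p q r p' q' r'; rewrite /xyz !rmorphM !rmorphXn /= !psix pM.
Qed.

Lemma hesse_gr_xyz p q r : D_gr (p + q + r) (xyz x y z p q r).
Proof.
have h i n : D_gr n (dx w i ^+ n).
  elim: n => [|n IHn]; first exact: D_gr1.
  by rewrite exprS; apply: (D_grM (m := 1)) => //; apply: D_gr_dx.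
by apply: D_grM => //; apply: D_grM.
Qed.

Lemma hesse_has_dim n : has_dim (@D_gr k w n) 'C(n.+2, 2).
Proof.
have [phi [pD pZ pM]] := hesse_functional.
exact: (xyz_has_dim pD pZ pM (@D_gr0 _ w) (@D_grD _ w) (@D_grZ _ w) hesse_gr_xyz hesse_span).
Qed.

Lemma hesse_sqrC i a : dx w i * dx w i * a = a * (dx w i * dx w i).
Proof.
have [xy xz] := xxC hesse_Rx hesse_Ry hesse_Rz abc.
have [yx yz] := yyC hesse_Rx hesse_Ry hesse_Rz abc.
have [zx zy] := zzC hesse_Rx hesse_Ry hesse_Rz abc.
have ij j : dx w i * dx w i * dx w j = dx w j * (dx w i * dx w i).
  case: (ord3P i) => ->; case: (ord3P j) => ->;
    [exact/esym/mulrA | exact: xy | exact: xz | exact: yx | exact/esym/mulrA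
    | exact: yz | exact: zx | exact: zy | exact/esym/mulrA].
by have [s ->] := D_words a; exact: central_words.
Qed.

Lemma hesse_inj n s : D_gr n s -> s * x = 0 -> s = 0.
Proof.
have [phi [pD pZ pM]] := hesse_functional.
by apply: (xyz_mulx_inj pD pZ pM hesse_span) => p q r; apply: hesse_sqrC.
Qed.
End HesseAlgebra.

(** * Passage to the converse ring by reversing words *)

Section Reversal.
Variables (k : fieldType) (w : tensor3 k) (R : nzRingType) (iota : {rmorphism k -> R}).
Variables (iotac : {rmorphism k -> R^c}) (X : 'I_3 -> R) (gr : nat -> R -> Prop) (tau : R -> R).
Hypothesis iotacE : forall c, iotac c = iota c.
Hypothesis tauD : forall a b, tau (a + b) = tau a + tau b.
Hypothesis tauM : forall a b, tau (a * b) = tau b * tau a.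
Hypothesis tauK : forall a, tau (tau a) = a.
Hypothesis tauX : forall i, tau (X i) = X i.
Hypothesis tau_iota : forall c, tau (iota c) = iota c.
Hypothesis tau_gr : forall n a, gr n a -> gr n (tau a).
Hypothesis sym : symmetric_coefs w.
Hypothesis gg : graded_generated w iota X gr.

Let Xc : 'I_3 -> R^c := X.
Let grc : nat -> R^c -> Prop := gr.

Lemma tau0 : tau 0 = 0.
Proof. by apply: (addrI (tau 0)); rewrite -tauD !addr0. Qed.

Lemma tau_sum (F : 'I_3 -> R) : tau (\sum_j F j) = \sum_j tau (F j).
Proof. by apply: (big_morph tau); [exact: tauD | exact: tau0]. Qed.

Lemma tau_eq0 a : tau a = 0 -> a = 0.
Proof. by move=> a0; rewrite -[a]tauK a0 tau0. Qed.

Lemma polar_mx_conv j l : polar_mx w iotac Xc j l = polar_mx w iota X j l.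
Proof.
apply: eq_bigr => t _; rewrite iotacE -[LHS]/(X t * iota _).
by rewrite -(gg_cent gg).
Qed.

Lemma tau_polar j l : tau (polar_mx w iota X j l) = polar_mx w iota X j l.
Proof.
rewrite tau_sum; apply: eq_bigr => t _.
by rewrite tauM tauX tau_iota (gg_cent gg).
Qed.

(* sums of products in [R^c], read in [R] and reversed *)
Lemma tau_conv_sum (u v : 'I_3 -> R) : (forall j, tau (v j) = v j) ->
  tau (\sum_j ((u j : R^c) * (v j : R^c) : R^c) : R) = \sum_j tau (u j) * v j.
Proof.
by move=> tv; rewrite tau_sum; apply: eq_bigr => j _; rewrite [LHS]tauM tv.
Qed.

Lemma graded_generated_conv : graded_generated w iotac Xc grc.
Proof.
case: (gg) => cent g0 gD gZ gX gdec gdir gconn ggen grel; split=> //.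
- by move=> c r; rewrite iotacE; exact/esym/cent.
- move=> n c a ga; rewrite iotacE -[_ * _]/((a : R) * iota c).
  by rewrite -cent; apply: gZ.
- move=> n a t ga; rewrite /grc -[_ * _]/(X t * (a : R)) -[X t * _]tauK tauM tauX.
  by apply/tau_gr/gX/tau_gr.
- by move=> a /gconn[c ->]; exists c; rewrite iotacE.
- move=> n a /tau_gr/ggen[u gu tau_a]; exists (fun j => tau (u j)) => [j|].
    exact/tau_gr/gu.
  rewrite -[LHS]tauK tau_a tau_sum; apply: eq_bigr => j _.
  by rewrite tauM tauX.
- move=> j; rewrite -[RHS](X_polar sym gg j); apply: eq_bigr => l _.
  by rewrite polar_mx_conv [polar_mx _ _ _ j l]polar_mx_sym.
Qed.

Lemma pregr_tau n a : pregr gr n a -> pregr gr n (tau a).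
Proof. by case: n => [->|n]; [rewrite /= tau0 | apply: tau_gr]. Qed.

Lemma graded_exact_conv : graded_exact w iota X gr -> graded_exact w iotac Xc grc.
Proof.
case=> e1 e2 e3; split.
- move=> n u gu u0; have [j||v gv vP] := e1 n (fun j => tau (u j)).
  + exact/tau_gr/gu.
  + by rewrite -tau_conv_sum // u0 tau0.
  exists (fun j => tau (v j)) => [j|l]; first exact/pregr_tau/gv.
  rewrite -[LHS]tauK vP tau_sum; apply: eq_bigr => j _.
  by rewrite tauM tau_polar polar_mx_conv.
- move=> n u gu u0; have [j|l|s gs sP] := e2 n (fun j => tau (u j)).
  + exact/tau_gr/gu.
  + transitivity (\sum_j tau (u j) * (polar_mx w iotac Xc j l : R)).
      by apply: eq_bigr => j _; rewrite polar_mx_conv.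
    rewrite -tau_conv_sum => [|j]; first by rewrite u0 tau0.
    by rewrite polar_mx_conv tau_polar.
  exists (tau s) => [|l]; first exact: pregr_tau.
  by rewrite -[LHS]tauK sP tauM tauX.
- move=> n s gs s0; apply: tau_eq0; apply: (e3 n); first exact: tau_gr.
  by move=> j; rewrite -(tauX j) -tauM -[RHS]tau0; congr tau; exact: s0.
Qed.

(** The form needed for Ext, whose cocycles are not homogeneous. *)
Lemma ungraded_exact_conv : ungraded_exact w iota X -> ungraded_exact w iotac Xc.
Proof.
case=> e1 e2 e3; split.
- move=> u u0; have [|v vP] := e1 (fun j => tau (u j)).
    by rewrite -tau_conv_sum // u0 tau0.
  exists (fun j => tau (v j)) => l.
  rewrite -[LHS]tauK vP tau_sum; apply: eq_bigr => j _.
  by rewrite tauM tau_polar polar_mx_conv.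
- move=> u u0; have [l|s sP] := e2 (fun j => tau (u j)).
    transitivity (\sum_j tau (u j) * (polar_mx w iotac Xc j l : R)).
      by apply: eq_bigr => j _; rewrite polar_mx_conv.
    rewrite -tau_conv_sum => [|j]; first by rewrite u0 tau0.
    by rewrite polar_mx_conv tau_polar.
  by exists (tau s) => l; rewrite -[LHS]tauK sP tauM tauX.
- move=> s s0; apply: tau_eq0; apply: e3.
  by move=> j; rewrite -(tauX j) -tauM -[RHS]tau0; congr tau; exact: s0.
Qed.
End Reversal.

Section ConverseInAlg.
Variables (k : fieldType) (A : algType k).

(** The same function as [in_alg], with the converse ring as declared target so that its morphism
    structure refers to the reversed product. *)
Definition in_alg_conv (c : k) : A^c := c%:A.

Fact in_alg_conv_is_zmod_morphism : zmod_morphism in_alg_conv.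
Proof. by move=> a b; rewrite /in_alg_conv scalerBl. Qed.

Fact in_alg_conv_is_monoid_morphism : monoid_morphism in_alg_conv.
Proof.
split=> [|a b]; first exact: scale1r.
by rewrite -[RHS]/(b%:A * a%:A : A) mulr_algr scalerA.
Qed.

HB.instance Definition _ := GRing.isZmodMorphism.Build k A^c in_alg_conv
  in_alg_conv_is_zmod_morphism.
HB.instance Definition _ := GRing.isMonoidMorphism.Build k A^c in_alg_conv
  in_alg_conv_is_monoid_morphism.

Lemma in_algC (c : k) (r : A) : in_alg A c * r = r * in_alg A c.
Proof. by rewrite /= mulr_algl mulr_algr. Qed.

Lemma in_alg_convC c (r : A^c) : in_alg_conv c * r = r * in_alg_conv c.
Proof. exact/esym/in_algC. Qed.

Lemma alg_noetherian (ts s : seq A) : (forall t r, t \in ts -> r * t = t * r) ->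
  (forall N : A -> Prop, N 0 -> (forall a b, N a -> N b -> N (a + b)) ->
     (forall c a, N a -> N (c *: a)) -> (forall t a, t \in ts -> N a -> N (t * a)) ->
     (forall x, x \in s -> N x) -> forall r, N r) ->
  noetherian A.
Proof.
move=> tsC gen; split.
  apply: (finite_over_central_noetherian (iota := in_alg A : {rmorphism k -> A}) (s := s) tsC).
  move=> N N0 ND NZ NT NG; apply: gen => // c a Na.
  by rewrite -mulr_algl; apply: NZ.
apply: (@finite_over_central_noetherian A^c k in_alg_conv ts s) => [t r tts|].
  exact: (esym (tsC t r tts)).
move=> N N0 ND NZ NT NG; apply: gen => // [c a Na|t a tT Na].
  by rewrite -mulr_algr; apply: NZ.
by rewrite -tsC //; apply: NT.
Qed.

Lemma word_decomposition (I : finType) (X : I -> A) (s : seq (k * seq I)) :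
  exists c (u : I -> A),
  \sum_(p <- s) p.1 *: \prod_(i <- p.2) X i = c%:A + \sum_j X j * u j.
Proof.
elim: s => [|[d [|i m]] s [c [u IH]]].
- exists 0, (fun=> 0); rewrite big_nil scale0r add0r big1 // => j _.
  by rewrite mulr0.
- exists (d + c), u; rewrite big_cons IH /= big_nil addrA -scalerDl //.
- exists c, (fun j => (if j == i then d *: \prod_(i <- m) X i else 0) + u j).
  rewrite big_cons IH /=; under [in RHS]eq_bigr => j _ do rewrite mulrDr.
  rewrite big_split /= addrCA; congr (_ + (_ + _)).
  rewrite [RHS](bigD1 i) //= eqxx [X in _ = _ + X]big1 ?addr0 => [|j /negbTE ->].
    by rewrite big_cons scalerAr.
  by rewrite mulr0.
Qed.

End ConverseInAlg.

Section ReversalOfD.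
Variables (k : fieldType) (w : tensor3 k).
Hypothesis sym : symmetric_coefs w.
Local Notation S := (D_alg w).

(** For symmetric [w] each relator is unchanged when its words are reversed, so the generators
    satisfy the same relations in the converse ring. *)
Lemma D_reversal : exists tau : S -> S,
  [/\ forall a b, tau (a + b) = tau a + tau b, forall a b, tau (a * b) = tau b * tau a,
     forall a, tau (tau a) = a, forall i, tau (dx w i) = dx w i &
     (forall c, tau (in_alg S c) = in_alg S c) /\ forall n a, D_gr n a -> D_gr n (tau a)].
Proof.
have [i|psi [psix psiZ]] := D_lift (w := w) (A := S^c) (iota := @in_alg_conv k S) (a := dx w)
  (@in_alg_convC k S).
  rewrite -[RHS](D_rel w i) exchange_big; apply: eq_bigr => j _; apply: eq_bigr => l _.
  by case: sym => _ ->; exact: mulr_algr.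
pose tau (a : S) : S := psi a.
have tauD a b : tau (a + b) = tau a + tau b by exact: (rmorphD psi).
have tauM a b : tau (a * b) = tau b * tau a by exact: (rmorphM psi).
have tau1 : tau 1 = 1 by exact: (rmorph1 psi).
have tauX i : tau (dx w i) = dx w i by exact: psix.
have tauZ c a : tau (c *: a) = c *: tau a.
  by rewrite [LHS]psiZ; exact: mulr_algr.
have tau_word m : tau (dword w m) = dword w (rev m).
  rewrite /dword; elim: m => [|i m IHm]; first by rewrite !big_nil.
  by rewrite big_cons tauM IHm tauX rev_cons -cats1 big_cat big_seq1.
have tau_comb (s : seq (k * seq 'I_3)) :
    tau (\sum_(p <- s) p.1 *: dword w p.2) = \sum_(p <- s) p.1 *: dword w (rev p.2).
  rewrite (big_morph tau tauD (rmorph0 psi : tau 0 = 0)).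
  by apply: eq_bigr => p _; rewrite tauZ tau_word.
exists tau; split=> //.
- move=> a; have [s ->] := D_words a; rewrite tau_comb.
  transitivity (tau (\sum_(p <- [seq (p.1, rev p.2) | p <- s]) p.1 *: dword w p.2)).
    by apply: (congr1 tau); rewrite big_map.
  by rewrite tau_comb big_map; apply: eq_bigr => p _; rewrite revK.
- split=> [c|n a /D_grP[s sn ->]]; first by rewrite [LHS]tauZ tau1.
  rewrite tau_comb big_seq; apply: D_gr_sum => p /sn <-.
  by rewrite -size_rev; apply/D_grZ/D_gr_dword.
Qed.

Lemma D_graded_generated : graded_generated w (in_alg S : {rmorphism k -> S}) (dx w) (@D_gr k w).
Proof.
have polar j l : polar_mx w (in_alg S : {rmorphism k -> S}) (dx w) j l =
    \sum_t w [tuple j; t; l] *: dx w t.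
  by apply: eq_bigr => t _; exact: mulr_algl.
split.
- exact: in_algC.
- exact: D_gr0.
- exact: D_grD.
- by move=> n c a ga; rewrite [in_alg S c * a]mulr_algl; apply: D_grZ.
- by move=> n a t ga; rewrite -addn1; apply: D_grM => //; apply: D_gr_dx.
- exact: D_gr_dec.
- exact: D_gr_direct.
- by move=> a /D_gr0P[c ->]; exists c.
- exact: D_gr_gen.
- move=> j; rewrite -[RHS](D_rel w j) exchange_big; apply: eq_bigr => l _.
  rewrite polar mulr_suml; apply: eq_bigr => t _; exact/esym/scalerAl.
Qed.

Lemma D_right_augmentation_kernel (eps : {rmorphism S -> k}) :
  (forall c : k, eps c%:A = c) -> (forall i, eps (dx w i) = 0) ->
  forall r, eps r = 0 -> exists h, r = \sum_l dx w l * h l.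
Proof.
move=> e1 ex r; have [s ->] := D_words r.
have [c [u ->]] := word_decomposition (dx w) s.
rewrite rmorphD e1 rmorph_sum big1 => [|j _]; last by rewrite rmorphM ex mul0r.
by rewrite addr0 => ->; exists u; rewrite scale0r add0r.
Qed.
End ReversalOfD.

(** * Homogeneous components *)

Section Component.
Variables (k : fieldType) (w : tensor3 k) (R : nzRingType) (iota : {rmorphism k -> R}).
Variables (X : 'I_3 -> R) (gr : nat -> R -> Prop).
Hypothesis gg : graded_generated w iota X gr.

Lemma gg_sum n (I : finType) (F : I -> R) : (forall i, gr n (F i)) -> gr n (\sum_i F i).
Proof. by move=> h; elim/big_ind: _ => //; [exact: gg_0 gg _ | exact: gg_D gg _]. Qed.

Lemma gg_B n a b : gr n a -> gr n b -> gr n (a - b).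
Proof.
move=> ga gb; apply: (gg_D gg) => //; rewrite -mulN1r -(rmorph1 iota) -rmorphN.
exact: (gg_Z gg).
Qed.

Lemma gg_polar n a j l : gr n a -> gr n.+1 (a * polar_mx w iota X j l).
Proof.
move=> ga; rewrite mulr_sumr; apply: gg_sum => t.
by rewrite mulrA -(gg_cent gg) -mulrA; apply/(gg_Z gg)/(gg_X gg).
Qed.

Lemma gr_component (g : nat -> R) N n a : gr n a -> (forall i, gr i.+1 (g i)) ->
  (n <= N)%N -> a = \sum_(i < N) g i -> a = if n is m.+1 then g m else 0.
Proof.
move=> ga gg' nN ag.
pose h i := (if i is i'.+1 then g i' else 0) - (if i == n then a else 0).
have grh i : gr i (h i).
  apply: gg_B; first by case: i => [|i]; [exact: gg_0 gg _ | exact: gg'].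
  by case: eqP => [->//|_]; exact: gg_0 gg _.
have := gg_direct gg (N := N.+1) grh; rewrite sumrB big_ord_recl /= add0r -ag.
rewrite -big_mkcond /= (big_pred1 (Ordinal (nN : (n < N.+1)%N))) //.
rewrite subrr => /(_ erefl n nN); rewrite /h eqxx => /subr0_eq <-.
by case: n {ga nN h grh}.
Qed.

(** The polar matrix is homogeneous of degree 1, so of an arbitrary solution [v] only the components
    of degree [n - 1] contribute to [u]. *)
Lemma graded_exact1 : (forall u, \sum_j u j * X j = 0 ->
    exists v, forall l, u l = \sum_j v j * polar_mx w iota X j l) ->
  forall n (u : 'I_3 -> R), (forall j, gr n (u j)) -> \sum_j u j * X j = 0 ->
    exists2 v, (forall j, pregr gr n (v j)) & forall l, u l = \sum_j v j * polar_mx w iota X j l.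
Proof.
move=> ex n u gu /ex[v uv].
have [N [nN vN]] : exists N, (n <= N)%N /\ forall j, fil gr N (v j).
  have /choice[N NP] j : exists n, fil gr n (v j).
    by have [N [f [grf ->]]] := gg_dec gg (v j); exists N, f.
  exists (maxn n (\max_j N j)); split=> [|j]; first exact: leq_maxl.
  apply: (fil_leq (gg_0 gg)) (NP j).
  by apply: leq_trans (leq_maxr _ _); apply: (leq_bigmax j).
have /choice[f fP] j : exists f : nat -> R, (forall i, gr i (f i)) /\ v j = \sum_(i < N) f i.
  by have [f ? ?] := vN j; exists f.
exists (fun j => if n is m.+1 then f j m else 0) => [j|l].
  by rewrite /pregr; case: (n) => // m; case: (fP j).
have grg i : gr i.+1 (\sum_j f j i * polar_mx w iota X j l).
  by apply: gg_sum => j; apply: gg_polar; case: (fP j).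
rewrite (gr_component (gu l) grg nN).
  by case: (n) => [|m] //; rewrite big1 // => j _; rewrite mul0r.
rewrite uv exchange_big; apply: eq_bigr => j _; rewrite -mulr_suml.
by case: (fP j) => _ ->.
Qed.
End Component.

Lemma xyz_halves (k : fieldType) (A : algType k) (x y z : A) p q r :
  (forall a, y * y * a = a * (y * y)) -> (forall a, z * z * a = a * (z * z)) ->
  xyz x y z p q r = (x * x) ^+ p./2 * ((y * y) ^+ q./2 *
    ((z * z) ^+ r./2 * xyz x y z (odd p) (odd q) (odd r))).
Proof.
move=> yC zC; have half (a : A) n : a ^+ n = (a * a) ^+ n./2 * a ^+ odd n.
  by rewrite -expr2 -exprM mul2n -exprD addnC odd_double_half.
have yX n a : (y * y) ^+ n * a = a * (y * y) ^+ n by exact/esym/commrX/esym/yC.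
have zX n a : (z * z) ^+ n * a = a * (z * z) ^+ n by exact/esym/commrX/esym/zC.
rewrite /xyz (half x p) (half y q) (half z r) -!mulrA; congr (_ * _).
have yCA n a b : a * ((y * y) ^+ n * b) = (y * y) ^+ n * (a * b) by rewrite !mulrA yX.
have zCA n a b : a * ((z * z) ^+ n * b) = (z * z) ^+ n * (a * b) by rewrite !mulrA zX.
by rewrite yCA (zCA _ (y ^+ _)) zCA.
Qed.

Lemma mem_seq3 (T : eqType) (a b c : T) :
  [/\ a \in [:: a; b; c], b \in [:: a; b; c] & c \in [:: a; b; c]].
Proof. by rewrite !inE !eqxx !orbT. Qed.

Lemma all_seq3 (T : eqType) (P : T -> Prop) (a b c : T) :
  P a -> P b -> P c -> forall t, t \in [:: a; b; c] -> P t.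
Proof. by move=> Pa Pb Pc t; rewrite !inE => /or3P[] /eqP ->. Qed.

(** * Regularity of the potentials in Hesse form *)

Section HesseRegular.
Variables (k : fieldType) (al be ga : k) (w : tensor3 k).
Hypothesis abc : al * be * ga != 1.
Hypothesis wE : forall i j l, w [tuple i; j; l] = hesse_coef al be ga i j l.
Local Notation S := (D_alg w).
Local Notation x := (dx w vx).
Local Notation y := (dx w vy).
Local Notation z := (dx w vz).
Local Notation iS := (in_alg S : {rmorphism k -> S}).

Let sym := hesse_symmetric wE.
Let gg : graded_generated w iS (dx w) (@D_gr k w) := D_graded_generated w.

Lemma D_polarE j l : polar_mx w iS (dx w) j l = \sum_t w [tuple j; t; l] *: dx w t.
Proof. by apply: eq_bigr => t _; exact: mulr_algl. Qed.

Lemma D_exact1 (u : 'I_3 -> S) : \sum_j u j * dx w j = 0 ->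
  exists v, forall l, u l = \sum_j v j * polar_mx w iS (dx w) j l.
Proof.
move=> /D_rel_exact[v uv]; exists v => l.
by rewrite uv; apply: eq_bigr => j _; rewrite D_polarE.
Qed.

Lemma hesse_graded_exact : graded_exact w iS (dx w) (@D_gr k w).
Proof.
have e1 := graded_exact1 gg D_exact1.
have e3 n s : D_gr n s -> (forall j, s * dx w j = 0) -> s = 0.
  by move=> gs s0; apply: (hesse_inj abc wE gs); apply: s0.
split=> // n u gu u0.
have [|s gs sP] := @exact2 k S (@D_gr k w) (dx w) (polar_mx w iS (dx w))
  (hesse_has_dim abc wE) (gg_0 gg) (gg_D gg) (gg_X gg) (gg_polar gg) (gg_gen gg)
  (X_polar sym gg) (gg_rel gg) _ e3 n u gu u0; last by exists s.
by move=> m v gv v0; have [v' gv' vP] := e1 m.+1 v gv v0; exists v'.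
Qed.

(** The eight monomials with exponents 0 or 1, which generate D(w) over the central squares. *)
Definition hesse_gens : seq S :=
  [seq xyz x y z t.1.1 t.1.2 t.2 | t : bool * bool * bool].

Lemma hesse_finite_over_squares (N : S -> Prop) : N 0 ->
  (forall a b, N a -> N b -> N (a + b)) -> (forall c a, N a -> N (c *: a)) ->
  (forall t a, t \in [:: x * x; y * y; z * z] -> N a -> N (t * a)) ->
  (forall u, u \in hesse_gens -> N u) -> forall r, N r.
Proof.
move=> N0 ND NZ NT NG r.
have N_expr t n a : t \in [:: x * x; y * y; z * z] -> N a -> N (t ^+ n * a).
  move=> tT Na; elim: n => [|n IHn]; first by rewrite mul1r.
  by rewrite exprS -mulrA; apply: NT.
have Nxyz p q s : N (xyz x y z p q s).
  rewrite (xyz_halves _ _ _ _ (hesse_sqrC abc wE vy) (hesse_sqrC abc wE vz)).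
  have [t1 t2 t3] := mem_seq3 (x * x) (y * y) (z * z).
  apply: (N_expr _ _ _ t1); apply: (N_expr _ _ _ t2); apply: (N_expr _ _ _ t3).
  by apply: NG; apply/mapP; exists (odd p, odd q, odd s); rewrite ?mem_enum.
have [m [f [grf ->]]] := D_gr_dec r; elim/big_ind: _ => // i _.
have [s [_ ->]] := hesse_span abc wE (grf i).
by elim/big_ind: _ => // t _; apply: NZ.
Qed.

Lemma hesse_noetherian : noetherian S.
Proof.
apply: (alg_noetherian _ hesse_finite_over_squares) => t r; move: t; apply: all_seq3.
- exact/esym/(hesse_sqrC abc wE vx).
- exact/esym/(hesse_sqrC abc wE vy).
- exact/esym/(hesse_sqrC abc wE vz).
Qed.

Lemma hesse_regular : regular_potential w.
Proof.
have [tau [tD tM tK tX [ti tg]]] := D_reversal sym.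
have ggc := graded_generated_conv (iota := iS) (iotac := @in_alg_conv k S) (fun c => erefl) tD tM tK tX tg sym gg.
have ge := hesse_graded_exact.
have gec := graded_exact_conv (iota := iS) (iotac := @in_alg_conv k S) (fun c => erefl) tD tM tK tX ti tg gg ge.
have ue := three_ungraded_exact sym gg ge.
have uec := ungraded_exact_conv (iota := iS) (iotac := @in_alg_conv k S) (fun c => erefl) tD tM tK tX ti gg ue.
have polc := polar_mx_conv (iota := iS) (iotac := @in_alg_conv k S) (fun c => erefl) gg.
have [eps e1 ex] := D_augmentation w.
have e1' c : eps (iS c) = c by exact: e1.
split.
- exact: hesse_noetherian.
- exact: D_connected_graded.
- split; first exact: (three_left_gldim sym gg ge e1' ex).
  exact: (@three_left_gldim k w S^c _ _ _ (aug_conv eps : {rmorphism S^c -> k})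
    sym ggc gec e1' ex).
- exists eps; first exact: D_is_augmentation.
  have r0 := D_right_augmentation_kernel e1 ex.
  (* Exactness for rows over the converse ring, read in [S], is exactness for columns, as Ext
     requires; [polar_mx_sym] accounts for the transposed matrix. *)
  case: uec => u1 u2 u3; split.
    exact: (three_Ext_iso sym gg ge e1' ex r0).
  move=> i i3; apply: (three_Ext_vanishes sym gg ge e1' ex _ _ _ i3).
  + move=> r rX; have [v vP] := u1 r rX; exists v => l.
    rewrite vP; apply: eq_bigr => j _; rewrite polc.
    by rewrite -[LHS]/(_ * _) polar_mx_sym.
  + move=> r rM; have [l|s sP] := u2 r; last by exists s.
    rewrite -[RHS](rM l); apply: eq_bigr => j _; rewrite polc.
    by rewrite -[LHS]/(_ * _) polar_mx_sym.
  + by move=> r rX; apply: u3.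
- exists (fun n => 'C(n.+2, 2)); split; first exact: (hesse_has_dim abc wE).
  exact: hilbert_coef.
Qed.
End HesseRegular.

(** * Linear syzygies of a regular potential *)

(** The image of [d2] contains the kernel of [d1], of dimension at least dim U2 - dim U3, which
    leaves at most one dimension for the kernel of [d2]. *)
Lemma kernel_line (k : fieldType) (U1 U2 U3 : vectType k) (d2 : 'Hom(U1, U2))
    (d1 : 'Hom(U2, U3)) (a b : U1) :
  (forall u, d1 u = 0 -> exists v, d2 v = u) ->
  (dim U1 + dim U3 <= (dim U2).+1)%N ->
  d2 a = 0 -> d2 b = 0 -> b != 0 -> exists c, a = c *: b.
Proof.
move=> ex dimE a0 b0 bN0.
have le1 : (\dim (lker d1) <= \dim (d2 @: fullv))%N.
  apply: dimvS; apply/subvP => u; rewrite memv_ker => /eqP/ex[v <-].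
  by apply: memv_img; apply: memvf.
have le2 : (\dim (d1 @: fullv) <= dim U3)%N by rewrite -dimvf; apply/dimvS/subvf.
have := limg_ker_dim d1 fullv; have := limg_ker_dim d2 fullv.
rewrite !capfv !dimvf => e2 e1.
have : lker d2 = <[b]>%VS.
  apply/esym/eqP; rewrite eqEdim -memvE memv_ker b0 eqxx dim_vline bN0 /=; lia.
move/vspaceP/(_ a); rewrite memv_ker a0 eqxx => /esym/vlineP[c ->].
by exists c.
Qed.

Section SyzygyLine.
Variables (k : fieldType) (A : algType k) (gr : nat -> A -> Prop).
Variables (X : 'I_3 -> A) (M : 'I_3 -> 'I_3 -> A).
Hypothesis gr_dim : forall n, has_dim (gr n) 'C(n.+2, 2).
Hypothesis gr0 : forall n, gr n 0.
Hypothesis grD : forall n a b, gr n a -> gr n b -> gr n (a + b).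
Hypothesis grZ : forall n c a, gr n a -> gr n (c *: a).
Hypothesis grX1 : forall i, gr 1 (X i).
Hypothesis grX : forall n a j, gr n a -> gr n.+1 (a * X j).
Hypothesis grM : forall n a j l, gr n a -> gr n.+1 (a * M j l).
Hypothesis gr1P : forall a, gr 1 a -> exists c : 'I_3 -> k, a = \sum_i c i *: X i.
Hypothesis gr_gen : forall n a, gr n.+1 a ->
  exists2 u : 'I_3 -> A, (forall j, gr n (u j)) & a = \sum_j u j * X j.
Hypothesis XM : forall l, \sum_j X j * M j l = 0.
Hypothesis exact1 : forall n (u : 'I_3 -> A), (forall j, gr n.+1 (u j)) ->
  \sum_j u j * X j = 0 -> exists2 v : 'I_3 -> A, (forall j, gr n (v j)) &
  forall l, u l = \sum_j v j * M j l.

(** A matrix encodes a syzygy with linear coefficients. The nine-dimensional space of matrices maps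
    to three copies of degree 2, of dimension 18, and from there to degree 3, of dimension 10; so
    the rank is at least 8, and the identity matrix spans the kernel. *)
Lemma syzygy_line (a : 'M[k]_3) :
  (forall l, \sum_j (\sum_i a i j *: X i) * M j l = 0) -> exists c, a = c%:M.
Proof.
move=> a0.
have gr_sum n (F : 'I_3 -> A) : (forall j, gr n (F j)) -> gr n (\sum_j F j).
  by move=> h; elim/big_ind: _ => //; apply: grD.
have [p2 [q2 [p2U p2K q2K]]] := has_dim_iso (gr_dim 2).
have [p3 [q3 [p3U p3K q3K]]] := has_dim_iso (gr_dim 3).
pose V := {ffun 'I_3 -> 'rV[k]_6}.
pose lin (a : 'M[k]_3) j : A := \sum_i a i j *: X i.
have grlin b j : gr 1 (lin b j) by apply: gr_sum => i; apply: grZ.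
have linE c b b' j : lin (c *: b + b') j = c *: lin b j + lin b' j.
  rewrite /lin scaler_sumr -big_split; apply: eq_bigr => i _.
  by rewrite !mxE scalerDl scalerA.
have K2 b l : p2 (q2 (\sum_j lin b j * M j l)) = \sum_j lin b j * M j l.
  by apply/p2K/gr_sum => j; apply: grM.
have K1 (f : 'I_3 -> 'rV_6) : p3 (q3 (\sum_j p2 (f j) * X j)) = \sum_j p2 (f j) * X j.
  by apply/p3K/gr_sum => j; apply: grX; apply: p2U.
have lin2 : linear (fun b => [ffun l => q2 (\sum_j lin b j * M j l)] : V).
  move=> c b b'; apply/ffunP => l; rewrite !ffunE; apply: (can_inj q2K).
  rewrite [RHS]linearP /= !K2 scaler_sumr -big_split; apply: eq_bigr => j _.
  by rewrite linE mulrDl -scalerAl.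
have lin1 : linear (fun f : V => q3 (\sum_j p2 (f j) * X j)).
  move=> c f f'; apply: (can_inj q3K).
  rewrite [RHS]linearP /= !K1 scaler_sumr -big_split; apply: eq_bigr => j _.
  by rewrite !ffunE linearP mulrDl -scalerAl.
have [d2 d2E] := linear_hom lin2; have [d1 d1E] := linear_hom lin1.
have d2K b : (forall l, \sum_j lin b j * M j l = 0) -> d2 b = 0.
  move=> b0; rewrite d2E; apply/ffunP => l; rewrite !ffunE b0.
  by apply: (can_inj q2K); rewrite linear0 p2K.
have [|||||c ->] := @kernel_line k _ _ _ d2 d1 a 1%:M.
- move=> u u0; have [||v gv vP] := exact1 (n := 1) (u := fun j => p2 (u j)).
  + by move=> j; apply: p2U.
  + by rewrite -K1 -d1E u0 linear0.
  have /choice[b bP] j := gr1P (gv j).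
  refine (ex_intro _ (\matrix_(i, j) b j i) _); apply/ffunP => l; rewrite d2E ffunE.
  apply: (can_inj q2K); rewrite K2 vP; apply: eq_bigr => j _; congr (_ * _).
  by rewrite bP; apply: eq_bigr => i _; rewrite mxE.
- have dimV m : dim {ffun 'I_3 -> 'rV[k]_m} = (3 * m)%N.
    by rewrite [LHS]/dim /= card_ord; congr (3 * _)%N; exact: mul1n.
  by rewrite dimV !dim_matrix.
- exact: d2K.
- apply: d2K => l; rewrite -[RHS](XM l); apply: eq_bigr => j _; congr (_ * _).
  rewrite /lin (bigD1 j) //= mxE eqxx scale1r big1 ?addr0 // => i /negbTE ij.
  by rewrite mxE ij scale0r.
- exact: oner_neq0.
by exists c; apply: scalemx1.
Qed.
End SyzygyLine.

Section Regular.
Variables (k : fieldType) (w : tensor3 k).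
Hypothesis reg : regular_potential w.

Lemma regular_has_dim n : has_dim (@D_gr k w n) 'C(n.+2, 2).
Proof.
have [_ _ _ _ [h [hdim hE]]] := reg.
suff <- : h n = 'C(n.+2, 2) by [].
elim/ltn_ind: n => n IHn; have := hE n; rewrite -(hilbert_coef n) !big_ord_recl.
have -> : ((1 - 'X : {poly int}) ^+ 3)`_(@ord0 n) = 1.
  by rewrite -horner_coef0 !hornerE expr1n.
rewrite !mul1r !subn0.
rewrite [X in _ + X = _](eq_bigr (fun i : 'I_n =>
  ((1 - 'X : {poly int}) ^+ 3)`_(lift ord0 i) * ('C((n - lift ord0 i).+2, 2))%:R)).
  by move=> /addIr; rewrite !natz => -[].
move=> i _; rewrite IHn //; rewrite /= /bump /=; have := ltn_ord i; lia.
Qed.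

Local Notation S := (D_alg w).
Local Notation iS := (in_alg S : {rmorphism k -> S}).
Local Notation M := (polar_mx w iS (dx w)).

Lemma regular_syzygy (a : 'M[k]_3) : symmetric_coefs w ->
  (forall l, \sum_j (\sum_i a i j *: dx w i) * M j l = 0) -> exists c, a = c%:M.
Proof.
move=> sym.
have gg : graded_generated w iS (dx w) (@D_gr k w) := D_graded_generated w.
have e1 := graded_exact1 gg (@D_exact1 k w).
apply: (syzygy_line regular_has_dim (gg_0 gg) (gg_D gg) (@D_grZ k w)
  (@D_gr_dx k w) (gg_X gg) (gg_polar gg) _ (X_polar sym gg)).
  move=> b /D_gr_gen[c gc ->].
  have /choice[d dP] i : exists d, c i = d%:A := (D_gr0P _).1 (gc i).
  by exists d; apply: eq_bigr => i _; rewrite dP mulr_algl.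
by move=> n u gu u0; have [v gv vP] := e1 n.+1 u gu u0; exists v.
Qed.
End Regular.

(** * The trilinear form of a potential and its polar forms *)

Section PolarForm.
Variable k : fieldType.
Implicit Types (w : tensor3 k) (a b c u v e : 'rV[k]_3) (g : 'M[k]_3).

Definition polar w a : 'M[k]_3 := \matrix_(j, l) \sum_i a 0 i * w [tuple i; j; l].

Definition tri w a b c : k := (b *m polar w a *m c^T) 0 0.

Lemma polar_linear w x a b : polar w (x *: a + b) = x *: polar w a + polar w b.
Proof.
apply/matrixP => j l; rewrite !mxE mulr_sumr -big_split; apply: eq_bigr => i _.
by rewrite !mxE mulrDl mulrA.
Qed.

Lemma triE w a b c :
  tri w a b c = \sum_i \sum_j \sum_l a 0 i * b 0 j * c 0 l * w [tuple i; j; l].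
Proof.
rewrite /tri mxE; under eq_bigr => l _ do rewrite !mxE mulr_suml.
rewrite exchange_big /= [RHS]exchange_big; apply: eq_bigr => j _.
rewrite [RHS]exchange_big; apply: eq_bigr => l _ /=.
rewrite mxE mulr_sumr mulr_suml; apply: eq_bigr => i _; ring.
Qed.

Lemma triDl w a b c d : tri w (a + b) c d = tri w a c d + tri w b c d.
Proof. by rewrite /tri -{1}[a]scale1r polar_linear scale1r mulmxDr mulmxDl mxE. Qed.

Lemma triZl w x a b c : tri w (x *: a) b c = x * tri w a b c.
Proof.
rewrite /tri -[x *: a]addr0 polar_linear (_ : polar w 0 = 0).
  by rewrite addr0 -scalemxAr -scalemxAl mxE.
by apply/matrixP => i j; rewrite !mxE big1 // => l _; rewrite mxE mul0r.
Qed.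

Lemma tuple3E (T : Type) (t : 3.-tuple T) : t = [tuple tnth t 0; tnth t 1; tnth t 2].
Proof.
have d := tnth t 0; apply: eq_from_tnth => i.
by case: (ord3P i) => ->; rewrite !(tnth_nth d).
Qed.

Lemma tensor3_big (F : 3.-tuple 'I_3 -> k) :
  \sum_t F t = \sum_i \sum_j \sum_l F [tuple i; j; l].
Proof.
rewrite pair_bigA pair_bigA /=.
rewrite (reindex (fun p : 'I_3 * 'I_3 * 'I_3 => [tuple p.1.1; p.1.2; p.2])) //.
pose dec (t : 3.-tuple 'I_3) := (tnth t 0, tnth t 1, tnth t 2).
exists dec => [[[i j] l] _|t _] //.
exact/esym/tuple3E.
Qed.

Lemma gl_act_coef g w i j l :
  gl_act g w [tuple i; j; l] = tri w (row i g) (row j g) (row l g).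
Proof.
rewrite ffunE tensor3_big triE; apply: eq_bigr => i' _; apply: eq_bigr => j' _.
apply: eq_bigr => l' _; rewrite !mxE !big_ord_recl big_ord0 mulr1 -!mulrA.
by congr (g _ _ * (g _ _ * (g _ _ * _))).
Qed.

Lemma polar_gl_act g w a : polar (gl_act g w) a = g *m polar w (a *m g) *m g^T.
Proof.
apply/matrixP => j l; rewrite mxE.
transitivity (tri w (a *m g) (row j g) (row l g)).
  rewrite mulmx_sum_row; under eq_bigr => i _ do rewrite gl_act_coef.
  elim/big_rec2: _ => [|i x y _ ->]; last by rewrite triDl triZl.
  by rewrite -[0 in RHS](scale0r 0) triZl mul0r.
rewrite /tri -row_mul mxE [RHS]mxE; apply: eq_bigr => i _; congr (_ * _).
  by rewrite mxE.
by rewrite !mxE.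
Qed.

Lemma tri_gl_act g w a b c :
  tri (gl_act g w) a b c = tri w (a *m g) (b *m g) (c *m g).
Proof. by rewrite /tri polar_gl_act trmx_mul !mulmxA. Qed.

Lemma tensor3P w w' : (forall i j l, w [tuple i; j; l] = w' [tuple i; j; l]) -> w = w'.
Proof.
move=> ww; apply/ffunP => t.
by rewrite (tuple3E t).
Qed.

Lemma gl_actM g h w : gl_act g (gl_act h w) = gl_act (g *m h) w.
Proof.
by apply: tensor3P => i j l; rewrite !gl_act_coef tri_gl_act !row_mul.
Qed.

Lemma linear_change_trans w w' w'' :
  linear_change w w' -> linear_change w' w'' -> linear_change w w''.
Proof.
move=> [g gu <-] [h hu <-]; exists (h *m g); first by rewrite unitmx_mul hu.
by rewrite gl_actM.
Qed.

End PolarForm.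

Section SymmetricTensors.
Variables (k : fieldType) (w : tensor3 k).

Lemma symmetric_potentialP : symmetric_potential w <-> symmetric_coefs w.
Proof.
split=> [sw|[w1 w2] s].
  have tp (a b : 'I_3) i j l :
      w [tuple i; j; l] = w [tuple tnth [tuple i; j; l] (tperm a b t) | t < 3].
    by rewrite -[in LHS](sw (tperm a b)) ffunE.
  split=> i j l; [rewrite (tp vx vy)|rewrite (tp vy vz)]; congr (w _);
    apply/eq_from_tnth => t; rewrite tnth_mktuple;
    by case: (ord3P t) => ->; rewrite permE /= !(tnth_nth i).
apply/ffunP => t; rewrite (tuple3E t) ffunE.
set a := tnth t 0; set b := tnth t 1; set c := tnth t 2.
have -> : [tuple tnth [tuple a; b; c] (s i) | i < 3] = 
    [tuple tnth [tuple a; b; c] (s vx); tnth [tuple a; b; c] (s vy);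
           tnth [tuple a; b; c] (s vz)].
  by apply: eq_from_tnth => i; rewrite tnth_mktuple; case: (ord3P i) => ->; rewrite [RHS](tnth_nth a).
have xy : s vx != s vy by rewrite (inj_eq perm_inj).
have yz : s vy != s vz by rewrite (inj_eq perm_inj).
have xz : s vx != s vz by rewrite (inj_eq perm_inj).
case: (ord3P (s vx)) xy xz => ->; case: (ord3P (s vy)) yz => ->;
  case: (ord3P (s vz)) => -> //= _ _ _; rewrite !(tnth_nth a) /=.
- by rewrite w2 w1.
- by rewrite w1 w2.
- by rewrite w1 w2 w1.
Qed.

Lemma symmetric_superpotential : symmetric_coefs w -> superpotential w.
Proof.
move=> [w1 w2]; apply: tensor3P => i j l; rewrite ffunE !(tnth_nth i) /=.
by rewrite w1 w2.
Qed.

Hypothesis sym : symmetric_coefs w.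
Implicit Types a b c e : 'rV[k]_3.

Lemma triC a b c : tri w a b c = tri w b a c.
Proof.
case: sym => w1 w2; rewrite !triE exchange_big; apply: eq_bigr => i _.
by apply: eq_bigr => j _; apply: eq_bigr => l _; rewrite w1 [b 0 _ * _]mulrC.
Qed.

Lemma triCr a b c : tri w a b c = tri w a c b.
Proof.
case: sym => w1 w2; rewrite !triE; apply: eq_bigr => i _.
rewrite exchange_big; apply: eq_bigr => j _; apply: eq_bigr => l _.
by rewrite w2 [a 0 i * _ * _]mulrAC.
Qed.

Lemma symmetric_gl_act g : symmetric_coefs (gl_act g w).
Proof. by split=> i j l; rewrite !gl_act_coef; [rewrite triC | rewrite triCr]. Qed.

(** Expansion by the ten coefficients of a ternary cubic, which turns conditions on frames into
    identities for [ring] and [field]. *)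
Lemma tri_comb e0 e1 e2 p0 p1 p2 q0 q1 q2 r0 r1 r2 :
  tri w (p0 *: e0 + p1 *: e1 + p2 *: e2) (q0 *: e0 + q1 *: e1 + q2 *: e2)
    (r0 *: e0 + r1 *: e1 + r2 *: e2) =
  p0 * q0 * r0 * tri w e0 e0 e0 + p1 * q1 * r1 * tri w e1 e1 e1
  + p2 * q2 * r2 * tri w e2 e2 e2
  + (p0 * q0 * r1 + p0 * q1 * r0 + p1 * q0 * r0) * tri w e0 e0 e1
  + (p0 * q0 * r2 + p0 * q2 * r0 + p2 * q0 * r0) * tri w e0 e0 e2
  + (p1 * q1 * r0 + p1 * q0 * r1 + p0 * q1 * r1) * tri w e1 e1 e0
  + (p1 * q1 * r2 + p1 * q2 * r1 + p2 * q1 * r1) * tri w e1 e1 e2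
  + (p2 * q2 * r0 + p2 * q0 * r2 + p0 * q2 * r2) * tri w e2 e2 e0
  + (p2 * q2 * r1 + p2 * q1 * r2 + p1 * q2 * r2) * tri w e2 e2 e1
  + (p0 * q1 * r2 + p0 * q2 * r1 + p1 * q0 * r2 + p1 * q2 * r0
     + p2 * q0 * r1 + p2 * q1 * r0) * tri w e0 e1 e2.
Proof.
have triDm a b c d : tri w a (b + c) d = tri w a b d + tri w a c d.
  by rewrite triC triDl !(triC _ a).
have triZm x a b c : tri w a (x *: b) c = x * tri w a b c.
  by rewrite triC triZl (triC _ a).
have triDr a b c d : tri w a b (c + d) = tri w a b c + tri w a b d.
  by rewrite triCr triDm !(triCr _ b).
have triZr x a b c : tri w a b (x *: c) = x * tri w a b c.
  by rewrite triCr triZm (triCr _ b).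
rewrite !(triDl, triZl, triDm, triZm, triDr, triZr).
rewrite !(triCr e0 e1 e0) !(triC e1 e0 e0) !(triCr e0 e2 e0) !(triC e2 e0 e0).
rewrite !(triCr e1 e0 e1) !(triC e0 e1 e1) !(triCr e1 e2 e1) !(triC e2 e1 e1).
rewrite !(triCr e2 e0 e2) !(triC e0 e2 e2) !(triCr e2 e1 e2) !(triC e1 e2 e2).
rewrite !(triCr e1 e0 e1) !(triCr e0 e1 e0) !(triCr e0 e2 e0) !(triCr e1 e2 e1)
  !(triCr e2 e0 e2) !(triCr e2 e1 e2).
rewrite !(triCr e0 e2 e1) !(triC e1 e0 e2) !(triC e2 e0 e1) !(triCr e0 e2 e1).
rewrite !(triC e2 e1 e0) !(triCr e1 e2 e0) !(triC e1 e0 e2).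
ring.
Qed.

End SymmetricTensors.

(** If the polar form at [c] is the square of the linear form v, the rows of the polar matrix
    combined by [c] become v times its own coefficients. *)
Lemma dyadic_syzygy (k : fieldType) (A : algType k) (x : 'I_3 -> A)
    (y : 'I_3 -> 'I_3 -> A) (w : tensor3 k) (c u v : 'I_3 -> k) :
  (forall j l, y j l = \sum_t w [tuple j; t; l] *: x t) ->
  (forall t l, \sum_j c j * w [tuple j; t; l] = v t * v l) ->
  forall l, \sum_j (\sum_i (\matrix_(i, j) (u i * c j) : 'M_3) i j *: x i) * y j l =
    v l *: ((\sum_i u i *: x i) * (\sum_i v i *: x i)).
Proof.
move=> yE cv l; transitivity ((\sum_i u i *: x i) * \sum_j c j *: \sum_t w [tuple j; t; l] *: x t).
  rewrite mulr_sumr; apply: eq_bigr => j _; rewrite -yE -scalerAr scalerAl; congr (_ * _).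
  by rewrite scaler_sumr; apply: eq_bigr => i _; rewrite scalerA mulrC mxE.
rewrite scalerAr; congr (_ * _).
under eq_bigr => j _ do rewrite scaler_sumr.
rewrite exchange_big scaler_sumr; apply: eq_bigr => t _ /=.
rewrite scalerA [v l * _]mulrC -cv scaler_suml; apply: eq_bigr => j _; exact: scalerA.
Qed.

Lemma square_relation (k : fieldType) (A : algType k) (x : 'I_3 -> A) (w : tensor3 k)
    (c v : 'I_3 -> k) :
  (forall t l, \sum_j c j * w [tuple j; t; l] = v t * v l) ->
  (forall j, \sum_t \sum_l w [tuple j; t; l] *: (x t * x l) = 0) ->
  (\sum_i v i *: x i) * (\sum_i v i *: x i) = 0.
Proof.
move=> cv rel.
transitivity (\sum_j c j *: \sum_t \sum_l w [tuple j; t; l] *: (x t * x l)).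
  rewrite mulr_suml; under [RHS]eq_bigr => j _ do rewrite scaler_sumr.
  rewrite exchange_big; apply: eq_bigr => t _.
  under [RHS]eq_bigr => j _ do rewrite scaler_sumr.
  rewrite mulr_sumr exchange_big; apply: eq_bigr => l _.
  rewrite -scalerAl -scalerAr scalerA -cv scaler_suml.
  by apply: eq_bigr => j _; rewrite scalerA.
by rewrite big1 // => j _; rewrite rel scaler0.
Qed.

Definition polar_not_square (k : fieldType) (w : tensor3 k) : Prop :=
  forall c v : 'rV[k]_3, c != 0 -> polar w c <> v^T *m v.

(* A square [polar w c = v^T *m v] makes both [v_i c_j] and, if [v = 0], every
   [u_i c_j] a syzygy of the relations besides the one given by the potential
   itself, leaving too few relations in degree 3. *)
Lemma regular_polar_not_square (k : fieldType) (w : tensor3 k) :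
  symmetric_coefs w -> regular_potential w -> polar_not_square w.
Proof.
move=> sym reg c v cN0 /matrixP pcv.
have cv t l : \sum_j c 0 j * w [tuple j; t; l] = v 0 t * v 0 l.
  by have := pcv t l; rewrite !mxE big_ord1 mxE.
have sq := square_relation cv (fun j => D_rel w j).
have key (u : 'I_3 -> k) :
    (forall l, v 0 l *: ((\sum_i u i *: dx w i) * (\sum_i v 0 i *: dx w i)) = 0) ->
    exists d, forall i j, u i * c 0 j = d * (i == j)%:R.
  move=> h; have [|d dP] := regular_syzygy reg (a := \matrix_(i, j) (u i * c 0 j)) sym.
    by move=> l; exact: etrans (dyadic_syzygy u (@D_polarE k w) cv l) (h l).
  by exists d => i j; move/matrixP: dP => /(_ i j); rewrite !mxE mulr_natr.
(* A matrix of rank at most one is scalar only if it is zero: the first principal 2 x 2 minor gives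
   d^2 = 0. *)
have u0 u : (exists d, forall i j, u i * c 0 j = d * (i == j)%:R) -> forall i, u i = 0.
  move=> [d dP] i; have /eqP cN := cN0.
  suff d0 : d = 0.
    apply/eqP; apply/negPn/negP => ui; apply: cN; apply/rowP => j; rewrite mxE.
    by apply: (mulfI ui); rewrite dP d0 mul0r mulr0.
  have := dP vx vx; have := dP vx vy; have := dP vy vy; rewrite !mulr1 mulr0 /=.
  move=> e1 e2 e3; apply/eqP; rewrite -sqrf_eq0 expr2 -{1}e1 -e3.
  by apply/eqP; transitivity (u vx * c 0 vy * (u vy * c 0 vx)); [ring | rewrite e2 mul0r].
(* For u = v the product is the square of v, which vanishes in D(w); this forces v = 0. Then any u
   is allowed, and the constant 1 gives the contradiction. *)
have v0 : forall i, v 0 i = 0.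
  by apply: u0; apply: key => l; rewrite sq scaler0.
have /eqP : (1 : k) = 0 by apply: (u0 (fun=> 1) _ vx); apply: key => l; rewrite v0 scale0r.
by rewrite oner_eq0.
Qed.

Lemma polar_not_square_gl_act (k : fieldType) (w : tensor3 k) (g : 'M[k]_3) :
  g \in unitmx -> polar_not_square w -> polar_not_square (gl_act g w).
Proof.
move=> gu ns c v cN0; rewrite polar_gl_act => e.
apply: (ns (c *m g) (v *m invmx g^T)).
  by apply: contra_neq cN0 => /(congr1 (mulmx^~ (invmx g))); rewrite mulmxK // mul0mx.
have gtu : g^T \in unitmx by rewrite unitmx_tr.
rewrite trmx_mul trmx_inv trmxK mulmxA -[_ *m v^T *m v]mulmxA -e.
by rewrite !mulmxA mulVmx // mul1mx mulmxK.
Qed.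

(** * Frames that produce a Hesse form *)

Section HesseForm.
Variable k : fieldType.
Implicit Types (w : tensor3 k) (a b e : 'rV[k]_3).

Definition hesse_form al be ga w : Prop :=
  exists2 w', linear_change w w' & forall i j l, w' [tuple i; j; l] = hesse_coef al be ga i j l.

(* The vectors need not be assumed to be a basis: pairing a relation with two of
   them shows that the coefficient of the third vanishes. *)
Lemma hesse_form_frame w e0 e1 e2 q : symmetric_coefs w ->
  tri w e0 e0 e1 = 0 -> tri w e0 e0 e2 = 0 -> tri w e1 e1 e0 = 0 ->
  tri w e1 e1 e2 = 0 -> tri w e2 e2 e0 = 0 -> tri w e2 e2 e1 = 0 ->
  tri w e0 e1 e2 = q -> q != 0 ->
  hesse_form (tri w e0 e0 e0 / q ^+ 3) (tri w e1 e1 e1) (tri w e2 e2 e2) w.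
Proof.
move=> sym h001 h002 h110 h112 h220 h221 h012 q0.
(* Rescaling one vector makes the mixed coefficient 1 and divides the first cube by [q ^+ 3]. *)
pose f0 := q^-1 *: e0.
have tC := triC sym; have tCr := triCr sym.
have tZm x a b c : tri w a (x *: b) c = x * tri w a b c by rewrite tC triZl (tC _ a).
have tZr x a b c : tri w a b (x *: c) = x * tri w a b c by rewrite tCr tZm (tCr _ b).
have g000 : tri w f0 f0 f0 = tri w e0 e0 e0 / q ^+ 3.
  by rewrite triZl tZm tZr; field.
have g001 : tri w f0 f0 e1 = 0 by rewrite triZl tZm h001 !mulr0.
have g002 : tri w f0 f0 e2 = 0 by rewrite triZl tZm h002 !mulr0.
have g110 : tri w e1 e1 f0 = 0 by rewrite tZr h110 mulr0.
have g220 : tri w e2 e2 f0 = 0 by rewrite tZr h220 mulr0.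
have g012 : tri w f0 e1 e2 = 1 by rewrite triZl h012 mulVf.
pose f (i : 'I_3) := nth 0 [:: f0; e1; e2] i.
pose g := \matrix_i f i.
have gE i : row i g = f i by rewrite rowK.
exists (gl_act g w).
  exists g => //; rewrite -row_free_unit; apply: inj_row_free => v.
  rewrite mulmx_sum_row sum_ord3 !gE /f /= => v0.
  have p a b : v 0 vx * tri w f0 a b + v 0 vy * tri w e1 a b + v 0 vz * tri w e2 a b = 0.
    by rewrite -!triZl -!triDl v0 -(scale0r 0) triZl mul0r.
  apply/rowP => i; rewrite mxE; case: (ord3P i) => ->.
  - have := p e1 e2; rewrite g012 h112 mulr0 addr0 (tCr e2) h221.
    by rewrite mulr0 addr0 mulr1.
  - have := p f0 e2; rewrite g002 (tCr e2) g220 (tC e1) g012.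
    by rewrite !mulr0 add0r addr0 mulr1.
  - have := p f0 e1; rewrite g001 (tCr e1) g110 (tC e2) (tCr f0) g012.
    by rewrite !mulr0 !add0r mulr1.
move=> i j l; rewrite gl_act_coef !gE.
case: (ord3P i) => ->; case: (ord3P j) => ->; case: (ord3P l) => -> //=;
  rewrite /hesse_coef /=; by
  [ | rewrite tC | rewrite tCr | rewrite tC tCr | rewrite tCr tC | rewrite tCr tC tCr].
Qed.
End HesseForm.

(** * Isotropic vectors and singular cubics *)

Section Isotropic.
Variables (k : closedFieldType).
Hypothesis k_char0 : [pchar k] =i pred0.
Implicit Types (P : 'M[k]_3) (a b c e : 'rV[k]_3).

Lemma two_neq0 : 2%:R != 0 :> k.
Proof. by rewrite ((pcharf0P k).1 k_char0). Qed.

Lemma square_root (x : k) : exists y, y ^+ 2 = x.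
Proof.
have [y yE] := solve_monicpoly (fun i => if i == 0%N then x else 0) (ltn0Sn 1).
by exists y; rewrite yE !big_ord_recl big_ord0 /= expr0 mulr1 mul0r !addr0.
Qed.

Lemma cube_root (x : k) : exists y, y ^+ 3 = x.
Proof.
have [y yE] := solve_monicpoly (fun i => if i == 0%N then x else 0) (ltn0Sn 2).
by exists y; rewrite yE !big_ord_recl big_ord0 /= expr0 mulr1 !mul0r !addr0.
Qed.

Local Notation qf P a b := ((a *m P *m b^T) 0 0).

Lemma qfC P a b : P^T = P -> qf P a b = qf P b a.
Proof.
move=> PT; transitivity ((a *m P *m b^T)^T 0 0); first by rewrite [RHS]mxE.
by rewrite !trmx_mul trmxK PT mulmxA.
Qed.

Lemma qfD P a b c : qf P (a + b) c = qf P a c + qf P b c.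
Proof. by rewrite !mulmxDl mxE. Qed.

Lemma qfZ P x a c : qf P (x *: a) c = x * qf P a c.
Proof. by rewrite -!scalemxAl mxE. Qed.

Lemma qfDr P a b c : qf P c (a + b) = qf P c a + qf P c b.
Proof. by rewrite linearD /= mulmxDr mxE. Qed.

Lemma qfZr P x a c : qf P c (x *: a) = x * qf P c a.
Proof. by rewrite linearZ /= -scalemxAr mxE. Qed.

Lemma exists_anisotropic P : P^T = P -> P != 0 -> exists a, qf P a a != 0.
Proof.
move=> PT; apply: contra_neqP => /forallNP h.
have h' a : qf P a a = 0 by apply/eqP/negPn/negP; apply: h.
apply/matrixP => i j; rewrite mxE.
pose d i : 'rV[k]_3 := delta_mx 0 i; have := h' (d i + d j).
rewrite qfD !qfDr !h' add0r addr0 (qfC (d j)) // -mulr2n -mulr_natl.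
move/eqP; rewrite mulf_eq0 (negbTE two_neq0) /= => /eqP.
by rewrite -rowE trmx_delta -colE !mxE.
Qed.

(** Removing from [P] the square attached to an anisotropic [a] leaves a nonzero form, which gives
    an anisotropic [b'] orthogonal to [a]. The vectors [a + t b'] and [a - t b'] are isotropic for
    the right [t] and pair to twice the value at [a]. *)
Lemma isotropic_pair P : P^T = P -> (forall v : 'rV_3, P <> v^T *m v) ->
  exists e1 e2, [/\ qf P e1 e1 = 0, qf P e2 e2 = 0 & qf P e1 e2 != 0].
Proof.
move=> PT Pv.
have [|a a0] := exists_anisotropic PT.
  by apply/eqP => P0; apply: (Pv 0); rewrite mulmx0.
have [r rE] := square_root (qf P a a).
have r0 : r != 0 by rewrite -sqrf_eq0 rE.
pose v := r^-1 *: (a *m P).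
have vE b : (v *m b^T) 0 0 = r^-1 * qf P a b by rewrite -scalemxAl mxE.
have P'E b c : qf (P - v^T *m v) b c = qf P b c - qf P a b * qf P a c / qf P a a.
  rewrite mulmxBr mulmxBl mxE [X in _ + X]mxE; congr (_ - _).
  rewrite mulmxA -[b *m _ *m _ *m _]mulmxA mxE big_ord1 vE.
  rewrite -[b *m v^T]trmxK trmx_mul trmxK mxE vE -rE; field.
  by rewrite r0.
have [||b b0] := @exists_anisotropic (P - v^T *m v).
- by rewrite linearB /= PT trmx_mul trmxK.
- by rewrite subr_eq0; apply/eqP.
move: b0; rewrite P'E => b0.
pose b' := b - (qf P a b / qf P a a) *: a.
have ab : qf P a b' = 0.
  by rewrite /b' -scaleNr qfDr qfZr; field.
have ba : qf P b' a = 0 by rewrite qfC.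
have bb : qf P b' b' = qf P b b - qf P a b * qf P a b / qf P a a.
  rewrite {2}/b' -scaleNr qfDr qfZr ba mulr0 addr0 /b' -scaleNr qfD qfZ.
  by field.
rewrite -bb in b0; clear bb; clearbody b'.
have [t tE] := square_root (- qf P a a / qf P b' b').
exists (a + t *: b'), (a + - t *: b').
rewrite !qfD !qfDr !qfZ !qfZr ab ba.
have e : t * (t * qf P b' b') = - qf P a a by rewrite mulrA -expr2 tE mulfVK.
split; rewrite ?mulr0 ?addr0 ?add0r; rewrite ?mulNr ?mulrN ?opprK e ?subrr //.
by rewrite opprK -mulr2n -mulr_natl mulf_neq0 ?two_neq0.
Qed.

Lemma polar_sym (w : tensor3 k) a : symmetric_coefs w -> (polar w a)^T = polar w a.
Proof.
move=> [w1 w2]; apply/matrixP => i j; rewrite !mxE; apply: eq_bigr => l _.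
by rewrite w2.
Qed.

(** Adding c s to [e1] changes w(e1, e1, e2) by 2 c q and keeps [e1] isotropic, since w(s, s, .) =
    0. So c = -w(e1, e1, e2) / (2 q) kills this coefficient, and likewise for [e2]. *)
Lemma hesse_form_singular (w : tensor3 k) s : symmetric_coefs w -> polar_not_square w ->
  s != 0 -> (forall a, tri w s s a = 0) -> exists be ga, hesse_form 0 be ga w.
Proof.
move=> sym ns s0 ss.
have [e1 [e2 [h1 h2 q0]]] := isotropic_pair (polar_sym s sym) (ns s ^~ s0).
rewrite -!/(tri w s _ _) in h1 h2 q0.
set q := tri w s e1 e2 in q0.
pose cb p0 p1 p2 : 'rV_3 := p0 *: s + p1 *: e1 + p2 *: e2.
have h110 : tri w e1 e1 s = 0 by rewrite (triCr sym) (triC sym).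
have h220 : tri w e2 e2 s = 0 by rewrite (triCr sym) (triC sym).
have two := two_neq0.
exists (tri w (cb (- tri w e1 e1 e2 / (2%:R * q)) 1 0)
              (cb (- tri w e1 e1 e2 / (2%:R * q)) 1 0)
              (cb (- tri w e1 e1 e2 / (2%:R * q)) 1 0)).
exists (tri w (cb (- tri w e2 e2 e1 / (2%:R * q)) 0 1)
              (cb (- tri w e2 e2 e1 / (2%:R * q)) 0 1)
              (cb (- tri w e2 e2 e1 / (2%:R * q)) 0 1)).
have h000 : tri w (cb 1 0 0) (cb 1 0 0) (cb 1 0 0) / q ^+ 3 = 0.
  by rewrite /cb tri_comb // !ss; field.
by rewrite -{1}h000; apply: hesse_form_frame => //; rewrite /cb tri_comb // ?ss ?h110 ?h220 -/q; field;
  rewrite ?two ?q0.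
Qed.
End Isotropic.

(** * Smooth cubics: conjugate pairs and coordinates *)

Section SmoothPotentials.
Variable k : closedFieldType.
Implicit Types (w : tensor3 k) (a b c e g s : 'rV[k]_3).

Definition smooth w := forall s, (forall a, tri w s s a = 0) -> s = 0.

Lemma smooth_gl_act w (g : 'M[k]_3) : g \in unitmx -> smooth w -> smooth (gl_act g w).
Proof.
move=> gu sm s s0; have /(congr1 (mulmx^~ (invmx g))) : s *m g = 0.
  by apply: sm => a; rewrite -[a](mulmxKV gu) -tri_gl_act s0.
by rewrite mulmxK // mul0mx.
Qed.

Lemma polar0P w a b : (forall c, tri w a b c = 0) <-> b *m polar w a = 0.
Proof.
split=> [h|h c]; last by rewrite /tri h mul0mx mxE.
apply/rowP => j; have := h (delta_mx 0 j).
by rewrite /tri trmx_delta -colE !mxE.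
Qed.

(** [c] is a point of the Hessian curve on the line through the first two basis vectors, found as an
    eigenvalue of the pencil of their polar forms; [g] lies in the kernel of its polar form. *)
Lemma conjugate_pair w : exists c g, [/\ c != 0, g != 0 & forall a, tri w c g a = 0].
Proof.
pose d i : 'rV[k]_3 := delta_mx 0 i.
have dN i : d i != 0.
  by apply/eqP => /rowP/(_ i)/eqP; rewrite !mxE !eqxx oner_eq0.
suff [c [g [cN gN gc]]] : exists c g, [/\ c != 0, g != 0 & g *m polar w c = 0].
  by exists c, g; split=> //; apply/polar0P.
have [/det0P[g gN gc]|dN0] := boolP (\det (polar w (d vx)) == 0); first by exists (d vx), g.
have Pu : polar w (d vx) \in unitmx by rewrite unitmxE unitfE.
pose A := polar w (d vy) *m invmx (polar w (d vx)).
have /closed_rootP[la] : size (char_poly A) != 1%N by rewrite size_char_poly.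
rewrite -eigenvalue_root_char => /eigenvalueP[g gA gN].
exists (- la *: d vx + d vy), g; split=> //.
  by apply/eqP => /rowP/(_ vy)/eqP; rewrite !mxE !eqxx mulr0 add0r oner_eq0.
rewrite polar_linear mulmxDr -scalemxAr scaleNr scalemxAl -gA.
by rewrite mulmxA mulmxKV // addNr.
Qed.

Lemma complete_frame c g : c != 0 -> (forall x, g != x *: c) ->
  exists h, forall x y z, x *: c + y *: g + z *: h = 0 -> [/\ x = 0, y = 0 & z = 0].
Proof.
move=> cN gN.
have [i hi] : exists i, ~~ (row i (1%:M : 'M[k]_3) <= c + g)%MS.
  apply/existsP; rewrite -[X in is_true X]negbK negb_exists; apply/negP => /forallP h.
  have /mxrankS : ((1%:M : 'M[k]_3) <= c + g)%MS.
    by apply/row_subP => i; have := h i; rewrite negbK.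
  rewrite mxrank1 => /leq_trans/(_ (mxrank_adds_leqif _ _)).
  by rewrite ltnNge (leq_trans (leq_add (rank_leq_row _) (rank_leq_row _))).
exists (row i 1%:M) => x y z e.
have z0 : z = 0.
  apply: contraNeq hi => zN.
  have -> : row i 1%:M = - (x / z) *: c + - (y / z) *: g.
    apply/eqP; rewrite -subr_eq0 -(can_eq (scalerK zN)) scaler0 -e.
    rewrite scalerBr scalerDr !scalerA !mulrN ![z * _]mulrC !divfK //.
    by rewrite !scaleNr opprD !opprK addrC.
  by apply: addmx_sub_adds; apply: scalemx_sub.
have y0 : y = 0.
  apply: contraTeq isT => yN; have := gN (- (x / y)).
  rewrite -(can_eq (scalerK yN)) scalerA mulrN mulrC divfK //.
  move: e; rewrite z0 scale0r addr0 => /eqP; rewrite addrC addr_eq0 => /eqP ->.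
  by rewrite scaleNr eqxx.
move: e; rewrite z0 y0 !scale0r !addr0 => /eqP.
by rewrite scaler_eq0 (negbTE cN) orbF => /eqP.
Qed.

Lemma frame_change w e0 e1 e2 :
  (forall x y z, x *: e0 + y *: e1 + z *: e2 = 0 -> [/\ x = 0, y = 0 & z = 0]) ->
  exists2 g, g \in unitmx & forall i j l, gl_act g w [tuple i; j; l] =
    tri w (nth 0 [:: e0; e1; e2] i) (nth 0 [:: e0; e1; e2] j) (nth 0 [:: e0; e1; e2] l).
Proof.
move=> free; pose f (i : 'I_3) := nth 0 [:: e0; e1; e2] i.
exists (\matrix_i f i) => [|i j l]; last by rewrite gl_act_coef !rowK.
rewrite -row_free_unit; apply: inj_row_free => v.
rewrite mulmx_sum_row sum_ord3 !rowK => /free[vx0 vy0 vz0].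
by apply/rowP => i; rewrite mxE; case: (ord3P i) => ->.
Qed.

Lemma hesse_form_change al be ga w w' :
  linear_change w w' -> hesse_form al be ga w' -> hesse_form al be ga w.
Proof.
move=> ww' [w'' w'w'' h]; exists w'' => //.
exact: linear_change_trans ww' w'w''.
Qed.

Definition row3 (x y z : k) : 'rV[k]_3 :=
  x *: delta_mx 0 vx + y *: delta_mx 0 vy + z *: delta_mx 0 vz.

Lemma row3E x y z : [/\ row3 x y z 0 vx = x, row3 x y z 0 vy = y & row3 x y z 0 vz = z].
Proof. by rewrite /row3 !mxE /= !mulr1 !mulr0 !addr0 !add0r. Qed.

Lemma row3P a : a = row3 (a 0 vx) (a 0 vy) (a 0 vz).
Proof.
have [e0 e1 e2] := row3E (a 0 vx) (a 0 vy) (a 0 vz).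
by apply/rowP => i; case: (ord3P i) => ->.
Qed.

Lemma row3_eq0 x y z : row3 x y z = 0 -> [/\ x = 0, y = 0 & z = 0].
Proof. by have [e0 e1 e2] := row3E x y z; move=> e; move: e0 e1 e2; rewrite e !mxE => <- <- <-. Qed.

Lemma tri_row3 w p0 p1 p2 q0 q1 q2 r0 r1 r2 : symmetric_coefs w ->
  tri w (row3 p0 p1 p2) (row3 q0 q1 q2) (row3 r0 r1 r2) =
  p0 * q0 * r0 * w [tuple vx; vx; vx] + p1 * q1 * r1 * w [tuple vy; vy; vy]
  + p2 * q2 * r2 * w [tuple vz; vz; vz]
  + (p0 * q0 * r1 + p0 * q1 * r0 + p1 * q0 * r0) * w [tuple vx; vx; vy]
  + (p0 * q0 * r2 + p0 * q2 * r0 + p2 * q0 * r0) * w [tuple vx; vx; vz]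
  + (p1 * q1 * r0 + p1 * q0 * r1 + p0 * q1 * r1) * w [tuple vy; vy; vx]
  + (p1 * q1 * r2 + p1 * q2 * r1 + p2 * q1 * r1) * w [tuple vy; vy; vz]
  + (p2 * q2 * r0 + p2 * q0 * r2 + p0 * q2 * r2) * w [tuple vz; vz; vx]
  + (p2 * q2 * r1 + p2 * q1 * r2 + p1 * q2 * r2) * w [tuple vz; vz; vy]
  + (p0 * q1 * r2 + p0 * q2 * r1 + p1 * q0 * r2 + p1 * q2 * r0
     + p2 * q0 * r1 + p2 * q1 * r0) * w [tuple vx; vy; vz].
Proof.
move=> sym; have dE i j l : tri w (delta_mx 0 i) (delta_mx 0 j) (delta_mx 0 l) = w [tuple i; j; l].
  by rewrite /tri -rowE trmx_delta -colE !mxE (bigD1 i) //= mxE !eqxx mul1r big1 ?addr0 // => t /negbTE ti; rewrite mxE ti andbF mul0r.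
by rewrite /row3 tri_comb // !dE.
Qed.

End SmoothPotentials.

(** * From a Weierstrass form to a Hesse form *)

Section Coordinates.
Variables (k : closedFieldType) (w : tensor3 k).
Hypothesis k_char0 : [pchar k] =i pred0.
Hypothesis sym : symmetric_coefs w.
Local Notation c000 := (w [tuple vx; vx; vx]).
Local Notation c111 := (w [tuple vy; vy; vy]).
Local Notation c222 := (w [tuple vz; vz; vz]).
Local Notation c001 := (w [tuple vx; vx; vy]).
Local Notation c002 := (w [tuple vx; vx; vz]).
Local Notation c110 := (w [tuple vy; vy; vx]).
Local Notation c112 := (w [tuple vy; vy; vz]).
Local Notation c220 := (w [tuple vz; vz; vx]).
Local Notation c221 := (w [tuple vz; vz; vy]).
Local Notation c012 := (w [tuple vx; vy; vz]).

Lemma polar_not_square_coords (c0 c1 c2 v0 v1 v2 : k) : polar_not_square w ->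
  c0 * c000 + c1 * c001 + c2 * c002 = v0 * v0 ->
  c0 * c110 + c1 * c111 + c2 * c112 = v1 * v1 ->
  c0 * c220 + c1 * c221 + c2 * c222 = v2 * v2 ->
  c0 * c001 + c1 * c110 + c2 * c012 = v0 * v1 ->
  c0 * c002 + c1 * c012 + c2 * c220 = v0 * v2 ->
  c0 * c012 + c1 * c112 + c2 * c221 = v1 * v2 ->
  [/\ c0 = 0, c1 = 0 & c2 = 0].
Proof.
move=> ns h00 h11 h22 h01 h02 h12; apply: row3_eq0; apply/eqP/negPn/negP => cN0.
apply: (ns _ (row3 v0 v1 v2) cN0); case: sym => w1 w2.
have [e0 e1 e2] := row3E c0 c1 c2; have [f0 f1 f2] := row3E v0 v1 v2.
apply/matrixP => i j; rewrite [LHS]mxE [RHS]mxE big_ord1 [_^T _ _]mxE sum_ord3 e0 e1 e2.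
case: (ord3P i) => ->; case: (ord3P j) => ->; rewrite ?f0 ?f1 ?f2.
- by rewrite -h00 [w [tuple vy; vx; vx]]w1 [w [tuple vx; vy; vx]]w2
    [w [tuple vz; vx; vx]]w1 [w [tuple vx; vz; vx]]w2.
- by rewrite -h01 [w [tuple vy; vx; vy]]w2 [w [tuple vz; vx; vy]]w1 [w [tuple vx; vz; vy]]w2.
- by rewrite -h02 [w [tuple vy; vx; vz]]w1 [w [tuple vz; vx; vz]]w2.
- by rewrite [RHS]mulrC -h01 [w [tuple vx; vy; vx]]w2 [w [tuple vz; vy; vx]]w2
    [w [tuple vz; vx; vy]]w1 [w [tuple vx; vz; vy]]w2.
- by rewrite -h11 [w [tuple vx; vy; vy]]w1 [w [tuple vy; vx; vy]]w2
    [w [tuple vz; vy; vy]]w1 [w [tuple vy; vz; vy]]w2.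
- by rewrite -h12 [w [tuple vz; vy; vz]]w2.
- by rewrite [RHS]mulrC -h02 [w [tuple vx; vz; vx]]w2 [w [tuple vy; vz; vx]]w2
    [w [tuple vy; vx; vz]]w1.
- by rewrite [RHS]mulrC -h12 [w [tuple vx; vz; vy]]w2 [w [tuple vy; vz; vy]]w2.
- by rewrite -h22 [w [tuple vx; vz; vz]]w1 [w [tuple vz; vx; vz]]w2
    [w [tuple vy; vz; vz]]w1 [w [tuple vz; vy; vz]]w2.
Qed.

Lemma smooth_coords (s0 s1 s2 : k) : smooth w ->
  s0 * s0 * c000 + s1 * s1 * c110 + s2 * s2 * c220
    + 2%:R * (s0 * s1 * c001 + s0 * s2 * c002 + s1 * s2 * c012) = 0 ->
  s0 * s0 * c001 + s1 * s1 * c111 + s2 * s2 * c221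
    + 2%:R * (s0 * s1 * c110 + s0 * s2 * c012 + s1 * s2 * c112) = 0 ->
  s0 * s0 * c002 + s1 * s1 * c112 + s2 * s2 * c222
    + 2%:R * (s0 * s1 * c012 + s0 * s2 * c220 + s1 * s2 * c221) = 0 ->
  [/\ s0 = 0, s1 = 0 & s2 = 0].
Proof.
move=> sm h0 h1 h2; apply: row3_eq0; apply: sm => a.
rewrite (row3P a) tri_row3 //.
move: (a 0 vx) (a 0 vy) (a 0 vz) => a0 a1 a2.
transitivity (a0 * 0 + a1 * 0 + a2 * 0 : k); last by rewrite !mulr0 !addr0.
by rewrite -{1}h0 -{1}h1 -h2; ring.
Qed.

Lemma hesse_form_row3 p0 p1 p2 q0 q1 q2 r0 r1 r2 t :
  let e0 := row3 p0 p1 p2 in let e1 := row3 q0 q1 q2 in let e2 := row3 r0 r1 r2 in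
  tri w e0 e0 e1 = 0 -> tri w e0 e0 e2 = 0 -> tri w e1 e1 e0 = 0 ->
  tri w e1 e1 e2 = 0 -> tri w e2 e2 e0 = 0 -> tri w e2 e2 e1 = 0 ->
  tri w e0 e1 e2 = t -> t != 0 -> exists al be ga, hesse_form al be ga w.
Proof.
move=> e0 e1 e2 h1 h2 h3 h4 h5 h6 h7 t0.
exists (tri w e0 e0 e0 / t ^+ 3), (tri w e1 e1 e1), (tri w e2 e2 e2).
exact: (hesse_form_frame sym h1 h2 h3 h4 h5 h6 h7 t0).
Qed.

(* On y^2 = x^3 + a x + b let (x0, y0) be a point of order 3, so that x0 is a
   root of the division polynomial 3 x^4 + 6 a x^2 + 12 b x - a^2. The frame
   consists of the vertices of a triangle through the nine flexes. *)
Lemma hesse_form_weierstrass a b : polar_not_square w -> smooth w ->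
  c000 = 1 -> c111 = 0 -> c222 = b -> c001 = 0 -> c002 = 0 -> c110 = 0 ->
  c112 = - 3%:R^-1 -> c220 = a / 3%:R -> c221 = 0 -> c012 = 0 ->
  exists al be ga, hesse_form al be ga w.
Proof.
move=> ns sm h000 h111 h222 h001 h002 h110 h112 h220 h221 h012.
have three : 3%:R != 0 :> k by rewrite ((pcharf0P k).1 k_char0).
have two := two_neq0 k_char0.
(* For a = 0 the polar form at the first basis vector is the square of the first coordinate. *)
have aN0 : a != 0.
  apply/eqP => a0.
  have [] := @polar_not_square_coords 1 0 0 1 0 0 ns; rewrite
    ?h000 ?h111 ?h222 ?h001 ?h002 ?h110 ?h112 ?h220 ?h221 ?h012 ?a0;
    try by rewrite ?mul0r ?mulr0 ?mul1r ?addr0.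
  by move/eqP; rewrite oner_eq0.
have [x0 x0E] : exists x, 3%:R * x ^+ 4 + 6%:R * a * x ^+ 2 + 12%:R * b * x - a ^+ 2 = 0.
  have := @solve_monicpoly k 4 (nth 0 [:: a ^+ 2 / 3%:R; - (4%:R * b); - (2%:R * a)]) isT.
  move=> [x xE]; exists x; rewrite xE !big_ord_recl big_ord0 /=; field.
  by [].
set Y := x0 ^+ 3 + a * x0 + b; set t := 3%:R * x0 ^+ 2 + a.
set psi := _ - _ in x0E.
have psiE : psi = 12%:R * x0 * Y - t ^+ 2 by rewrite /psi /Y /t; ring.
have x0a : t = 0 -> x0 ^+ 2 = - (a / 3%:R).
  move=> t0; apply/eqP; rewrite -subr_eq0 opprK; apply/eqP.
  by transitivity (t / 3%:R); [rewrite /t; field | rewrite t0 mul0r].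
(* [Y] is the square of the ordinate at [x0] and [t] the derivative there. If [Y] vanishes so does
   [t], and [(x0, 0, 1)] is a singular point. *)
have YN0 : Y != 0.
  apply/eqP => Y0; have t0 : t = 0.
    by apply/eqP; move/eqP: x0E; rewrite psiE Y0 mulr0 sub0r oppr_eq0 sqrf_eq0.
  have xa := x0a t0.
  have [] := @smooth_coords x0 0 1 sm; rewrite
    ?h000 ?h111 ?h222 ?h001 ?h002 ?h110 ?h112 ?h220 ?h221 ?h012.
  - by transitivity (t / 3%:R); [rewrite /t; field | rewrite t0 mul0r].
  - by ring.
  - transitivity (Y - x0 * (t / 3%:R)); first by rewrite /Y /t; field.
    by rewrite Y0 t0 mul0r mulr0 subr0.
  - by move=> _ _ /eqP; rewrite oner_eq0.
have tN0 : t != 0.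
  apply/eqP => t0; have := x0E; rewrite psiE t0 expr0n subr0 => /eqP.
  rewrite !mulf_eq0 (negbTE YN0) orbF ((pcharf0P k).1 k_char0) /= => /eqP x00.
  by move: t0; rewrite /t x00 expr0n mulr0 add0r; apply/eqP.
(* [ka] is the ordinate of the flex multiplied by a square root of -3. *)
have [ka kaE] := square_root (- (3%:R * Y)).
(* With [e0 = (s, 0, t)] and [e1 = (x0, ka, 1)], this is the solution of w(e1, e1, e0) = 0 after
   dividing by [t]. *)
pose s := - (3%:R * x0 ^+ 3 + 5%:R * a * x0 + 6%:R * b).
have ka0 : ka ^+ 2 + 3%:R * Y = 0 by rewrite kaE addNr.
apply: (@hesse_form_row3 s 0 t x0 ka 1 x0 (- ka) 1 (2%:R / 3%:R * ka ^+ 2 * t)) => /=;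
  last (by rewrite kaE !mulf_neq0 ?invr_eq0 ?oppr_eq0 ?mulf_neq0);
  rewrite tri_row3 // ?h000 ?h111 ?h222 ?h001 ?h002 ?h110 ?h112 ?h220 ?h221 ?h012.
- by transitivity (3%:R * Y * psi); [rewrite /s /Y /t /psi; field | rewrite x0E mulr0].
- by transitivity (3%:R * Y * psi); [rewrite /s /Y /t /psi; field | rewrite x0E mulr0].
- by transitivity (- t / 3%:R * (ka ^+ 2 + 3%:R * Y)); [rewrite /s /Y /t; field | rewrite ka0 mulr0].
- by transitivity (3%:R^-1 * (ka ^+ 2 + 3%:R * Y)); [rewrite /s /Y /t; field | rewrite ka0 mulr0].
- by transitivity (- t / 3%:R * (ka ^+ 2 + 3%:R * Y)); [rewrite /s /Y /t; field | rewrite ka0 mulr0].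
- by transitivity (3%:R^-1 * (ka ^+ 2 + 3%:R * Y)); [rewrite /s /Y /t; field | rewrite ka0 mulr0].
- apply/eqP; rewrite -subr_eq0; apply/eqP.
  transitivity (- t / 3%:R * (ka ^+ 2 + 3%:R * Y)); first by rewrite /s /Y /t; field.
  by rewrite ka0 mulr0.
Qed.
End Coordinates.

(** * Flexes and reduction to Weierstrass form *)

Section SmoothHesse.
Variable k : closedFieldType.
Hypothesis k_char0 : [pchar k] =i pred0.
Implicit Types (w : tensor3 k) (c g h : 'rV[k]_3).

Lemma row3_comb x y z p0 p1 p2 q0 q1 q2 r0 r1 r2 :
  x *: row3 p0 p1 p2 + y *: row3 q0 q1 q2 + z *: row3 r0 r1 r2 =
  row3 (x * p0 + y * q0 + z * r0) (x * p1 + y * q1 + z * r1)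
       (x * p2 + y * q2 + z * r2) :> 'rV[k]_3.
Proof.
apply/rowP => i; rewrite !mxE.
by case: (ord3P i) => -> /=; ring.
Qed.

Lemma conjugate_frame w c g : symmetric_coefs w -> smooth w ->
  c != 0 -> g != 0 -> (forall a, tri w c g a = 0) ->
  exists w1, [/\ linear_change w w1,
    [/\ w1 [tuple vx; vx; vx] = tri w c c c & w1 [tuple vy; vy; vy] = tri w g g g]
  & [/\ w1 [tuple vx; vx; vy] = 0, w1 [tuple vy; vy; vx] = 0
      & w1 [tuple vx; vy; vz] = 0]].
Proof.
move=> sym sm cN gN cg.
have [x|h free] := complete_frame cN (g := g).
  apply: contraNneq cN => gE; apply/eqP/sm => a.
  have xN : x != 0 by apply: contraNneq gN => x0; rewrite gE x0 scale0r.
  apply: (mulfI xN); rewrite mulr0 -(cg a) gE.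
  by rewrite (triC sym c (x *: c)) triZl.
have [B Bu BE] := frame_change w free; exists (gl_act B w); split.
- by exists B.
- by rewrite !BE.
- rewrite !BE /=; split; last exact: cg.
    by rewrite (triCr sym) cg.
  by rewrite (triCr sym) (triC sym) cg.
Qed.

(** [g] lies on the cubic and its polar form is degenerate, so it is a flex. In a frame starting
    with [c] and [g], a shift of the third vector and two rescalings give a Weierstrass equation. *)
Lemma hesse_form_flex w c g : symmetric_coefs w -> polar_not_square w -> smooth w ->
  c != 0 -> g != 0 -> (forall a, tri w c g a = 0) -> tri w g g g = 0 ->
  exists al be ga, hesse_form al be ga w.
Proof.
move=> sym ns sm cN gN cg ggg.
have [w1 [ch [h000 h111] [h001 h110 h012]]] := conjugate_frame sym sm cN gN cg.
suff [al [be [ga h]]] : exists al be ga, hesse_form al be ga w1.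
  by exists al, be, ga; apply: hesse_form_change ch h.
have [B Bu w1E] := ch.
have sym1 : symmetric_coefs w1 by rewrite -w1E; apply: symmetric_gl_act.
have ns1 : polar_not_square w1 by rewrite -w1E; apply: polar_not_square_gl_act.
have sm1 : smooth w1 by rewrite -w1E; apply: smooth_gl_act.
rewrite ggg in h111.
move: (tri w c c c) h000 => al h000 {w c g sym ns sm cN gN cg ggg ch B Bu w1E}.
set p := w1 [tuple vx; vx; vz]; set q := w1 [tuple vy; vy; vz].
set r := w1 [tuple vz; vz; vy].
have qN : q != 0.
  apply/eqP => q0; have [] := @smooth_coords k w1 sym1 0 1 0 sm1;
    rewrite ?h000 ?h111 ?h001 ?h110 ?h012 -/p -/q -/r ?q0; try ring.
  by move=> _ /eqP; rewrite oner_eq0.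
(* Otherwise the line through [c] and [g] lies on the cubic, and a singular point is found on it. *)
have alN : al != 0.
  apply/eqP => al0; have [p0|pN] := eqVneq p 0.
    have [] := @smooth_coords k w1 sym1 1 0 0 sm1;
      rewrite ?h000 ?h111 ?h001 ?h110 ?h012 -/p -/q -/r ?p0 ?al0; try ring.
    by move=> /eqP; rewrite oner_eq0.
  have [x xE] := square_root (- q / p).
  have [] := @smooth_coords k w1 sym1 x 1 0 sm1;
    rewrite ?h000 ?h111 ?h001 ?h110 ?h012 -/p -/q -/r -?expr2 ?xE ?al0; try ring.
    by field.
  by move=> _ /eqP; rewrite oner_eq0.
have two := two_neq0 k_char0.
have three : 3%:R != 0 :> k by rewrite ((pcharf0P k).1 k_char0).
have [u uE] := cube_root al^-1; have [v vE] := square_root (- (3%:R * q)^-1).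
have uN : u != 0.
  apply: contraNneq alN => u0; move/eqP: uE.
  by rewrite u0 expr0n eq_sym invr_eq0.
have vN : v != 0.
  by rewrite -sqrf_eq0 vE oppr_eq0 invr_eq0 mulf_neq0.
(* The shifts in the third vector kill the coefficients of types 002 and 221; [u] and [v] normalise
   those of types 000 and 112 to 1 and -1/3. *)
have [x y z|B Bu BE] := @frame_change k w1 (row3 u 0 0) (row3 0 v 0) (row3 (- p / al) (- r / (2%:R * q)) 1).
  rewrite row3_comb => /row3_eq0[e0 e1]; rewrite !mulr0 mulr1 !add0r => z0.
  move: e0 e1; rewrite z0 !mul0r !mulr0 !addr0 add0r => /eqP e0 /eqP e1.
  by move: e0 e1; rewrite !mulf_eq0 (negbTE uN) (negbTE vN) !orbF => /eqP-> /eqP->.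
set h' := row3 _ _ 1 in BE.
suff [a1 [b1 [g1 h]]] : exists al be ga, hesse_form al be ga (gl_act B w1).
  by exists a1, b1, g1; apply: hesse_form_change h; exists B.
apply: (hesse_form_weierstrass k_char0 (symmetric_gl_act sym1 B)
  (a := 3%:R * tri w1 h' h' (row3 u 0 0)) (b := tri w1 h' h' h')).
- exact: polar_not_square_gl_act.
- exact: smooth_gl_act.
all: rewrite BE /= ?/h' ?tri_row3 //; rewrite ?h000 ?h111 ?h001 ?h110 ?h012 -/p -/q -/r.
- transitivity (u ^+ 3 * al); [ring | by rewrite uE mulVf].
- ring.
- ring.
- by field; rewrite ?two ?three ?qN ?alN.
- ring.
- transitivity (v ^+ 2 * q); last by rewrite vE; field; rewrite ?three ?qN.
  by field; rewrite ?two ?three ?qN ?alN.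
- by field; rewrite ?two ?three ?qN ?alN.
- by field; rewrite ?two ?three ?qN ?alN.
- ring.
Qed.

Lemma cubic_roots (p q : k) : exists y1 y2 y3,
  [/\ y1 + y2 + y3 = 0, y1 * y2 + y1 * y3 + y2 * y3 = p & y1 * y2 * y3 = - q].
Proof.
have [y yE] := @solve_monicpoly k 3 (nth 0 [:: - q; - p]) isT.
have [z zE] := @solve_monicpoly k 2 (nth 0 [:: - (y ^+ 2 + p); - y]) isT.
rewrite !big_ord_recl !big_ord0 /bump /= in yE zE.
have {}zE : z ^+ 2 + y * z + y ^+ 2 + p = 0 by rewrite zE; ring.
have {}yE : y ^+ 3 + p * y + q = 0 by rewrite yE; ring.
exists y, z, (- y - z); split.
- ring.
- by transitivity (p - (z ^+ 2 + y * z + y ^+ 2 + p)); [ring | rewrite zE subr0].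
- apply/eqP; rewrite -subr_eq0; apply/eqP.
  transitivity (y ^+ 3 + p * y + q - y * (z ^+ 2 + y * z + y ^+ 2 + p)); first by ring.
  by rewrite yE zE mulr0 subrr.
Qed.

(** The resultant of a quadratic and a depressed cubic, expressed by the coefficients alone. *)
Lemma resultant_roots (a b c y1 y2 y3 e2 e3 : k) :
  y1 + y2 + y3 = 0 -> y1 * y2 + y1 * y3 + y2 * y3 = e2 -> y1 * y2 * y3 = e3 ->
  (a * y1 ^+ 2 + b * y1 + c) * (a * y2 ^+ 2 + b * y2 + c) * (a * y3 ^+ 2 + b * y3 + c) =
  a ^+ 3 * e3 ^+ 2 + a ^+ 2 * b * e3 * e2 + a ^+ 2 * c * e2 ^+ 2 - 3%:R * a * b * c * e3
  - 2%:R * a * c ^+ 2 * e2 + b ^+ 3 * e3 + b ^+ 2 * c * e2 + c ^+ 3.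
Proof.
move=> /eqP; rewrite addr_eq0 => /eqP y3E <- <-.
have {y3E} -> : y3 = - (y1 + y2) by rewrite y3E opprK.
ring.
Qed.

(* The point (x, y, 1) lies on the cubic and on its Hessian; x is a root of the
   resultant in y of the two equations. *)
Lemma flex_coordinates (r s t : k) : r ^+ 3 != s ^+ 3 -> exists x y,
  x ^+ 3 + y ^+ 3 + 3%:R * r * x + 3%:R * s * y + t = 0 /\
  s * x * y ^+ 2 + (r * x ^+ 2 + t * x - r ^+ 2) * y - s ^+ 2 * x = 0.
Proof.
move=> rs.
(* The value of [resultant_roots] for the quadratic [D] below. It has degree 9 in [x] with leading
   coefficient [s ^+ 3 - r ^+ 3], nonzero by hypothesis. *)
pose N (x : k) := r ^+ 6 * t
  + (- (3%:R * r ^+ 4 * t ^+ 2) - 3%:R * r ^+ 4 * s ^+ 3 + 3%:R * r ^+ 7) * x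
  + (3%:R * r ^+ 2 * t ^+ 3 + 12%:R * r ^+ 2 * s ^+ 3 * t - 12%:R * r ^+ 5 * t) * x ^+ 2
  + (- t ^+ 4 - 8%:R * s ^+ 3 * t ^+ 2 - 16%:R * s ^+ 6 + 15%:R * r ^+ 3 * t ^+ 2
     + 24%:R * r ^+ 3 * s ^+ 3 - 8%:R * r ^+ 6) * x ^+ 3
  + (- (6%:R * r * t ^+ 3) - 24%:R * r * s ^+ 3 * t + 18%:R * r ^+ 4 * t) * x ^+ 4
  + (- (9%:R * r ^+ 2 * t ^+ 2) - 6%:R * r ^+ 2 * s ^+ 3 + 6%:R * r ^+ 5) * x ^+ 5
  + (- t ^+ 3 - 4%:R * s ^+ 3 * t - 4%:R * r ^+ 3 * t) * x ^+ 6
  - 3%:R * r * t ^+ 2 * x ^+ 7 - 3%:R * r ^+ 2 * t * x ^+ 8 + (s ^+ 3 - r ^+ 3) * x ^+ 9.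
have [x xE] : exists x, N x = 0.
  have d0 : r ^+ 3 - s ^+ 3 != 0 by rewrite subr_eq0.
  pose d := r ^+ 3 - s ^+ 3.
  have [x xE] := @solve_monicpoly k 9 (nth 0 [:: r ^+ 6 * t / d;
    (- (3%:R * r ^+ 4 * t ^+ 2) - 3%:R * r ^+ 4 * s ^+ 3 + 3%:R * r ^+ 7) / d;
    (3%:R * r ^+ 2 * t ^+ 3 + 12%:R * r ^+ 2 * s ^+ 3 * t - 12%:R * r ^+ 5 * t) / d;
    (- t ^+ 4 - 8%:R * s ^+ 3 * t ^+ 2 - 16%:R * s ^+ 6 + 15%:R * r ^+ 3 * t ^+ 2
     + 24%:R * r ^+ 3 * s ^+ 3 - 8%:R * r ^+ 6) / d;
    (- (6%:R * r * t ^+ 3) - 24%:R * r * s ^+ 3 * t + 18%:R * r ^+ 4 * t) / d;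
    (- (9%:R * r ^+ 2 * t ^+ 2) - 6%:R * r ^+ 2 * s ^+ 3 + 6%:R * r ^+ 5) / d;
    (- t ^+ 3 - 4%:R * s ^+ 3 * t - 4%:R * r ^+ 3 * t) / d;
    - (3%:R * r * t ^+ 2) / d; - (3%:R * r ^+ 2 * t) / d]) isT.
  rewrite !big_ord_recl !big_ord0 /bump /= in xE.
  by exists x; rewrite /N xE /d; field.
have [y1 [y2 [y3 [e1 e2 e3]]]] := cubic_roots (3%:R * s) (x ^+ 3 + 3%:R * r * x + t).
pose D y := s * x * y ^+ 2 + (r * x ^+ 2 + t * x - r ^+ 2) * y + - (s ^+ 2 * x).
have DN : D y1 * D y2 * D y3 = 0.
  rewrite -xE (resultant_roots _ _ _ e1 e2 e3) /N; ring.
have cubic y : y = y1 \/ y = y2 \/ y = y3 -> 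
    x ^+ 3 + y ^+ 3 + 3%:R * r * x + 3%:R * s * y + t = 0.
  move=> yi; transitivity ((y - y1) * (y - y2) * (y - y3)); last first.
    by case: yi => [|[|]] ->; rewrite subrr ?mulr0 ?mul0r.
  transitivity (y ^+ 3 - (y1 + y2 + y3) * y ^+ 2 + (y1 * y2 + y1 * y3 + y2 * y3) * y
    - y1 * y2 * y3); last by ring.
  by rewrite e1 e2 e3; ring.
move/eqP: DN; rewrite !mulf_eq0 => /orP[/orP[]|] /eqP D0; exists x.
- by exists y1; split=> //; apply: cubic; left.
- by exists y2; split=> //; apply: cubic; right; left.
- by exists y3; split=> //; apply: cubic; right; right.
Qed.
End SmoothHesse.

(** * Existence of a flex and the smooth case *)

Section HesseFormSmooth.
Variable k : closedFieldType.
Hypothesis k_char0 : [pchar k] =i pred0.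
Implicit Types (w : tensor3 k) (c g : 'rV[k]_3).

Lemma flex_pair w (r s : k) : symmetric_coefs w -> r != 0 -> s != 0 ->
  w [tuple vx; vx; vx] = 1 -> w [tuple vy; vy; vy] = 1 ->
  w [tuple vx; vx; vy] = 0 -> w [tuple vx; vx; vz] = 0 ->
  w [tuple vy; vy; vx] = 0 -> w [tuple vy; vy; vz] = 0 ->
  w [tuple vz; vz; vx] = r -> w [tuple vz; vz; vy] = s -> w [tuple vx; vy; vz] = 0 ->
  exists c g, [/\ c != 0, g != 0, forall a, tri w c g a = 0 & tri w g g g = 0].
Proof.
move=> sym rN sN h000 h111 h001 h002 h110 h112 h220 h221 h012.
have rowN (x y z : k) : ~ [/\ x = 0, y = 0 & z = 0] -> row3 x y z != 0.
  by move=> h; apply/eqP => /row3_eq0.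
have H := (h000, h111, h001, h002, h110, h112, h220, h221, h012).
have n01 : (1 : k) <> 0 by apply/eqP/oner_neq0.
have [rs|rs] := eqVneq (r ^+ 3) (s ^+ 3).
  (* Here the resultant drops in degree: a flex lies on the line where the third coordinate is 0. *)
  exists (row3 0 0 1), (row3 1 (- r / s) 0); split.
  - by apply: rowN => -[].
  - by apply: rowN => -[].
  - by move=> a; rewrite (row3P a) tri_row3 // !H; field; rewrite ?sN.
  - rewrite tri_row3 // !H; transitivity (1 - r ^+ 3 / s ^+ 3).
      by field; rewrite ?sN.
    by rewrite rs divff ?subrr // expf_neq0.
have [x [y [xy1 xy2]]] := flex_coordinates (w [tuple vz; vz; vz]) rs.
have PN : row3 x y 1 != 0 by apply: rowN => -[].
have PPP : tri w (row3 x y 1) (row3 x y 1) (row3 x y 1) = 0.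
  by rewrite tri_row3 // !H -[RHS]xy1; ring.
have [x0|xN] := eqVneq x 0.
  have y0 : y = 0.
    suff /eqP : r ^+ 2 * y = 0 by rewrite mulf_eq0 expf_eq0 (negbTE rN) => /eqP.
    by rewrite -[RHS]oppr0 -{1}xy2 x0; ring.
  exists (row3 s (- r) 0), (row3 x y 1); split=> //.
    by apply: rowN => -[/eqP]; rewrite (negbTE sN).
  by move=> a; rewrite (row3P a) tri_row3 // !H x0 y0; ring.
have yN : y != 0.
  apply/eqP => y0; suff /eqP : s ^+ 2 * x = 0.
    by rewrite mulf_eq0 expf_eq0 (negbTE sN) (negbTE xN).
  by rewrite -[RHS]oppr0 -{1}xy2 y0; ring.
(* A kernel vector of the polar form at [(x, y, 1)], read off from its rows [(x, 0, r)] and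
   [(0, y, s)]; the third row is the Hessian equation [xy2]. At x = y = 0 this vector would vanish,
   hence the separate case. *)
exists (row3 (- r * y) (- s * x) (x * y)), (row3 x y 1); split=> //.
  by apply: rowN => -[_ _ /eqP]; rewrite mulf_eq0 (negbTE xN) (negbTE yN).
move=> a; rewrite (row3P a) tri_row3 // !H.
transitivity (a 0 vz * 0 : k); last by rewrite mulr0.
by rewrite -[in RHS]xy2; ring.
Qed.

(** If neither member of a conjugate pair is a flex, both serve as axes and the cubic becomes x^3 +
    y^3 + 3 r x z^2 + 3 s y z^2 + t z^3. For r = 0 or s = 0 the polar form of an axis would be a
    square; otherwise [flex_pair] applies. *)
Lemma hesse_form_smooth w : symmetric_coefs w -> polar_not_square w -> smooth w ->
  exists al be ga, hesse_form al be ga w.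
Proof.
move=> sym ns sm; have [c [g [cN gN cg]]] := conjugate_pair w.
have [ccc|cccN] := eqVneq (tri w c c c) 0.
  by apply: (hesse_form_flex k_char0 sym ns sm gN cN) => // a; rewrite (triC sym).
have [ggg|gggN] := eqVneq (tri w g g g) 0.
  exact: (hesse_form_flex k_char0 sym ns sm cN gN).
have [w1 [ch [h000 h111] [h001 h110 h012]]] := conjugate_frame sym sm cN gN cg.
suff [al [be [ga h]]] : exists al be ga, hesse_form al be ga w1.
  by exists al, be, ga; apply: hesse_form_change ch h.
have [B Bu w1E] := ch.
have sym1 : symmetric_coefs w1 by rewrite -w1E; apply: symmetric_gl_act.
have ns1 : polar_not_square w1 by rewrite -w1E; apply: polar_not_square_gl_act.
have sm1 : smooth w1 by rewrite -w1E; apply: smooth_gl_act.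
move: (tri w c c c) (tri w g g g) cccN gggN h000 h111 => al be alN beN h000 h111.
move=> {w c g sym ns sm cN gN cg ch B Bu w1E}.
set p := w1 [tuple vx; vx; vz]; set q := w1 [tuple vy; vy; vz].
have [u uE] := cube_root al^-1; have [v vE] := cube_root be^-1.
have uN : u != 0.
  apply: contraNneq alN => u0; move/eqP: uE.
  by rewrite u0 expr0n eq_sym invr_eq0.
have vN : v != 0.
  apply: contraNneq beN => v0; move/eqP: vE.
  by rewrite v0 expr0n eq_sym invr_eq0.
have [x y z|B Bu BE] := @frame_change k w1 (row3 u 0 0) (row3 0 v 0) (row3 (- p / al) (- q / be) 1).
  rewrite row3_comb => /row3_eq0[e0 e1]; rewrite !mulr0 mulr1 !add0r => z0.
  move: e0 e1; rewrite z0 !mul0r !mulr0 !addr0 add0r => /eqP e0 /eqP e1.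
  by move: e0 e1; rewrite !mulf_eq0 (negbTE uN) (negbTE vN) !orbF => /eqP-> /eqP->.
set h' := row3 _ _ 1 in BE.
suff [a1 [b1 [g1 h]]] : exists al be ga, hesse_form al be ga (gl_act B w1).
  by exists a1, b1, g1; apply: hesse_form_change h; exists B.
have sym2 := symmetric_gl_act sym1 B.
have ns2 := polar_not_square_gl_act Bu ns1.
have sm2 := smooth_gl_act Bu sm1.
have k000 : gl_act B w1 [tuple vx; vx; vx] = 1.
  rewrite BE /= tri_row3 // h000 h111 h001 h110 h012.
  by transitivity (u ^+ 3 * al); [ring | rewrite uE mulVf].
have k111 : gl_act B w1 [tuple vy; vy; vy] = 1.
  rewrite BE /= tri_row3 // h000 h111 h001 h110 h012.
  by transitivity (v ^+ 3 * be); [ring | rewrite vE mulVf].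
have k001 : gl_act B w1 [tuple vx; vx; vy] = 0.
  by rewrite BE /= tri_row3 // h000 h111 h001 h110 h012; ring.
have k110 : gl_act B w1 [tuple vy; vy; vx] = 0.
  by rewrite BE /= tri_row3 // h000 h111 h001 h110 h012; ring.
have k002 : gl_act B w1 [tuple vx; vx; vz] = 0.
  by rewrite BE /= tri_row3 // h000 h111 h001 h110 h012 -/p -/q; field; rewrite ?alN ?beN.
have k112 : gl_act B w1 [tuple vy; vy; vz] = 0.
  by rewrite BE /= tri_row3 // h000 h111 h001 h110 h012 -/p -/q; field; rewrite ?alN ?beN.
have k012 : gl_act B w1 [tuple vx; vy; vz] = 0.
  by rewrite BE /= tri_row3 // h000 h111 h001 h110 h012 -/p -/q; field; rewrite ?alN ?beN.
move: (gl_act B w1) sym2 ns2 sm2 k000 k111 k001 k110 k002 k112 k012 => w2.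
move=> sym2 ns2 sm2 k000 k111 k001 k110 k002 k112 k012.
have rN : w2 [tuple vz; vz; vx] != 0.
  apply/eqP => r0; have [] := @polar_not_square_coords k w2 sym2 1 0 0 1 0 0 ns2;
    rewrite ?k000 ?k111 ?k001 ?k110 ?k002 ?k112 ?k012 ?r0; try ring.
  by move/eqP; rewrite oner_eq0.
have sN : w2 [tuple vz; vz; vy] != 0.
  apply/eqP => r0; have [] := @polar_not_square_coords k w2 sym2 0 1 0 0 1 0 ns2;
    rewrite ?k000 ?k111 ?k001 ?k110 ?k002 ?k112 ?k012 ?r0; try ring.
  by move=> _ /eqP; rewrite oner_eq0.
have [c [g [cN gN cg ggg]]] :=
  flex_pair sym2 rN sN k000 k111 k001 k002 k110 k112 erefl erefl k012.
exact: (hesse_form_flex k_char0 sym2 ns2 sm2 cN gN cg ggg).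
Qed.

End HesseFormSmooth.

(** * Rescaling Hesse forms to the four types *)

Section NormalForms.
Variable k : closedFieldType.
Hypothesis k_char0 : [pchar k] =i pred0.
Implicit Types (w : tensor3 k) (a b c : 'rV[k]_3).

Lemma cube_neq0 (x : k) : x ^+ 3 != 0 -> x != 0.
Proof. by rewrite expf_eq0. Qed.

Lemma monE (a b c i j l : 'I_3) :
  mon k a b c [tuple i; j; l] = [&& i == a, j == b & l == c]%:R.
Proof. by rewrite ffunE -val_eqE /= !eqseq_cons andbT. Qed.

Lemma pot_S_coef i j l : pot_S k [tuple i; j; l] = hesse_coef 0 0 0 i j l.
Proof.
rewrite /pot_S !ffunE -!val_eqE /= !eqseq_cons !andbT.
by case: (ord3P i) => ->; case: (ord3P j) => ->; case: (ord3P l) => ->;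
  rewrite /hesse_coef /= ?addr0 ?add0r.
Qed.

Lemma hesse_coefD (al be ga : k) i j l : hesse_coef al be ga i j l = hesse_coef 0 0 0 i j l
  + (al * [&& i == vx, j == vx & l == vx]%:R + be * [&& i == vy, j == vy & l == vy]%:R
     + ga * [&& i == vz, j == vz & l == vz]%:R).
Proof.
by case: (ord3P i) => ->; case: (ord3P j) => ->; case: (ord3P l) => ->;
  rewrite /hesse_coef /= ?mulr0 ?mulr1 ?addr0 ?add0r.
Qed.

Lemma pot_S'_coef i j l : pot_S' k [tuple i; j; l] = hesse_coef 1 0 0 i j l.
Proof.
rewrite /pot_S' [LHS]ffunE pot_S_coef monE [RHS]hesse_coefD.
by rewrite !mul0r !addr0 mul1r.
Qed.

Lemma pot_NC_coef i j l : pot_NC k [tuple i; j; l] = hesse_coef 1 1 0 i j l.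
Proof.
rewrite /pot_NC [LHS]ffunE [X in X + _]ffunE pot_S_coef !monE [RHS]hesse_coefD.
by rewrite mul0r addr0 !mul1r addrA.
Qed.

Lemma pot_EC_coef (xi : k) i j l : pot_EC xi [tuple i; j; l] = hesse_coef xi xi xi i j l.
Proof.
rewrite /pot_EC [LHS]ffunE pot_S_coef [RHS]hesse_coefD; congr (_ + _).
by rewrite !(ffunE, monE) /= -!val_eqE /= !eqseq_cons !andbT -!mulrDr.
Qed.

Lemma tri_hesse w al be ga p0 p1 p2 q0 q1 q2 r0 r1 r2 :
  (forall i j l, w [tuple i; j; l] = hesse_coef al be ga i j l) ->
  tri w (row3 p0 p1 p2) (row3 q0 q1 q2) (row3 r0 r1 r2) =
  p0 * q0 * r0 * al + p1 * q1 * r1 * be + p2 * q2 * r2 * ga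
  + (p0 * q1 * r2 + p0 * q2 * r1 + p1 * q0 * r2 + p1 * q2 * r0
     + p2 * q0 * r1 + p2 * q1 * r0).
Proof.
move=> wE; rewrite tri_row3; last exact: hesse_symmetric wE.
by rewrite !wE /hesse_coef /= !mulr0 !addr0 mulr1.
Qed.

Lemma hesse_form_scale al be ga x y z w : x * y * z = 1 -> hesse_form al be ga w ->
  hesse_form (x ^+ 3 * al) (y ^+ 3 * be) (z ^+ 3 * ga) w.
Proof.
move=> xyz [w' ww' w'E]; apply: hesse_form_change ww' _.
have := @hesse_form_frame k w' (row3 x 0 0) (row3 0 y 0) (row3 0 0 z) 1 (hesse_symmetric w'E).
rewrite !(tri_hesse _ _ _ _ _ _ _ _ _ w'E) expr1n divr1.
have -> : x * x * x * al + 0 * 0 * 0 * be + 0 * 0 * 0 * ga + (x * 0 * 0 + x * 0 * 0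
  + 0 * x * 0 + 0 * 0 * x + 0 * x * 0 + 0 * 0 * x) = x ^+ 3 * al by ring.
have -> : 0 * 0 * 0 * al + y * y * y * be + 0 * 0 * 0 * ga + (0 * y * 0 + 0 * 0 * y
  + y * 0 * 0 + y * 0 * 0 + 0 * 0 * y + 0 * y * 0) = y ^+ 3 * be by ring.
have -> : 0 * 0 * 0 * al + 0 * 0 * 0 * be + z * z * z * ga + (0 * 0 * z + 0 * z * 0
  + 0 * 0 * z + 0 * z * 0 + z * 0 * 0 + z * 0 * 0) = z ^+ 3 * ga by ring.
by apply; rewrite ?oner_neq0 // -?xyz; ring.
Qed.

Lemma hesse_form_swap al be ga w : hesse_form al be ga w -> hesse_form be al ga w.
Proof.
move=> [w' ww' w'E]; apply: hesse_form_change ww' _.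
have := @hesse_form_frame k w' (row3 0 1 0) (row3 1 0 0) (row3 0 0 1) 1 (hesse_symmetric w'E).
rewrite !(tri_hesse _ _ _ _ _ _ _ _ _ w'E) expr1n divr1.
rewrite !mulr0 !mul0r !mulr1 !addr0 !add0r !mul1r.
by apply; rewrite ?oner_neq0.
Qed.

Lemma hesse_form_rot al be ga w : hesse_form al be ga w -> hesse_form be ga al w.
Proof.
move=> [w' ww' w'E]; apply: hesse_form_change ww' _.
have := @hesse_form_frame k w' (row3 0 1 0) (row3 0 0 1) (row3 1 0 0) 1 (hesse_symmetric w'E).
rewrite !(tri_hesse _ _ _ _ _ _ _ _ _ w'E) expr1n divr1.
rewrite !mulr0 !mul0r !mulr1 !addr0 !add0r !mul1r.
by apply; rewrite ?oner_neq0.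
Qed.

(** Cube roots of xi / al and xi / be scale the first two axes. The third scale is forced by x y z =
    1, and its cube is xi / ga because xi^3 = al be ga. *)
Lemma hesse_form_balance al be ga xi w : al != 0 -> be != 0 -> ga != 0 ->
  xi ^+ 3 = al * be * ga -> hesse_form al be ga w -> hesse_form xi xi xi w.
Proof.
move=> alN beN gaN xiE h.
have xiN : xi != 0 by apply: cube_neq0; rewrite xiE !mulf_neq0.
have [x xE] := cube_root (xi / al); have [y yE] := cube_root (xi / be).
have xN : x != 0 by apply: cube_neq0; rewrite xE mulf_neq0 ?invr_eq0.
have yN : y != 0 by apply: cube_neq0; rewrite yE mulf_neq0 ?invr_eq0.
have := @hesse_form_scale al be ga x y (x * y)^-1 w (divff (mulf_neq0 xN yN)) h.
rewrite exprVn exprMn xE yE !divfK //.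
suff -> : (xi / al * (xi / be))^-1 * ga = xi by [].
transitivity (xi ^+ 3 / xi ^+ 2); last by field.
by rewrite xiE; field; rewrite ?alN ?beN ?xiN.
Qed.

(** For the product -8 the balanced form has xi = -2, and then (1, 1, 1) is a singular vector. *)
Lemma hesse_form_smooth_prod al be ga w : smooth w -> hesse_form al be ga w ->
  al * be * ga != - 8%:R.
Proof.
move=> sm h; apply/eqP => e.
have : al * be * ga != 0 by rewrite e oppr_eq0 ((pcharf0P k).1 k_char0).
rewrite !mulf_eq0 !negb_or => /andP[/andP[alN beN] gaN].
have [|w' [g gu w'E] w'c] := hesse_form_balance alN beN gaN (xi := - 2%:R) _ h.
  by rewrite e; ring.
have sm' : smooth w' by rewrite -w'E; apply: smooth_gl_act.
have [|/eqP] := @row3_eq0 k 1 1 1; last by rewrite oner_eq0.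
by apply: sm' => a; rewrite (row3P a) (tri_hesse _ _ _ _ _ _ _ _ _ w'c); ring.
Qed.

(** For xi^3 = 1 the polar form at (1, 1, xi) is the square of (y, y, 1/y) with y^2 = xi. *)
Lemma hesse_form_polar_not_square xi w : polar_not_square w -> hesse_form xi xi xi w ->
  xi ^+ 3 <> 1.
Proof.
move=> ns [w' [g gu w'E] w'c] x3.
have ns' : polar_not_square w' by rewrite -w'E; apply: polar_not_square_gl_act.
have xN : xi != 0.
  by apply/eqP => x0; move/eqP: x3; rewrite x0 expr0n eq_sym oner_eq0.
have [y yE] := square_root xi.
have yN : y != 0 by rewrite -sqrf_eq0 yE.
have [] := @polar_not_square_coords k w' (hesse_symmetric w'c) 1 1 xi y y y^-1 ns';
  rewrite ?w'c /hesse_coef /= ?mulr0 ?mulr1 ?mul1r ?addr0 ?add0r -?expr2 ?yE ?mulfV //.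
- by rewrite exprVn yE; apply: (mulfI xN); rewrite -exprS x3 mulfV.
- by move/eqP; rewrite oner_eq0.
Qed.

(** The values -2 and 1 + s, 1 - s are the cube roots of -8, by the factorisation xi^3 + 8 = (xi +
    2) ((xi - 1)^2 + 3). *)
Lemma EC_parameterP (xi : k) :
  EC_parameter xi <-> [/\ xi != 0, xi ^+ 3 != - 8%:R & xi ^+ 3 <> 1].
Proof.
split=> [[/eqP x0 x2 xs x3]|[/eqP x0 /eqP x8 x3]].
  split=> //; apply/eqP => x8.
  have : (xi + 2%:R) * ((xi - 1) ^+ 2 + 3%:R) = 0.
    by transitivity (xi ^+ 3 + 8%:R); [ring | rewrite x8 addNr].
  move/eqP; rewrite mulf_eq0 !addr_eq0 => /orP[/eqP //|/eqP/xs[/eqP]].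
  by rewrite addrC subrK eqxx.
split=> // [xE|s s2]; first by apply: x8; rewrite xE; ring.
have e (t : k) : t ^+ 2 = - 3%:R -> (1 + t) ^+ 3 = - 8%:R.
  move=> t2; transitivity (1 + 3%:R * t + (3%:R + t) * t ^+ 2); first by ring.
  by rewrite t2; ring.
split=> xE; apply: x8; rewrite xE; first exact: e.
by apply: e; rewrite sqrrN.
Qed.

Lemma hesse_form_type (al be ga : k) w : polar_not_square w -> al * be * ga != - 8%:R ->
  hesse_form al be ga w ->
  exists ty, exists2 w', has_type ty w' & linear_change w w'.
Proof.
move=> ns e8 h.
(* The compensating scale falls on the second coefficient, which is 0 in each application. *)
have one u v x w1 : hesse_form u v x w1 -> u != 0 -> exists y, hesse_form 1 (v * y) x w1.
  move=> h1 uN; have [y yE] := cube_root u^-1.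
  have yN : y != 0 by apply: cube_neq0; rewrite yE invr_eq0.
  have y1 : y * y^-1 * 1 = 1 by rewrite mulfV ?mulr1.
  by exists (y^-1 ^+ 3); have := hesse_form_scale y1 h1; rewrite yE mulVf // expr1n mul1r mulrC.
have typ w1 (u v x : k) (pot : tensor3 k) : (forall i j l, pot [tuple i; j; l] = hesse_coef u v x i j l) ->
    hesse_form u v x w1 -> linear_change w1 pot.
  move=> potE [w' ww' w'E]; suff <- : w' = pot by [].
  by apply: tensor3P => i j l; rewrite w'E potE.
have two u v w1 : hesse_form u v 0 w1 ->
    exists ty, exists2 w', has_type ty w' & linear_change w1 w'.
  have [->|uN] := eqVneq u 0; have [->|vN] := eqVneq v 0 => h1.
  - by exists TypeS, (pot_S k) => //; apply: typ pot_S_coef h1.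
  - have [y] := one _ _ _ _ (hesse_form_swap h1) vN; rewrite mul0r => h2.
    by exists TypeS', (pot_S' k) => //; apply: typ pot_S'_coef h2.
  - have [y] := one _ _ _ _ h1 uN; rewrite mul0r => h2.
    by exists TypeS', (pot_S' k) => //; apply: typ pot_S'_coef h2.
  - have [x xE] := cube_root u^-1; have [y yE] := cube_root v^-1.
    have xN : x != 0 by apply: cube_neq0; rewrite xE invr_eq0.
    have yN : y != 0 by apply: cube_neq0; rewrite yE invr_eq0.
    have := @hesse_form_scale u v 0 x y (x * y)^-1 w1 (divff (mulf_neq0 xN yN)) h1.
    rewrite xE yE !mulVf // mulr0 => h2.
    by exists TypeNC, (pot_NC k) => //; apply: typ pot_NC_coef h2.
have [al0|alN] := eqVneq al 0.
  by rewrite al0 in h; apply: two (hesse_form_rot h).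
have [be0|beN] := eqVneq be 0.
  by rewrite be0 in h; apply: two (hesse_form_rot (hesse_form_rot h)).
have [ga0|gaN] := eqVneq ga 0; first by rewrite ga0 in h; apply: two h.
have [xi xiE] := cube_root (al * be * ga).
have h1 := hesse_form_balance alN beN gaN xiE h.
exists TypeEC, (pot_EC xi); last exact: typ (pot_EC_coef xi) h1.
exists xi => //; apply/EC_parameterP; split.
- by apply: cube_neq0; rewrite xiE !mulf_neq0.
- by rewrite xiE.
- exact: hesse_form_polar_not_square ns h1.
Qed.
End NormalForms.

(** * Existence and uniqueness of the type *)

Section Classification.
Variable k : closedFieldType.
Hypothesis k_char0 : [pchar k] =i pred0.
Implicit Types (w : tensor3 k) (a b c : 'rV[k]_3).

Lemma potential_type_exists w : symmetric_coefs w -> polar_not_square w ->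
  exists ty, exists2 w', has_type ty w' & linear_change w w'.
Proof.
move=> sym ns; have [sm|] := pselect (smooth w).
  have [al [be [ga h]]] := hesse_form_smooth k_char0 sym ns sm.
  apply: (hesse_form_type ns _ h).
  exact: (hesse_form_smooth_prod k_char0 sm h).
move=> /existsNP[s /not_implyP[ss /eqP sN]].
have [be [ga h]] := hesse_form_singular k_char0 sym ns sN ss.
apply: (hesse_form_type ns _ h).
by rewrite !mul0r eq_sym oppr_eq0 ((pcharf0P k).1 k_char0).
Qed.

Definition singular_vector w c := forall a, tri w c c a = 0.

Definition singular_rank w n := exists A : 'M[k]_3,
  [/\ \rank A = n, forall i, singular_vector w (row i A)
    & forall c, singular_vector w c -> (c <= A)%MS].

Lemma singular_rank_uniq w m n : singular_rank w m -> singular_rank w n -> m = n.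
Proof.
move=> [A [<- A1 A2]] [B [<- B1 B2]]; apply/eqP; rewrite eqn_leq.
by apply/andP; split; apply: mxrankS; apply/row_subP => i; [apply: B2 | apply: A2].
Qed.

Lemma singular_rank_linear_change w w' n :
  linear_change w w' -> singular_rank w' n -> singular_rank w n.
Proof.
move=> [g gu <-] [A [rA A1 A2]]; exists (A *m g); split.
- by rewrite mxrankMfree // row_free_unit.
- by move=> i a; rewrite row_mul -[a](mulmxKV gu) -tri_gl_act A1.
- move=> c c0; rewrite -[c](mulmxKV gu); apply: submxMr; apply: A2 => a.
  by rewrite tri_gl_act mulmxKV.
Qed.

Lemma singular_hesseP w al be ga c :
  (forall i j l, w [tuple i; j; l] = hesse_coef al be ga i j l) ->
  singular_vector w c <->
  [/\ al * c 0 vx ^+ 2 + 2%:R * c 0 vy * c 0 vz = 0,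
      be * c 0 vy ^+ 2 + 2%:R * c 0 vx * c 0 vz = 0
    & ga * c 0 vz ^+ 2 + 2%:R * c 0 vx * c 0 vy = 0].
Proof.
move=> wE; rewrite {1}(row3P c); set x := c 0 vx; set y := c 0 vy; set z := c 0 vz.
split=> [h|[h0 h1 h2] a].
  split; [rewrite -[RHS](h (row3 1 0 0)) | rewrite -[RHS](h (row3 0 1 0))
         | rewrite -[RHS](h (row3 0 0 1))]; rewrite (tri_hesse _ _ _ _ _ _ _ _ _ wE); ring.
rewrite (row3P a) (tri_hesse _ _ _ _ _ _ _ _ _ wE).
move: (a 0 vx) (a 0 vy) (a 0 vz) => a0 a1 a2.
transitivity (a0 * 0 + a1 * 0 + a2 * 0 : k); last by rewrite !mulr0 !addr0.
by rewrite -{1}h0 -{1}h1 -h2; ring.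
Qed.

Definition type_index (ty : potential_type) : nat :=
  match ty with TypeS => 0 | TypeS' => 1 | TypeNC => 2 | TypeEC => 3 end%N.

(* [copid_mx r] spans the last [3 - r] basis vectors. *)
Lemma singular_rank_copid w r : (r <= 3)%N ->
  (forall i : 'I_3, (r <= i)%N -> singular_vector w (delta_mx 0 i)) ->
  (forall c, singular_vector w c -> forall i : 'I_3, (i < r)%N -> c 0 i = 0) ->
  singular_rank w (3 - r)%N.
Proof.
move=> r3 h1 h2; exists (copid_mx r); split.
- by rewrite rank_copid_mx.
- move=> i; rewrite rowE mulmxBr mulmx1; case: (leqP r i) => ri.
    rewrite (_ : _ *m _ = 0) ?subr0; first exact: h1.
    by apply/rowP => j; rewrite -rowE !mxE (ltnNge i) ri andbF.
  rewrite (_ : _ *m _ = delta_mx 0 i) ?subrr.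
    by move=> a; rewrite -(scale0r 0) triZl mul0r.
  by apply/rowP => j; rewrite -rowE !mxE ri andbT eqxx eq_sym.
- move=> c /h2 c0; rewrite (_ : c = c *m copid_mx r) ?submxMl //.
  rewrite mulmxBr mulmx1 (_ : c *m _ = 0) ?subr0 //.
  apply/rowP => j; rewrite !mxE big1 // => i _; rewrite mxE.
  by case: (ltnP i r) => ir; rewrite ?andbF ?mulr0 // c0 ?mul0r.
Qed.

Lemma type_singular_rank ty w : has_type ty w -> singular_rank w (3 - type_index ty)%N.
Proof.
have two : 2%:R != 0 :> k := two_neq0 k_char0.
have sq0 (x : k) : x ^+ 2 = 0 -> x = 0 by move/eqP; rewrite sqrf_eq0 => /eqP.
have pr0 (x y : k) : 2%:R * x * y = 0 -> x = 0 \/ y = 0.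
  move/eqP; rewrite -mulrA mulf_eq0 (negbTE two) /= mulf_eq0.
  by move=> /orP[] /eqP h; [left | right].
case: ty => /= [->|->|->|[xi /(EC_parameterP)[xN x8 _] ->]];
  apply: singular_rank_copid => //.
- move=> i _; apply/(singular_hesseP _ (@pot_S_coef k)); rewrite !mxE.
  by case: (ord3P i) => ->; rewrite /= ?mulr0 ?mul0r ?mulr0 ?mul0r ?addr0.
- move=> i i1; apply/(singular_hesseP _ (@pot_S'_coef k)); rewrite !mxE.
  by case: (ord3P i) i1 => -> //= _; rewrite ?expr0n /= ?mulr0 ?mul0r ?mulr0 ?mul0r ?addr0.
- move=> c /(singular_hesseP _ (@pot_S'_coef k))[]; rewrite !mul0r !add0r mul1r => e0 e1 e2.
  move=> i; case: (ord3P i) => -> //= _; case: (pr0 _ _ e1) => // z0.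
  by apply: sq0; move: e0; rewrite z0 mulr0 addr0.
- move=> i i1; apply/(singular_hesseP _ (@pot_NC_coef k)); rewrite !mxE.
  by case: (ord3P i) i1 => -> //= _; rewrite ?expr0n /= ?mulr0 ?mul0r ?mulr0 ?mul0r ?addr0.
- move=> c /(singular_hesseP _ (@pot_NC_coef k))[]; rewrite !mul0r !add0r !mul1r => e0 e1 e2.
  have [x0 y0] : c 0 vx = 0 /\ c 0 vy = 0.
    case: (pr0 _ _ e2) => h; split=> //; apply: sq0.
    + by move: e1; rewrite h mulr0 mul0r addr0.
    + by move: e0; rewrite h mulr0 mul0r addr0.
  by move=> i; case: (ord3P i) => ->.
- by move=> i; rewrite leqNgt ltn_ord.
- move=> c /(singular_hesseP _ (pot_EC_coef xi))[].
  set x := c 0 vx; set y := c 0 vy; set z := c 0 vz => e0 e1 e2.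
  have sq u v : xi * u ^+ 2 + v = 0 -> v = 0 -> u = 0.
    move=> + v0; rewrite v0 addr0 => /eqP.
    by rewrite mulf_eq0 (negbTE xN) sqrf_eq0 => /eqP.
  (* Multiplying the three equations gives xi^3 (xyz)^2 = -8 (xyz)^2, so a coordinate vanishes, and
     then the others do. *)
  have [xyz0|xyzN] := eqVneq (x * y * z) 0; last first.
    case/eqP: x8; apply: (mulIf (expf_neq0 2 xyzN)).
    transitivity ((xi * x ^+ 2) * (xi * y ^+ 2) * (xi * z ^+ 2)); first by ring.
    move/eqP: e0; rewrite addr_eq0 => /eqP ->; move/eqP: e1; rewrite addr_eq0 => /eqP ->.
    by move/eqP: e2; rewrite addr_eq0 => /eqP ->; ring.
  move/eqP: xyz0; rewrite !mulf_eq0 -orbA => /or3P[] /eqP h.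
  + have y0 : y = 0 by apply: sq e1 _; rewrite h mulr0 mul0r.
    have z0 : z = 0 by apply: sq e2 _; rewrite h mulr0 mul0r.
    by move=> i; case: (ord3P i) => ->.
  + have x0 : x = 0 by apply: sq e0 _; rewrite h mulr0 mul0r.
    have z0 : z = 0 by apply: sq e2 _; rewrite h mulr0.
    by move=> i; case: (ord3P i) => ->.
  + have x0 : x = 0 by apply: sq e0 _; rewrite h mulr0.
    have y0 : y = 0 by apply: sq e1 _; rewrite h mulr0.
    by move=> i; case: (ord3P i) => ->.
Qed.

Lemma type_unique w ty ty' w1 w2 : has_type ty w1 -> linear_change w w1 ->
  has_type ty' w2 -> linear_change w w2 -> ty = ty'.
Proof.
move=> /type_singular_rank h1 c1 /type_singular_rank h2 c2.
have := singular_rank_uniq (singular_rank_linear_change c1 h1)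
                           (singular_rank_linear_change c2 h2).
by case: ty {h1}; case: ty' {h2}.
Qed.

Lemma type_hesse_coef ty w : has_type ty w -> exists al be ga,
  al * be * ga != 1 /\ forall i j l, w [tuple i; j; l] = hesse_coef al be ga i j l.
Proof.
have n01 : (0 : k) != 1 by rewrite eq_sym oner_eq0.
case: ty => /= [->|->|->|[xi [_ _ _ /eqP x3] ->]].
- by exists 0, 0, 0; rewrite mulr0; split=> //; exact: pot_S_coef.
- by exists 1, 0, 0; rewrite mulr0; split=> //; exact: pot_S'_coef.
- by exists 1, 1, 0; rewrite mulr0; split=> //; exact: pot_NC_coef.
- by exists xi, xi, xi; split; [rewrite -expr2 -exprSr | exact: pot_EC_coef].
Qed.
End Classification.

Theorem lemma3p5 (k : closedFieldType) (k_char0 : [pchar k] =i pred0) :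
  (forall w : tensor3 k,
     symmetric_potential w -> regular_potential w -> twisted_superpotential w ->
     exists! ty : potential_type,
       exists2 w' : tensor3 k, has_type ty w' & linear_change w w') /\
  (forall (ty : potential_type) (w : tensor3 k),
     has_type ty w ->
     [/\ symmetric_potential w, regular_potential w & superpotential w]).
Proof.
split=> [w /symmetric_potentialP sym reg _|ty w /type_hesse_coef[al [be [ga [abc wE]]]]].
  have [ty [w1 t1 c1]] := potential_type_exists k_char0 sym (regular_polar_not_square sym reg).
  exists ty; split=> [|ty' [w2 t2 c2]]; first by exists w1.
  exact: (type_unique k_char0 t1 c1 t2 c2).
have sym := hesse_symmetric wE.
split; [exact/symmetric_potentialP | exact: (hesse_regular abc wE) | exact: symmetric_superpotential].
Qed.
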